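(* For every even integer $n$, there exists a network $\mathcal{N}=(\mathcal{G},(\tau_e)_{e\in E},(\gamma_e)_{e\in E})$ in which $\mathcal{G}$ has $n$ vertices such that, with $\gamma$ denoting the capacity of $\mathcal{N}$, $$\mathsf{PoA}(\mathcal{N},\gamma)=\mathsf{BR}(\mathcal{N},\gamma)=n-1,\qquad \mathsf{PoS}(\mathcal{N},\gamma)=1 .$$
   Context: **Network.** $\mathbb{N}=\{0,1,2,\dots\}$, $\mathbb{N}_{+}=\{1,2,\dots\}$. A network $\mathcal{N}=(\mathcal{G},(\tau_e)_{e\in E},(\gamma_e)_{e\in E})$ consists of a finite directed multigraph $\mathcal{G}=(V,E)$ and, for each edge $e$, a free-flow transit cost $\tau_e\in\mathbb{N}$ and a capacity $\gamma_e\in\mathbb{N}$. A path is a finite sequence of edges $(e_1,\dots,e_m)$ with the head of $e_i$ equal to the tail of $e_{i+1}$. There is a unique source $s$ (only outgoing edges) and a unique destination $d$ (only incoming edges), and for each vertex $v\ne s,d$ there is a path from $s$ to $v$ and a path from $v$ to $d$. A route is a path from $s$ to $d$; $\mathcal{R}$ is the set of routes. A cut is a set $C\subseteq E$ meeting every route, with capacity $\sum_{e\in C}\gamma_e$; the capacity $\gamma$ of $\mathcal{N}$ is the minimum capacity of a cut. **Game $\Gamma(\mathcal{N},\delta)$.** Time is discrete. At each stage $t\in\mathbb{N}_{+}$ a generation $G_t$ of $\delta$ players departs from $s$; $[it]$ denotes the $i$-th player of $G_t$, and $G=\bigcup_t G_t$. Priority: $[js]\lhd[it]$ iff $s<t$,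 or $s=t$ and $j<i$. Each player chooses a route; a strategy profile is $\sigma\in\mathcal{R}^{G}$. Player $[it]$ enters the first edge of her route at time $t$. A player entering edge $e$ at time $u$ reaches its head at time $u+\tau_e$, where there may be a queue. Players in the queue of $e$ are ordered by time of entry into $e$, ties being broken by the priority $\lhd$ (no overtaking). At each stage at most $\gamma_e$ players, the first ones in the queue, exit $e$: a player who has reached the head exits at that stage if fewer than $\gamma_e$ players are in the queue ahead of her, and otherwise waits one stage and the process repeats. A player exiting $e$ at some stage enters the next edge of her route at the same stage, or leaves the system if she is at $d$. **Latencies.** The latency of $[it]$ is $\ell_{it}(\sigma)=c_{it}(\sigma)+w_{it}(\sigma)$, where $c_{it}(\sigma)$ is the sum of $\tau_e$ over the edges of her route and $w_{it}(\sigma)$ is the total number of stages she spends waiting in queues. Put $\ell_t(\sigma)=\sum_{[it]\in G_t}\ell_{it}(\sigma)$ and $\bar L_T(\sigma)=\frac1T\sum_{t=1}^{T}\ell_t(\sigma)$. **Optimum.** $\sigma$ is socially optimal if $\liminf_{T\to\infty}\bar L_T(\sigma')\ge\limsup_{T\to\infty}\bar L_T(\sigma)$ for all $\sigma'\in\mathcal{R}^G$; $\mathsf{Opt}(\mathcal{N},\delta)$ is the common value $\liminf_{T\to\infty}\bar L_T(\sigma)=\limsup_{T\to\infty}\bar L_T(\sigma)$ for socially optimal $\sigma$. **Equilibrium.** $\sigma$ is a Nash equilibrium if $\ell_{it}(\sigma)\le\ell_{it}(\sigma'_{it},\sigma_{-it})$ for every player $[it]\in G$ and every $\sigma'_{it}\in\mathcal{R}$,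 where $\sigma_{-it}$ is the profile of strategies of all players other than $[it]$. A Nash equilibrium is a uniformly fastest route (UFR) equilibrium if for every player $[it]$ and every vertex $v$ on her route $\sigma_{it}$ there is no alternative route $\sigma'_{it}$ that allows $[it]$ to arrive at $v$ earlier than under $\sigma_{it}$. $\mathcal{E}(\mathcal{N},\delta)$ is the set of UFR equilibria. Put $$\mathsf{WEq}(\mathcal{N},\delta)=\sup_{\sigma\in\mathcal{E}(\mathcal{N},\delta)}\limsup_{T\to\infty}\bar L_T(\sigma),\qquad \mathsf{BEq}(\mathcal{N},\delta)=\inf_{\sigma\in\mathcal{E}(\mathcal{N},\delta)}\limsup_{T\to\infty}\bar L_T(\sigma).$$ **Efficiency measures** (for the game $\Gamma(\mathcal{N},\gamma)$, i.e. with inflow equal to the capacity). $\mathsf{PoA}(\mathcal{N},\gamma)=\mathsf{WEq}(\mathcal{N},\gamma)/\mathsf{Opt}(\mathcal{N},\gamma)$ is the price of anarchy; $\mathsf{PoS}(\mathcal{N},\gamma)=\mathsf{BEq}(\mathcal{N},\gamma)/\mathsf{Opt}(\mathcal{N},\gamma)$ is the price of stability; the Braess ratio $\mathsf{BR}(\mathcal{N},\gamma)$ is the largest factor by which the removal of one or more edges can improve the latency of traffic in an equilibrium flow. *)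

(* Defs.v *)
From mathcomp Require Import all_boot all_order all_algebra.
From mathcomp Require Import all_classical all_reals all_analysis.

Set Implicit Arguments.
Unset Strict Implicit.
Unset Printing Implicit Defensive.

Import Order.TTheory GRing.Theory Num.Theory.

Local Open Scope ring_scope.
Local Open Scope nat_scope.

(* The edges of the multigraph form a subset [edges] of a finite type of labels,
   so that deleting edges changes neither that type nor the type of profiles. *)
Record prenetwork := Prenetwork {
  vertex : finType;
  edge : finType;
  edges : {set edge};
  tail : edge -> vertex;
  head : edge -> vertex;
  source : vertex;
  dest : vertex;
  transit : edge -> nat;
  capacity : edge -> nat
}.

(* Walks may revisit vertices and edges; the empty walk joins u to itself. *)
Fixpoint walk (N : prenetwork) (u : vertex N) (r : seq (edge N))
    (v : vertex N) : bool :=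
  if r is e :: r' then [&& e \in edges N, tail e == u & walk (head e) r' v]
  else u == v.

Definition is_route (N : prenetwork) (r : seq (edge N)) : bool :=
  walk (source N) r (dest N).

Definition only_outgoing (N : prenetwork) (v : vertex N) : Prop :=
  forall e, e \in edges N -> head e != v.

Definition only_incoming (N : prenetwork) (v : vertex N) : Prop :=
  forall e, e \in edges N -> tail e != v.

Definition is_network (N : prenetwork) : Prop :=
  [/\ source N != dest N,
      (forall v : vertex N, only_outgoing v <-> v = source N),
      (forall v : vertex N, only_incoming v <-> v = dest N) &
      forall v : vertex N, v != source N -> v != dest N ->
        (exists r, walk (source N) r v) /\ (exists r, walk v r (dest N))].

Definition remove_edges (N : prenetwork) (F : {set edge N}) : prenetwork :=
  Prenetwork (edges N :\: F) (@tail N) (@head N) (source N) (dest N)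
    (@transit N) (@capacity N).

Definition is_cut (N : prenetwork) (C : {set edge N}) : Prop :=
  C \subset edges N /\ forall r, is_route r -> has (fun e => e \in C) r.

Definition cut_capacity (N : prenetwork) (C : {set edge N}) : nat :=
  \sum_(e in C) capacity e.

Definition net_capacity (N : prenetwork) : nat :=
  cut_capacity [arg min_(C < edges N | `[< is_cut C >]) cut_capacity C].

(* (g, i) stands for the player [it] with t = g + 1 (and i counted from 0). *)
Definition player (delta : nat) : Type := (nat * 'I_delta)%type.

Definition depart (delta : nat) (p : player delta) : nat := p.1.+1.

Definition prio (delta : nat) (q p : player delta) : bool :=
  (q.1 < p.1) || ((q.1 == p.1) && (q.2 < p.2)).

(* The players departing at stages 1, ..., t, in the order prio. *)
Definition players_upto (delta t : nat) : seq (player delta) :=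
  [seq (g, i) | g <- iota 0 t, i <- enum 'I_delta].

Definition profile (N : prenetwork) (delta : nat) : Type :=
  player delta -> seq (edge N).

Definition is_profile (N : prenetwork) (delta : nat)
    (sigma : profile N delta) : Prop :=
  forall p, is_route (sigma p).

Definition deviate (N : prenetwork) (delta : nat) (sigma : profile N delta)
    (p : player delta) (r : seq (edge N)) : profile N delta :=
  fun q => if q == p then r else sigma q.

(* [h p] lists the stages at which p has entered the successive edges of her
   route so far, followed, once she is out of the last edge, by the stage at
   which she left the system.  Hence p is on edge number (size (h p)).-1 of her
   route, which she entered at stage last 0 (h p), and she left her edge number
   j at stage nth 0 (h p) j.+1. *)
Definition history (delta : nat) : Type := player delta -> seq nat.

(* The j-th edge of q's route, entered at stage v, precedes in the queue the
   k-th edge of p's route, entered at stage u.  The comparison of j and k only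
   matters when one player enters the same edge twice at the same stage. *)
Definition precedes (delta : nat) (v : nat) (q : player delta) (j : nat)
    (u : nat) (p : player delta) (k : nat) : bool :=
  (v < u) || ((v == u) && (prio q p || ((q == p) && (j < k)))).

(* The number of players ahead of p on her current edge e at stage t: those who
   precede her and did not leave e before stage t.  Players leaving e at stage t
   itself are counted, since they use up the capacity of e at that stage. *)
Definition ahead (N : prenetwork) (delta : nat) (sigma : profile N delta)
    (h : history delta) (t : nat) (p : player delta) : nat :=
  let k := (size (h p)).-1 in
  \sum_(q <- players_upto delta t) \sum_(j < size (h q))
    [&& onth (sigma q) j == onth (sigma p) k,
        precedes (nth 0 (h q) j) q j (last 0 (h p)) p k &
        (j.+1 < size (h q)) ==> (t <= nth 0 (h q) j.+1)].

(* p has reached the head of her current edge by stage t. *)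
Definition in_queue (N : prenetwork) (delta : nat) (sigma : profile N delta)
    (h : history delta) (t : nat) (p : player delta) : bool :=
  if onth (sigma p) (size (h p)).-1 is Some e
  then last 0 (h p) + transit e <= t else false.

Definition exits (N : prenetwork) (delta : nat) (sigma : profile N delta)
    (h : history delta) (t : nat) (p : player delta) : bool :=
  in_queue sigma h t p &&
  (if onth (sigma p) (size (h p)).-1 is Some e
   then ahead sigma h t p < capacity e else false).

Definition exit_edge (N : prenetwork) (delta : nat) (sigma : profile N delta)
    (t : nat) (p : player delta) (h : history delta) : history delta :=
  if exits sigma h t p
  then fun q => if q == p then rcons (h p) t else h q else h.

(* A player may cross several edges of transit cost 0 during one stage, but at
   most as many as her route has. *)
Definition move (N : prenetwork) (delta : nat) (sigma : profile N delta)
    (t : nat) (h : history delta) (p : player delta) : history delta :=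
  iter (size (sigma p)) (exit_edge sigma t p) h.

(* The history at the end of stage t.  Within a stage, the players move one
   after the other in the order prio: the queue ahead of a player only depends
   on the previous stages and on the moves made at this stage by players of
   higher priority. *)
Fixpoint hist (N : prenetwork) (delta : nat) (sigma : profile N delta)
    (t : nat) : history delta :=
  if t is t'.+1
  then foldl (move sigma t) (hist sigma t') (players_upto delta t)
  else fun p => [:: depart p].

(* p is still in a queue at the end of stage t, that is, she waits at stage t. *)
Definition waits (N : prenetwork) (delta : nat) (sigma : profile N delta)
    (p : player delta) (t : nat) : bool :=
  in_queue sigma (hist sigma t) t p.

(* Arriving at v means exiting an edge with head v, after queueing there. *)
Definition arrived (N : prenetwork) (delta : nat) (sigma : profile N delta)
    (p : player delta) (v : vertex N) (t : nat) : bool :=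
  (depart p <= t) &&
  ((v == source N) ||
   has (fun e => head e == v) (take (size (hist sigma t p)).-1 (sigma p))).

Definition on_route (N : prenetwork) (r : seq (edge N)) (v : vertex N) : bool :=
  has (fun e => (tail e == v) || (head e == v)) r.

Local Open Scope classical_set_scope.
Local Open Scope ereal_scope.

Definition transit_cost (R : realType) (N : prenetwork) (delta : nat)
    (sigma : profile N delta) (p : player delta) : \bar R :=
  \sum_(e <- sigma p) (transit e)%:R%:E.

(* +oo for a player who is stuck in a queue forever. *)
Definition waiting_time (R : realType) (N : prenetwork) (delta : nat)
    (sigma : profile N delta) (p : player delta) : \bar R :=
  \sum_(0 <= t <oo) (waits sigma p t)%:R%:E.

Definition latency (R : realType) (N : prenetwork) (delta : nat)
    (sigma : profile N delta) (p : player delta) : \bar R :=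
  transit_cost R sigma p + waiting_time R sigma p.

(* The total latency of the generation departing at stage g + 1. *)
Definition gen_latency (R : realType) (N : prenetwork) (delta : nat)
    (sigma : profile N delta) (g : nat) : \bar R :=
  \sum_(i < delta) latency R sigma (g, i).

Definition avg_latency (R : realType) (N : prenetwork) (delta : nat)
    (sigma : profile N delta) (T : nat) : \bar R :=
  (T%:R^-1)%:E * \sum_(0 <= g < T) gen_latency R sigma g.

Definition socially_optimal (R : realType) (N : prenetwork) (delta : nat)
    (sigma : profile N delta) : Prop :=
  is_profile sigma /\
  forall sigma' : profile N delta, is_profile sigma' ->
    limn_esup (avg_latency R sigma) <= limn_einf (avg_latency R sigma').

(* +oo if there were no socially optimal profile. *)
Definition Opt (R : realType) (N : prenetwork) (delta : nat) : \bar R :=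
  xget +oo [set x | exists sigma : profile N delta,
    [/\ socially_optimal R sigma, limn_einf (avg_latency R sigma) = x
      & limn_esup (avg_latency R sigma) = x]].

Definition nash (R : realType) (N : prenetwork) (delta : nat)
    (sigma : profile N delta) : Prop :=
  is_profile sigma /\
  forall (p : player delta) (r : seq (edge N)), is_route r ->
    latency R sigma p <= latency R (deviate sigma p r) p.

Definition arrival_time (R : realType) (N : prenetwork) (delta : nat)
    (sigma : profile N delta) (p : player delta) (v : vertex N) : \bar R :=
  ereal_inf [set t%:R%:E | t in [set t : nat | arrived sigma p v t]].

Definition UFR (R : realType) (N : prenetwork) (delta : nat)
    : set (profile N delta) :=
  [set sigma | nash R sigma /\
    forall (p : player delta) (v : vertex N), on_route (sigma p) v ->
      ~ exists r, is_route r /\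
        arrival_time R (deviate sigma p r) p v < arrival_time R sigma p v].

Definition WEq (R : realType) (N : prenetwork) (delta : nat) : \bar R :=
  ereal_sup [set limn_esup (avg_latency R sigma) | sigma in @UFR R N delta].

Definition BEq (R : realType) (N : prenetwork) (delta : nat) : \bar R :=
  ereal_inf [set limn_esup (avg_latency R sigma) | sigma in @UFR R N delta].

Definition PoA (R : realType) (N : prenetwork) (delta : nat) : \bar R :=
  WEq R N delta / Opt R N delta.

Definition PoS (R : realType) (N : prenetwork) (delta : nat) : \bar R :=
  BEq R N delta / Opt R N delta.

(* Equilibria are compared through their worst long-run latency; the inflow
   stays delta after the removal, and some route must survive. *)
Definition BR (R : realType) (N : prenetwork) (delta : nat) : \bar R :=
  ereal_sup [set WEq R N delta / WEq R (remove_edges F) delta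
    | F in [set F : {set edge N} |
        [/\ F \subset edges N, F != finset.set0
          & exists r : seq (edge N), is_route (N := remove_edges F) r]]].

(* Main.v *)
Require Import Defs.
From mathcomp Require Import all_boot all_order all_algebra.
From mathcomp Require Import all_classical all_reals all_analysis.
From mathcomp Require Import zify.
Import Defs.

Set Implicit Arguments.
Unset Strict Implicit.
Unset Printing Implicit Defensive.

Import Order.TTheory GRing.Theory Num.Theory.

Local Open Scope nat_scope.

(* Three families of networks, each with inflow equal to its capacity: two
   parallel edges for n = 2, the Braess network for n = 4, and for n >= 6 a chain
   of n - 1 links of capacity 2 with backward links and a bypass.  In each of them
   a player loses at least 1 (on average, in the Braess network), which some
   equilibrium achieves, and some equilibrium has latency n - 1 per player from
   some generation on: in the chain, the first generations cross one link twice
   and thereby delay everybody behind them forever, although the backward links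
   stay unused afterwards.

   An equilibrium is certified, separately for each player p, by labels: a v is a
   stage before which nobody outside a set Q of players ahead of p can reach the
   vertex v.  Labels propagate along the edges, and an edge may raise the label of
   its head beyond the transit cost if enough players of Q leave it just before.
   As the players of Q cannot be disturbed by those behind them, p cannot beat her
   labels, whatever she does.

   No equilibrium is worse than n - 1: in the chain, a deviation to the first link
   followed by the bypass never queues; in the Braess network, the queues left on
   the two edges out of the source hold at most two players in total, so that one
   of the two outer routes takes at most 3 stages.  Without the backward links and
   the bypass (without the edge from a to b), equilibria have latency 1. *)

(** * The dynamics *)

(** Why the chain needs three kinds of doubling. Put J = n - 3. Of the n - 1 forward links, link 0
    costs 1, links 1, ..., J can be doubled because a backward link runs beside each, and the last
    one leads to the destination, where nobody can turn back. A doubled link keeps a queue worth one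
    stage: a generation held up there uses the whole capacity one stage later and so holds up the
    next. Doubling each link once thus yields only 1 + J. Generation J.+1 therefore doubles link
    J.-1 again, with both mates sharing each visit, which raises the delay there to 2; meanwhile
    link J receives nobody for a stage and its queue drains, so generation J.+2 doubles link J
    again. In the long run a player pays 1 + (J - 2) + 2 + 1 = n - 1, exactly the cost of link 0 and
    the bypass, which therefore tempts nobody. Link J.-1 must not start at the source, so J >= 2;
    this is why n = 4 requires a network of its own. *)

Section Priority.
Variable delta : nat.
Implicit Types p q z : player delta.

Lemma prio_trans : transitive (@prio delta).
Proof.
move=> [g i] [g' i'] [g'' i'']; rewrite /prio /=; lia.
Qed.

Lemma prio_irr : irreflexive (@prio delta).
Proof. by move=> [g i]; rewrite /prio /= !ltnn andbF. Qed.

Lemma prio_asym p q : prio p q -> prio q p -> False.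
Proof. by move=> pq /(prio_trans pq); rewrite prio_irr. Qed.

Lemma prio_total p q : p != q -> prio p q || prio q p.
Proof.
case: p q => g i [g' i']; rewrite /prio /= xpair_eqE -val_eqE /=; lia.
Qed.

Lemma mem_players_upto p t : (p \in players_upto delta t) = (depart p <= t).
Proof.
case: p => g i; apply/allpairsP/idP => [[[g' i'] /= [+ _ [-> _]]]|h].
  by rewrite mem_iota.
by exists (g, i); rewrite mem_iota mem_enum.
Qed.

Lemma pairwise_players_upto t : pairwise (@prio delta) (players_upto delta t).
Proof.
rewrite /players_upto; elim: t 0 => [//|t IH] m /=.
rewrite pairwise_cat IH andbT; apply/andP; split.
  apply/allrelP => x y /mapP[i _ ->] /allpairsP[[g j] /= [+ _ ->]].
  by rewrite mem_iota /prio /= => /andP[-> _].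
rewrite pairwise_map.
have : sorted ltn (map val (enum 'I_delta)) by rewrite val_enum_ord iota_ltn_sorted.
rewrite (sorted_pairwise ltn_trans) pairwise_map.
apply: sub_pairwise => i j /= ij; rewrite /prio /= eqxx /=; move: ij; rewrite /=; lia.
Qed.

Lemma uniq_players_upto t : uniq (players_upto delta t).
Proof. exact: pairwise_uniq prio_irr (pairwise_players_upto t). Qed.

Lemma players_uptoS p t : depart p <= t ->
  exists ps1 ps2, [/\ players_upto delta t = ps1 ++ p :: ps2,
    forall q, prio q p -> q \in ps1,
    forall q, q \in ps1 -> prio q p & forall q, q \in ps2 -> prio p q].
Proof.
rewrite -mem_players_upto => pin.
have [ps1 [ps2 E]] : exists ps1 ps2, players_upto delta t = ps1 ++ p :: ps2.
  by case/splitPr: pin => ps1 ps2; exists ps1, ps2.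
exists ps1, ps2; have := pairwise_players_upto t; rewrite E.
rewrite pairwise_cat => /and3P[/allrelP a1 _ /= /andP[/allP a2 _]].
split=> // q; last first.
- by move=> qin; apply: a1 => //; rewrite mem_head.
move=> qp; have : q \in players_upto delta t.
  rewrite mem_players_upto; move: pin; rewrite mem_players_upto.
  by move: qp; rewrite /prio /depart; lia.
rewrite E mem_cat in_cons => /or3P[//|/eqP qE|qin2]; last have pq := a2 _ qin2.
  by rewrite qE prio_irr in qp.
by case: (prio_asym qp pq).
Qed.

End Priority.

(** * The moves within one stage *)

Section Stage.
Variables (N : prenetwork) (delta : nat) (sigma : profile N delta).
Implicit Types (p q z : player delta) (h : history delta).

Definition set_history h p (s : seq nat) : history delta :=
  fun q => if q == p then s else h q.

Lemma set_history_id h p : set_history h p (h p) = h.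
Proof. by apply/funext => q; rewrite /set_history; case: eqP => [->|]. Qed.

Lemma set_history_eq h p s : set_history h p s p = s.
Proof. by rewrite /set_history eqxx. Qed.

Lemma exits_size h t p : h p != [::] -> exits sigma h t p ->
  size (h p) <= size (sigma p).
Proof.
move=> hp; rewrite /exits /in_queue; case E : (onth _ _) => [e|//] _.
by have := onthTE (sigma p) (size (h p)).-1; rewrite E /=; case: (h p) hp.
Qed.

Lemma iter_exit_edge h t p i : exists2 m,
    iter i (exit_edge sigma t p) h = set_history h p (h p ++ nseq m t) &
    [/\ m <= i,
      forall l, l < m -> exits sigma (set_history h p (h p ++ nseq l t)) t p &
      m < i -> ~~ exits sigma (set_history h p (h p ++ nseq m t)) t p].
Proof.
elim: i => [|i [m E [mi ex nex]]].
  by exists 0; rewrite // cats0 set_history_id.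
rewrite iterS E /exit_edge; case: ifPn => ext; last first.
  by exists m => //; split=> //; exact: leqW.
have {mi nex}mi : m = i.
  by apply/eqP; rewrite eqn_leq mi leqNgt; apply/negP => /nex; rewrite ext.
exists m.+1.
  apply/funext => q; rewrite /set_history; case: eqP => // _.
  by rewrite eqxx -cats1 -catA -[[:: t]]/(nseq 1 t) -nseqD addn1.
split=> [|l|]; rewrite ?mi ?ltnn // ltnS leq_eqVlt => /orP[/eqP->|].
  by rewrite -mi.
by rewrite -mi; apply: ex.
Qed.

Lemma move_spec h t p : h p != [::] -> exists2 m,
    move sigma t h p = set_history h p (h p ++ nseq m t) &
    (forall l, l < m -> exits sigma (set_history h p (h p ++ nseq l t)) t p) /\
    ~~ exits sigma (set_history h p (h p ++ nseq m t)) t p.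
Proof.
move=> hp; have [m E [mi ex nex]] := iter_exit_edge h t p (size (sigma p)).
exists m => //; split=> //; move: mi; rewrite leq_eqVlt => /orP[/eqP mE|/nex//].
apply/negP => /exits_size; rewrite set_history_eq size_cat size_nseq mE.
by case: (h p) hp => //= x s _ /(_ isT); lia.
Qed.

Lemma foldl_move_notin t ps h q : q \notin ps -> foldl (move sigma t) h ps q = h q.
Proof.
elim: ps h => [//|p ps IH] h; rewrite in_cons negb_or => /andP[qp qps] /=.
rewrite IH // /move; have [m -> _] := iter_exit_edge h t p (size (sigma p)).
by rewrite /set_history (negPf qp).
Qed.

Lemma hist_head t p : exists s, hist sigma t p = depart p :: s.
Proof.
elim: t => [|t [s E]] /=; first by exists [::].
elim: (players_upto _ _) (hist sigma t) s E => [|q ps IH] h s E /=.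
  by exists s.
rewrite /move; have [m mE _] := iter_exit_edge h t.+1 q (size (sigma q)).
case: (eqVneq p q) => pq.
  apply: (IH _ (s ++ nseq m t.+1)).
  by rewrite mE -pq set_history_eq E.
by apply: (IH _ s); rewrite mE /set_history (negPf pq).
Qed.

Lemma hist_neq0 t p : hist sigma t p != [::].
Proof. by have [s ->] := hist_head t p. Qed.

Lemma hist_early t p : t < depart p -> hist sigma t p = [:: depart p].
Proof.
elim: t => [//|t IH] tp /=; rewrite foldl_move_notin; first by apply: IH; lia.
by rewrite mem_players_upto -ltnNge.
Qed.

(* The history in which p moves at stage t.+1, when she has already crossed l
   edges during that stage. *)
Definition mid_history t p l : history delta := fun q =>
  if q == p then hist sigma t p ++ nseq l t.+1
  else if prio q p then hist sigma t.+1 q else hist sigma t q.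

Lemma hist_step t p : depart p <= t.+1 -> exists2 m,
    hist sigma t.+1 p = hist sigma t p ++ nseq m t.+1 &
    (forall l, l < m -> exits sigma (mid_history t p l) t.+1 p) /\
    ~~ exits sigma (mid_history t p m) t.+1 p.
Proof.
move=> pt; have [ps1 [ps2 [E sub1 in1 in2]]] := players_uptoS pt.
have p1 : p \notin ps1 by apply/negP => /in1; rewrite prio_irr.
have p2 : p \notin ps2 by apply/negP => /in2; rewrite prio_irr.
set h1 := foldl (move sigma t.+1) (hist sigma t) ps1.
have h1p : h1 p = hist sigma t p by rewrite /h1 foldl_move_notin.
have histE : hist sigma t.+1 = foldl (move sigma t.+1) (move sigma t.+1 h1 p) ps2.
  by rewrite /= E foldl_cat.
have [|m mE [ex nex]] := @move_spec h1 t.+1 p; first by rewrite h1p hist_neq0.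
have midE l : set_history h1 p (h1 p ++ nseq l t.+1) = mid_history t p l.
  apply/funext => q; rewrite /set_history /mid_history h1p; case: eqP => // /eqP qp.
  case: ifPn => pr.
    have q2 : q \notin ps2 by apply/negP => /in2 /(prio_asym pr).
    by rewrite histE foldl_move_notin // mE /set_history (negPf qp).
  have q1 : q \notin ps1 by apply: contra pr => /in1.
  by rewrite /h1 foldl_move_notin.
exists m.
  by rewrite histE foldl_move_notin // mE set_history_eq h1p.
by split=> [l /ex|]; rewrite -midE.
Qed.

Lemma hist_stepW t p : exists m, hist sigma t.+1 p = hist sigma t p ++ nseq m t.+1.
Proof.
have [/hist_step[m -> _]|tp] := leqP (depart p) t.+1; first by exists m.
by exists 0; rewrite !hist_early ?cats0 //; lia.
Qed.

Lemma hist_le t t' p : t <= t' -> exists2 s, hist sigma t' p = hist sigma t p ++ s &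
  all (fun u => t < u <= t') s.
Proof.
move=> /subnK <-; elim: (t' - t) => [|d [s E as_]]; first by exists [::]; rewrite ?cats0.
have [m mE] := hist_stepW (d + t) p.
exists (s ++ nseq m (d + t).+1); first by rewrite addSn mE E catA.
rewrite all_cat all_nseq; apply/andP; split; last by apply/orP; right; lia.
by apply: sub_all as_ => u; lia.
Qed.

End Stage.

(** * The queueing rule in terms of entry stages *)

Section Rule.
Variables (N : prenetwork) (delta : nat) (sigma : profile N delta).
Implicit Types (p q z : player delta) (h : history delta).

(* p enters the k-th edge of her route at stage u; for k = size (sigma p), she
   leaves the system. *)
Definition enters p k u : bool :=
  (k < size (hist sigma u p)) && (nth 0 (hist sigma u p) k == u).

Lemma hist_mem_le t p u : depart p <= t -> u \in hist sigma t p -> u <= t.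
Proof.
move=> pt; have [s -> /allP a] := hist_le sigma p (leq0n t).
by rewrite mem_cat => /orP[|/a]; [rewrite /= inE => /eqP -> | lia].
Qed.

Lemma enters_hist p k u t : enters p k u -> u <= t ->
  k < size (hist sigma t p) /\ nth 0 (hist sigma t p) k = u.
Proof.
move=> /andP[ks /eqP ku] ut; have [s -> _] := hist_le sigma p ut.
by rewrite size_cat nth_cat ks; split=> //; lia.
Qed.

Lemma hist_enters t p k : depart p <= t -> k < size (hist sigma t p) ->
  enters p k (nth 0 (hist sigma t p) k) /\ nth 0 (hist sigma t p) k <= t.
Proof.
move=> pt ks; have le := hist_mem_le pt (mem_nth 0 ks); split=> //.
have [u uE] : exists u, nth 0 (hist sigma t p) k = u by eexists.
rewrite uE in le *; have [s E /allP a] := hist_le sigma p le.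
move: ks uE; rewrite /enters E nth_cat size_cat.
have [_ _ ->|k1 ks uE] := ltnP k (size (hist sigma u p)); first by rewrite eqxx.
have := a _ (mem_nth 0 (_ : k - size (hist sigma u p) < size s)).
by rewrite uE ltnn => /(_ ltac:(lia)).
Qed.

Lemma enters_uniq p k u v : enters p k u -> enters p k v -> u = v.
Proof.
move=> ku kv; have [uv|/ltnW vu] := leqP u v.
  have [_ <-] := enters_hist ku uv; by have [_ ->] := enters_hist kv (leqnn v).
have [_ <-] := enters_hist ku (leqnn u); by have [_ ->] := enters_hist kv vu.
Qed.

Lemma enters0 p u : enters p 0 u = (u == depart p).
Proof. by rewrite /enters; have [s ->] := hist_head sigma u p; rewrite eq_sym. Qed.

Lemma enters_depart p k u : enters p k u -> depart p <= u.
Proof.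
move=> /andP[ks /eqP ku]; rewrite leqNgt; apply/negP => up; move: ks ku.
by rewrite hist_early //=; case: k => //= _ E; rewrite E ltnn in up.
Qed.

Lemma enters_prefix p k j v : enters p j v -> k <= j ->
  exists2 u, enters p k u & u <= v.
Proof.
move=> jv kj; have [js _] := enters_hist jv (leqnn v).
have [|ku ul] := @hist_enters v p k (enters_depart jv); first lia.
by exists (nth 0 (hist sigma v p) k).
Qed.

Lemma enters_le p k j u v : enters p k u -> enters p j v -> k <= j -> u <= v.
Proof.
by move=> ku jv kj; have [w kw] := enters_prefix jv kj; rewrite (enters_uniq ku kw).
Qed.

Lemma size_hist t p : size (hist sigma t p) <= (size (sigma p)).+1.
Proof.
elim: t => [//|t IH]; have [pt|tp] := leqP (depart p) t.+1; last first.
  by rewrite hist_early.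
have [[|m] -> [ex _]] := hist_step sigma pt; first by rewrite cats0.
have /exits_size := ex m (leqnn _); rewrite /mid_history eqxx -size_eq0.
by rewrite !size_cat !size_nseq; have := hist_neq0 sigma t p; rewrite -size_eq0; lia.
Qed.

Lemma enters_size p k u : enters p k u -> k <= size (sigma p).
Proof. by move=> /andP[+ _]; have := size_hist u p; lia. Qed.

(* Seen from p, who entered edge number k of her route at stage u, q is ahead of
   her at stage x on the same edge, which is the j-th edge of q. *)
Definition queued_ahead x p k u (qj : player delta * nat) : Prop :=
  [/\ exists2 v, enters qj.1 qj.2 v & precedes v qj.1 qj.2 u p k,
      onth (sigma qj.1) qj.2 = onth (sigma p) k &
      ~~ (qj.2.+1 < size (hist sigma x.-1 qj.1))].

Definition ahead_list h t p : seq (player delta * nat) :=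
  let k := (size (h p)).-1 in
  [seq qj <- [seq (q, j) | q <- players_upto delta t, j <- iota 0 (size (h q))] |
    [&& onth (sigma qj.1) qj.2 == onth (sigma p) k,
        precedes (nth 0 (h qj.1) qj.2) qj.1 qj.2 (last 0 (h p)) p k &
        (qj.2.+1 < size (h qj.1)) ==> (t <= nth 0 (h qj.1) qj.2.+1)]].

Lemma ahead_size h t p : ahead sigma h t p = size (ahead_list h t p).
Proof.
rewrite /ahead_list size_filter -sum1_count big_mkcond big_allpairs_dep /=.
by apply: eq_bigr => q _; rewrite -[iota 0 _]val_enum_ord big_map big_enum.
Qed.

Lemma uniq_ahead_list h t p : uniq (ahead_list h t p).
Proof.
apply: filter_uniq; apply: allpairs_uniq_dep.
- exact: uniq_players_upto.
- by move=> q _; exact: iota_uniq.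
- by move=> [q j] [q' j'] _ _ [-> ->].
Qed.

Lemma mem_ahead_list h t p q j : ((q, j) \in ahead_list h t p) =
  let k := (size (h p)).-1 in
  [&& depart q <= t, j < size (h q), onth (sigma q) j == onth (sigma p) k,
      precedes (nth 0 (h q) j) q j (last 0 (h p)) p k &
      (j.+1 < size (h q)) ==> (t <= nth 0 (h q) j.+1)].
Proof.
rewrite mem_filter /= [LHS]andbC [RHS]andbA; congr (_ && _).
rewrite -mem_players_upto; apply/allpairsPdep/andP => [[q' [j' [qi + [-> ->]]]]|[qi ji]].
  by rewrite mem_iota.
by exists q, j; rewrite mem_iota.
Qed.

Lemma mid_state t p l m k : depart p <= t.+1 -> l <= m ->
  hist sigma t.+1 p = hist sigma t p ++ nseq m t.+1 ->
  size (hist sigma t p) + l = k.+1 ->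
  let h := mid_history sigma t p l in
  [/\ (size (h p)).-1 = k, last 0 (h p) = nth 0 (hist sigma t.+1 p) k &
      enters p k (last 0 (h p))].
Proof.
move=> pt lm pE kE h.
have hp : h p = hist sigma t p ++ nseq l t.+1 by rewrite /h /mid_history eqxx.
have hk : (size (h p)).-1 = k by rewrite hp size_cat size_nseq kE.
have lastE : last 0 (h p) = nth 0 (hist sigma t.+1 p) k.
  rewrite -nth_last hk hp pE -(subnKC lm) nseqD catA.
  by rewrite [in RHS]nth_cat size_cat size_nseq kE ltnSn.
split=> //; have [|ku _] := @hist_enters t.+1 p k pt; last by rewrite lastE.
by rewrite pE size_cat size_nseq; lia.
Qed.

(** This removes the order of moves within a stage. A player of lower priority, who has yet to move
    at stage t.+1, can only enter the edge too late to precede p, and whoever leaves at t.+1 itself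
    is counted in either case. *)
Lemma mem_mid_ahead t p l m k qj : depart p <= t.+1 -> l <= m ->
  hist sigma t.+1 p = hist sigma t p ++ nseq m t.+1 ->
  size (hist sigma t p) + l = k.+1 ->
  qj \in ahead_list (mid_history sigma t p l) t.+1 p <->
  queued_ahead t.+1 p k (nth 0 (hist sigma t.+1 p) k) qj.
Proof.
move=> pt lm pE kE; case: qj => q j.
have [midk lastE _] := mid_state pt lm pE kE.
have [a midq] : exists a, mid_history sigma t p l q = hist sigma t q ++ nseq a t.+1.
  rewrite /mid_history; case: eqP => [->|_]; first by exists l.
  by case: ifP => _; [exact: hist_stepW | exists 0; rewrite cats0].
have [b qE] : exists b,
    hist sigma t.+1 q = mid_history sigma t p l q ++ nseq b t.+1.
  rewrite /mid_history; case: eqP => [->|_].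
    by exists (m - l); rewrite pE -catA -nseqD subnKC.
  by case: ifP => _; [exists 0; rewrite cats0 | exact: hist_stepW].
rewrite mem_ahead_list midk lastE; cbn zeta; set u := nth _ (hist _ _ p) k.
have pku : enters p k u /\ u <= t.+1.
  by apply: hist_enters; rewrite // pE size_cat size_nseq; lia.
split.
  move=> /and5P[qt jq /eqP je prec out].
  have [|jv vt] := @hist_enters t.+1 q j qt; first by rewrite qE size_cat; lia.
  split=> //=; last first.
    apply/negP => j1; move: out; rewrite midq size_cat nth_cat j1 ltn_addr //=.
    apply/negP; rewrite -ltnNge ltnS.
    have [qt'|tq] := leqP (depart q) t; first by have [] := hist_enters qt' j1.
    by rewrite hist_early in j1.
  by exists (nth 0 (hist sigma t.+1 q) j) => //; rewrite qE nth_cat jq.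
move=> [[v /= jv prec] je out].
have vu : v <= u by move: prec; rewrite /precedes; lia.
have [jq jn] := enters_hist jv (leq_trans vu pku.2).
have jmid : j < size (mid_history sigma t p l q).
  rewrite /mid_history; move: prec; rewrite /precedes => prec.
  case: eqP => [qp|/eqP qp].
    rewrite size_cat size_nseq kE; move: prec; rewrite qp prio_irr eqxx /=.
    case/orP => [vu'|/andP[_ /leqW//]]; rewrite ltnS leqNgt; apply/negP => kj.
    move: jv vu'; rewrite qp => jv; rewrite ltnNge => /negP; apply.
    exact: enters_le pku.1 jv (ltnW kj).
  case: ifPn => [//|qp'].
  move: prec; rewrite (negPf qp') (negPf qp) /= andbF orbF => vu'.
  have vt : v <= t by have := pku.2; lia.
  by have [] := enters_hist jv vt.
apply/and5P; split=> //.
- by have := enters_depart jv; have := pku.2; lia.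
- exact/eqP.
- by move: jn prec; rewrite qE nth_cat jmid => ->.
apply/implyP => j1; rewrite midq nth_cat nth_nseq.
move: out j1; rewrite midq size_cat size_nseq /= => out j1.
case: (ltnP j.+1 (size (hist sigma t q))) => [|_]; first lia.
by rewrite ifT //; lia.
Qed.


Lemma enters_exits p k x : enters p k.+1 x -> exists t m l,
  [/\ x = t.+1, depart p <= t.+1, l < m,
      hist sigma t.+1 p = hist sigma t p ++ nseq m t.+1 &
      size (hist sigma t p) + l = k.+1 /\
      exits sigma (mid_history sigma t p l) t.+1 p].
Proof.
move=> kx; have dx := enters_depart kx.
case: x kx dx => [|t] kx dx; first by rewrite /depart in dx.
have [m mE [ex _]] := hist_step sigma dx.
have k0 : size (hist sigma t p) <= k.+1.
  rewrite leqNgt; apply/negP => ks.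
  have [dt|td] := leqP (depart p) t; last by rewrite hist_early in ks.
  have [kt] := hist_enters dt ks.
  by rewrite -(enters_uniq kx kt) ltnn.
have [k1 _] := enters_hist kx (leqnn _).
rewrite mE size_cat size_nseq in k1.
exists t, m, (k.+1 - size (hist sigma t p)); split=> //; first lia.
by split; [lia | apply: ex; lia].
Qed.

(** This lemma and the next two are the form in which the queueing rule is used below: no exit
    before the transit cost is paid, no exit behind [capacity e] players, and no delay otherwise. *)
Lemma enters_transit p k u x e : enters p k.+1 x -> enters p k u ->
  onth (sigma p) k = Some e -> u + transit e <= x.
Proof.
move=> kx ku ke; have [t [m [l [-> pt /ltnW lm mE [kE]]]]] := enters_exits kx.
have [mk _ /enters_uniq/(_ ku) <-] := mid_state pt lm mE kE.
by rewrite /exits /in_queue mk ke => /andP[].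
Qed.

Lemma enters_blocked p k u x e L : enters p k.+1 x -> enters p k u ->
  onth (sigma p) k = Some e -> uniq L ->
  (forall qj, qj \in L -> queued_ahead x p k u qj) -> size L < capacity e.
Proof.
move=> kx ku ke uL sL; have [t [m [l [xE pt /ltnW lm mE [kE ex]]]]] := enters_exits kx.
have [mk _ _] := mid_state pt lm mE kE.
move: ex; rewrite /exits mk ke => /andP[_]; apply: leq_ltn_trans.
rewrite ahead_size; apply: uniq_leq_size uL _ => qj /sL.
rewrite xE; have [|kv _] := @hist_enters t.+1 p k pt.
  by rewrite mE size_cat size_nseq; lia.
by rewrite (enters_uniq ku kv) => /(mem_mid_ahead qj pt lm mE kE).
Qed.

Lemma enters_release p k u x e : enters p k u -> onth (sigma p) k = Some e ->
  u + transit e <= x ->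
  (forall L, uniq L -> (forall qj, qj \in L -> queued_ahead x p k u qj) ->
     size L < capacity e) ->
  k.+1 < size (hist sigma x p).
Proof.
move=> ku ke ux free; rewrite ltnNge; apply/negP => xk.
have ux' : u <= x by lia.
have [kx kn] := enters_hist ku ux'.
have dx := leq_trans (enters_depart ku) ux'.
case: x => [|t] in ux free xk ux' kx kn dx; first by rewrite /depart in dx.
have [m mE [_ /negP]] := hist_step sigma dx; apply.
have kE : size (hist sigma t p) + m = k.+1.
  by move: kx xk; rewrite mE size_cat size_nseq; lia.
have [mk _ /enters_uniq/(_ ku) lE] := mid_state dx (leqnn m) mE kE.
rewrite /exits /in_queue mk ke lE ux /= ahead_size.
apply: free => [|qj]; first exact: uniq_ahead_list.
by move=> /(mem_mid_ahead qj dx (leqnn m) mE kE); rewrite kn.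
Qed.

End Rule.

(** * Schedules *)

Lemma prio_ind delta (P : player delta -> Prop) :
  (forall q, (forall z, prio z q -> P z) -> P q) -> forall q, P q.
Proof.
move=> IH [g i]; elim/ltn_ind: g i => g IHg [i ilt]; elim/ltn_ind: i ilt => i IHi ilt.
apply: IH => -[g' [i' i'lt]]; rewrite /prio /= => /orP[/IHg//|/andP[/eqP-> i'i]].
exact: IHi.
Qed.

Section Walks.
Variable N : prenetwork.
Implicit Types (u v : vertex N) (r : seq (edge N)).

Lemma walk_edges u r v k e : walk u r v -> onth r k = Some e -> e \in edges N.
Proof.
by elim: r u k => [|f r IH] u [|k] //= /and3P[fE _ w] => [[<-]|/(IH _ _ w)].
Qed.

Lemma walk_tail u r v e : walk u r v -> onth r 0 = Some e -> tail e = u.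
Proof. by case: r => [|f r] //= /and3P[_ /eqP fu _] [<-]. Qed.

Lemma walk_next u r v k e f : walk u r v -> onth r k = Some e ->
  onth r k.+1 = Some f -> tail f = head e.
Proof.
elim: r u k => [|g r IH] u [|k] //= /and3P[_ _ w]; last exact: IH w.
by case=> <- /(walk_tail w).
Qed.

Lemma walk_last u r v k e : walk u r v -> onth r k = Some e ->
  size r = k.+1 -> head e = v.
Proof.
elim: r u k => [|g r IH] u [|k] //= /and3P[_ _ w].
  by move=> [<-] [/size0nil rE]; move: w; rewrite rE => /eqP.
by move=> re [/(IH _ _ w re)].
Qed.

Lemma walk_nonempty u r v : u != v -> walk u r v -> 0 < size r.
Proof. by case: r => //= + /eqP; move=> /eqP. Qed.

End Walks.

Lemma onth_lt (T : Type) (s : seq T) k x : onth s k = Some x -> k < size s.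
Proof. by move=> sk; rewrite -onthTE sk. Qed.

Lemma lt_onth (T : Type) (s : seq T) k : k < size s -> exists x, onth s k = Some x.
Proof. by rewrite -onthTE; case: (onth s k) => // x; exists x. Qed.

(** * Players whom those behind cannot disturb *)

Section Barrier.
Variables (N : prenetwork) (delta : nat) (rho : profile N delta).
Implicit Types (p q z : player delta).

Lemma left_before q j x y : enters rho q j.+1 y -> y < x ->
  j.+1 < size (hist rho x.-1 q).
Proof. by move=> jy yx; have [|->] := enters_hist jy (_ : y <= x.-1); lia. Qed.

Lemma not_left_before q j x : (forall y, enters rho q j.+1 y -> x <= y) ->
  ~~ (j.+1 < size (hist rho x.-1 q)).
Proof.
move=> nl; apply/negP => js.
have [dx|xd] := leqP (depart q) x.-1; last by rewrite hist_early in js.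
have [/nl] := hist_enters dx js; rewrite /depart in dx; lia.
Qed.

Variables (Q : pred (player delta)) (S : player delta -> nat -> nat).
Variable a : vertex N -> nat.

(** The counterpart of [queued_ahead] with the planned stages S in place of the actual ones. *)
Definition sched_ahead x q k (zj : player delta * nat) : Prop :=
  [/\ Q zj.1, onth (rho zj.1) zj.2 = onth (rho q) k,
      precedes (S zj.1 zj.2) zj.1 zj.2 (S q k) q k & x <= S zj.1 zj.2.+1].

Hypothesis Q_prio : forall q z, Q q -> ~~ Q z -> prio q z.
Hypothesis S_depart : forall q, Q q -> S q 0 = depart q.
Hypothesis S_transit : forall q k e, Q q -> onth (rho q) k = Some e ->
  S q k + transit e <= S q k.+1.
Hypothesis S_free : forall q k e L, Q q -> onth (rho q) k = Some e -> uniq L ->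
  (forall zj, zj \in L -> sched_ahead (S q k.+1) q k zj) -> size L < capacity e.
Hypothesis S_blocked : forall q k e, Q q -> onth (rho q) k = Some e ->
  S q k + transit e < S q k.+1 -> exists L, [/\ uniq L, capacity e <= size L &
    forall zj, zj \in L -> sched_ahead (S q k.+1).-1 q k zj].
Hypothesis a_source : forall z, ~~ Q z -> a (source N) <= depart z.
Hypothesis route_notQ : forall z, ~~ Q z -> is_route (rho z).
Hypothesis S_le_a : forall z q k e, ~~ Q z -> Q q -> onth (rho q) k = Some e ->
  S q k <= a (tail e).
Hypothesis a_edge : forall e, e \in edges N -> a (head e) <= a (tail e) + transit e \/
  exists L, [/\ uniq L, capacity e <= size L & forall zj, zj \in L ->
    [/\ Q zj.1, onth (rho zj.1) zj.2 = Some e & a (head e) <= (S zj.1 zj.2.+1).+1]].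

Let exact_upto T :=
  (forall q k u, Q q -> enters rho q k u -> u <= T -> u = S q k) /\
  (forall q k, Q q -> k <= size (rho q) -> S q k <= T -> enters rho q k (S q k)).

Let bound_upto T := forall z k u e, ~~ Q z -> enters rho z k.+1 u -> u <= T ->
  onth (rho z) k = Some e -> a (head e) <= u.

Let tail_bound T z k u e : bound_upto T -> ~~ Q z -> enters rho z k u -> u <= T ->
  onth (rho z) k = Some e -> a (tail e) <= u.
Proof.
move=> b nQz zk uT ke; have rz := route_notQ nQz; case: k => [|k] in zk ke *.
  by rewrite (walk_tail rz ke); move: zk; rewrite enters0 => /eqP ->; exact: a_source.
have [f kf] : exists f, onth (rho z) k = Some f.
  by apply: lt_onth; have := onth_lt ke; lia.
by rewrite (walk_next rz kf ke); exact: b nQz zk uT kf.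
Qed.

(** Players of Q are treated by priority, then by position on the route. An outsider z is never
    ahead of q on an edge e: the bound at earlier stages keeps z from its tail until [a (tail e)],
    when q has already entered by [S_le_a], and [Q_prio] settles ties. *)
Let exact_step T : (forall t, t < T -> exact_upto t) ->
  (forall t, t < T -> bound_upto t) -> exact_upto T.
Proof.
move=> IHe IHb.
suff D q : Q q -> forall k, k <= size (rho q) ->
    (enters rho q k T -> S q k = T) /\ (S q k = T -> enters rho q k T).
  split=> [q k u Qq qk|q k Qq ks]; rewrite leq_eqVlt => /orP[/eqP uT|uT].
  - by rewrite uT in qk *; have [/(_ qk)] := D q Qq k (enters_size qk).
  - exact: (IHe u uT).1.
  - by rewrite uT; have [_ ->] := D q Qq k ks.
  - exact: (IHe _ uT).2.
elim/prio_ind: q => q IHq Qq k; elim/ltn_ind: k => -[|k] IHk ks.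
  by rewrite enters0 S_depart //; split=> [/eqP|<-].
have known z j : Q z -> j <= size (rho z) -> prio z q || ((z == q) && (j <= k)) ->
    (forall u, enters rho z j u -> u <= T -> u = S z j) /\
    (S z j <= T -> enters rho z j (S z j)).
  move=> Qz js zq.
  have [e1 e2] : (enters rho z j T -> S z j = T) /\ (S z j = T -> enters rho z j T).
    by case/orP: zq => [zq|/andP[/eqP-> jk]]; [exact: IHq | apply: IHk => //; lia].
  split=> [u zu|]; rewrite leq_eqVlt => /orP[/eqP uT|uT].
  - by rewrite uT in zu *; rewrite e1.
  - exact: (IHe u uT).1.
  - by rewrite uT e2.
  - exact: (IHe _ uT).2.
have [e ke] : exists e, onth (rho q) k = Some e by apply: lt_onth.
have [kE1 kE2] : (forall u, enters rho q k u -> u <= T -> u = S q k) /\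
    (S q k <= T -> enters rho q k (S q k)).
  by apply: known => //; [exact: ltnW | rewrite eqxx leqnn orbT].
have St := S_transit Qq ke.
split=> [qT|ST].
  have [u ku uT] := enters_prefix qT (leqnSn k).
  have uE := kE1 u ku uT; rewrite uE in ku uT.
  have uTe := enters_transit qT ku ke.
  have [lt|gt|//] := ltngtP (S q k.+1) T.
    by rewrite (enters_uniq qT ((IHe _ lt).2 q k.+1 Qq ks (leqnn _))).
  (* Those who block q at the stage before her planned exit are still there at every earlier stage,
     in particular at T. *)
  have [|L [uL cL sL]] := S_blocked Qq ke; first lia.
  have : size L < capacity e; last by rewrite ltnNge cL.
  apply: (enters_blocked qT ku ke uL) => -[z j] /sL[/= Qz je prec out].
  have js : j < size (rho z) by apply: (@onth_lt _ _ _ e); rewrite je.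
  have zS : enters rho z j (S z j).
    move: prec; rewrite /precedes => /orP[lt|/andP[/eqP eq pr]].
      by apply: (IHe (S z j) _).2 => //; [lia | exact: ltnW].
    apply: (known z j Qz (ltnW js) _).2; last by rewrite eq.
    by case/orP: pr => [->//|/andP[-> /ltnW ->]]; rewrite orbT.
  split=> //=; first by exists (S z j).
  apply: not_left_before => y jy; rewrite leqNgt; apply/negP => yT.
  by have := (IHe y yT).1 z j.+1 y Qz jy (leqnn y); lia.
have ku : enters rho q k (S q k) by apply: kE2; lia.
have qT : k.+1 < size (hist rho T q).
  apply: (enters_release ku ke); first by rewrite -ST.
  move=> L uL sL; apply: (S_free Qq ke uL) => -[z j] /sL[[v /= jv prec] je out].
  have js : j < size (rho z) by apply: (@onth_lt _ _ _ e); rewrite je.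
  have vT : v <= T by move: prec; rewrite /precedes; lia.
  have Qz : Q z.
    apply/negPn/negP => nQz; have qz := Q_prio Qq nQz.
    move: prec; rewrite /precedes => /orP[lt|/andP[_ /orP[/prio_asym/(_ qz)//|/andP[/eqP zq _]]]].
      have vT' : v < T by lia.
      have := tail_bound (IHb v vT') nQz jv (leqnn v) (etrans je ke).
      by have := S_le_a nQz Qq ke; lia.
    by rewrite zq Qq in nQz.
  have vE : v = S z j.
    move: (prec); rewrite /precedes => /orP[lt|/andP[/eqP eq pr]].
      by apply: (IHe v _).1 => //; lia.
    apply: (known z j Qz (ltnW js) _).1 => //.
    by case/orP: pr => [->//|/andP[-> /ltnW ->]]; rewrite orbT.
  split=> //=; first by rewrite -vE.
  rewrite leqNgt; apply/negP => lt; move/negP: out; apply.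
  apply: left_before (_ : _ < T); last by rewrite -ST; exact: lt.
  by apply: (IHe (S z j.+1) _).2 => //; lia.
have dT : depart q <= T by have := enters_depart ku; lia.
have [en le] := hist_enters dT qT.
set y := nth _ _ _ in en le; move: le; rewrite leq_eqVlt => /orP[/eqP <-//|yT].
by have := (IHe y yT).1 q k.+1 y Qq en (leqnn y); lia.
Qed.

Let bound_step T : exact_upto T -> (forall t, t < T -> bound_upto t) -> bound_upto T.
Proof.
move=> [ex1 ex] IHb z k u e nQz zk.
have step k0 f u0 : enters rho z k0.+1 T -> enters rho z k0 u0 -> u0 <= T ->
    onth (rho z) k0 = Some f -> a (tail f) <= u0 -> a (head f) <= T.
  move=> zk0 ku uT0 kf au.
  have uf := enters_transit zk0 ku kf.
  have [|[L [uL cL sL]]] := a_edge (walk_edges (route_notQ nQz) kf); first lia.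
  (* If z left f before [a (head f)], the players of L would still be in f; they entered it no later
     than z and have higher priority, so they block her. *)
  rewrite leqNgt; apply/negP => aT.
  have : size L < capacity f; last by rewrite ltnNge cL.
  apply: (enters_blocked zk0 ku kf uL) => -[q j] /sL[/= Qq jf out].
  have js := onth_lt jf; have Sa := S_le_a nQz Qq jf.
  have qS : enters rho q j (S q j) by apply: ex => //; lia.
  split=> /=; last 1 first.
  - apply: not_left_before => y jy; rewrite leqNgt; apply/negP => yT.
    by have := ex1 q j.+1 y Qq jy (ltnW yT); lia.
  - exists (S q j) => //; rewrite /precedes (Q_prio Qq nQz) /=; lia.
  - by rewrite jf kf.
rewrite leq_eqVlt => /orP[/eqP uT|uT]; last first.
  exact: (IHb u uT z k u e nQz zk (leqnn u)).
(* Several edges of transit cost 0 may be crossed within stage T, so the bound at T itself is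
   propagated along the route. *)
rewrite {}uT in zk *; elim: k zk e => [|k IHk] zk f kf;
  have [w kw wT] := enters_prefix zk (leqnSn _); have au : a (tail f) <= w.
- rewrite (walk_tail (route_notQ nQz) kf).
  by move: kw; rewrite enters0 => /eqP ->; exact: a_source.
- exact: step zk kw wT kf au.
- have [e ke] : exists e, onth (rho z) k = Some e.
    by apply: lt_onth; have := onth_lt kf; lia.
  rewrite (walk_next (route_notQ nQz) ke kf).
  move: wT; rewrite leq_eqVlt => /orP[/eqP wT|wT].
    by rewrite wT in kw *; exact: IHk.
  exact: (IHb w wT z k w e nQz kw (leqnn w)).
- exact: step zk kw wT kf au.
Qed.
Let upto T : exact_upto T /\ bound_upto T.
Proof.
elim/ltn_ind: T => T IH; have e := exact_step (fun t tT => (IH t tT).1) (fun t tT => (IH t tT).2).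
by split=> //; exact: bound_step e (fun t tT => (IH t tT).2).
Qed.

Lemma barrier_exact q k u : Q q -> k <= size (rho q) -> enters rho q k u <-> u = S q k.
Proof.
move=> Qq ks; split=> [qk|->]; first exact: ((upto u).1.1 q k u Qq qk (leqnn u)).
exact: ((upto (S q k)).1.2 q k Qq ks (leqnn _)).
Qed.

Lemma barrier_bound z k u e : ~~ Q z -> onth (rho z) k = Some e ->
  enters rho z k.+1 u -> a (head e) <= u.
Proof.
by move=> nQz ke zk; exact: (upto u).2 z k u e nQz zk (leqnn u) ke.
Qed.

End Barrier.

Lemma sum_leq_nat v u x : u <= v -> \sum_(u <= s < x) (v <= s) = x - v.
Proof.
move=> uv; elim: x => [|x IH]; first by rewrite big_geq.
have [ux|xu] := leqP u x; last by rewrite big_geq //; lia.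
by rewrite big_nat_recr //= IH; lia.
Qed.

(** * Latencies and arrival times from entry stages *)

Section Latency.
Variables (R : realType) (N : prenetwork) (delta : nat) (sigma : profile N delta).
Implicit Types (p q z : player delta).

Definition transit_at p k : nat := if onth (sigma p) k is Some e then transit e else 0.

Lemma size_hist_between p k u s : enters sigma p k u -> u <= s ->
  (forall x, enters sigma p k.+1 x -> s < x) -> size (hist sigma s p) = k.+1.
Proof.
move=> ku us nx; have [ks _] := enters_hist ku us.
apply/eqP; rewrite eqn_leq ks andbT leqNgt; apply/negP => k1.
have ds : depart p <= s by have := enters_depart ku; lia.
by have [/nx] := hist_enters ds k1; lia.
Qed.

Lemma waits_between p k u s e : enters sigma p k u -> u <= s ->
  onth (sigma p) k = Some e ->
  (forall x, enters sigma p k.+1 x -> s < x) -> waits sigma p s = (u + transit e <= s).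
Proof.
move=> ku us ke nx; have sz := size_hist_between ku us nx.
rewrite /waits /in_queue sz /= ke -nth_last sz /=.
by have [_ ->] := enters_hist ku us.
Qed.

Lemma waits_early p s : s < depart p -> waits sigma p s = false.
Proof.
move=> sp; rewrite /waits /in_queue hist_early //=.
by case: (sigma p) => [|e r] //; apply/negbTE; lia.
Qed.

Lemma sum_waits_early p : \sum_(0 <= s < depart p) waits sigma p s = 0.
Proof. by rewrite big_nat big1 // => s /andP[_ /waits_early ->]. Qed.

Lemma sum_waits p k u : enters sigma p k u ->
  \sum_(0 <= s < u) waits sigma p s + \sum_(0 <= i < k) transit_at p i + depart p = u.
Proof.
elim: k u => [|k IH] x kx.
  move: kx; rewrite enters0 => /eqP ->.
  by rewrite sum_waits_early big_geq.
have [u ku ux] := enters_prefix kx (leqnSn k).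
have [e ke] := lt_onth (enters_size kx).
have ue := enters_transit kx ku ke.
have tl : \sum_(u <= s < x) waits sigma p s = x - (u + transit e).
  rewrite -(@sum_leq_nat _ u); last by lia.
  apply: eq_big_nat => s /andP[us sx]; congr nat_of_bool.
  by apply: (waits_between ku us ke) => y /(enters_uniq kx) <-.
rewrite (big_cat_nat (n := u)) //= big_nat_recr //= tl {2}/transit_at ke.
by have := IH u ku; lia.
Qed.

(** If p has not yet reached the head of her current edge, her waits on it are the truncated
    difference 0, and the full transit cost of that edge makes up for it. *)
Lemma sum_waits_unfinished p k u t e : enters sigma p k u -> u <= t ->
  onth (sigma p) k = Some e -> (forall x, enters sigma p k.+1 x -> t < x) ->
  t.+1 <= \sum_(0 <= s < t.+1) waits sigma p s
        + \sum_(0 <= i < size (sigma p)) transit_at p i + depart p.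
Proof.
move=> ku ut ke nx; have := sum_waits ku; have kl := onth_lt ke.
have tl : \sum_(u <= s < t.+1) waits sigma p s = t.+1 - (u + transit e).
  rewrite -(@sum_leq_nat _ u); last by lia.
  apply: eq_big_nat => s /andP[us sx]; congr nat_of_bool.
  by apply: (waits_between ku us ke) => y /nx; lia.
rewrite (big_cat_nat (n := u) (p := t.+1)) //=; last exact: leqW.
rewrite tl (big_cat_nat (n := k) (p := size _)) //=; last exact: ltnW.
have te : transit_at p k = transit e by rewrite /transit_at ke.
rewrite (big_ltn kl) te; lia.
Qed.

Lemma transit_costE p :
  transit_cost R sigma p = ((\sum_(0 <= i < size (sigma p)) transit_at p i)%N)%:R%:E.
Proof.
rewrite /transit_cost big_mkord /transit_at; elim: (sigma p) => [|e r IH].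
  by rewrite big_nil big_ord0.
by rewrite big_cons IH big_ord_recl /= natrD EFinD.
Qed.

Let W p T : \bar R := (\sum_(0 <= s < T) (waits sigma p s)%:R%:E)%E.

Let WE p T : W p T = ((\sum_(0 <= s < T) waits sigma p s)%N)%:R%:E.
Proof. by rewrite /W sumEFin natr_sum. Qed.

Let W_le p T : (W p T <= waiting_time R sigma p)%E.
Proof. by apply: nneseries_lim_ge => n _ _; rewrite lee_fin ler0n. Qed.

Lemma latency_finish p x : enters sigma p (size (sigma p)) x ->
  latency R sigma p = (x - depart p)%:R%:E.
Proof.
move=> fx; rewrite /latency transit_costE /waiting_time.
rewrite (nneseries_split 0 x) => [|k _]; last by rewrite lee_fin ler0n.
rewrite add0n eseries0 => [|s xs _]; last first.
  have [sz _] := enters_hist fx xs.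
  rewrite /waits /in_queue; case E : onth => [e|//]; have := onth_lt E; lia.
rewrite adde0 -/(W p x) WE -EFinD -natrD; congr _%:R%:E.
by have := sum_waits fx; lia.
Qed.

(* The hypothesis is empty for a player stuck forever, whose latency is +oo. *)
Lemma latency_ge p c : is_route (sigma p) ->
  (forall x, enters sigma p (size (sigma p)) x -> depart p + c <= x) ->
  (c%:R%:E <= latency R sigma p)%E.
Proof.
move=> rp late.
have [[x fx]|nf] := pselect (exists x, enters sigma p (size (sigma p)) x).
  by rewrite (latency_finish fx) lee_fin ler_nat; have := late x fx; lia.
pose t := depart p + c; pose k := (size (hist sigma t p)).-1.
have sz : 0 < size (hist sigma t p) by have [s ->] := hist_head sigma t p.
have dt : depart p <= t by rewrite /t; lia.
have kt : k < size (hist sigma t p) by rewrite /k; lia.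
have [ku ut] := hist_enters dt kt; set u := nth _ _ _ in ku ut.
have [e ke] : exists e, onth (sigma p) k = Some e.
  apply: lt_onth; have := enters_size ku; rewrite leq_eqVlt => /orP[/eqP kE|//].
  by case: nf; exists u; rewrite -kE.
have nx x : enters sigma p k.+1 x -> t < x.
  by move=> kx; rewrite ltnNge; apply/negP => /(enters_hist kx)[]; rewrite /k; lia.
have := sum_waits_unfinished ku ut ke nx => le.
apply: (@le_trans _ _ (transit_cost R sigma p + W p t.+1)%E); last first.
  by rewrite leeD2l // W_le.
by rewrite transit_costE WE -EFinD -natrD lee_fin ler_nat /t; rewrite /t in le; lia.
Qed.

Lemma latency_le p c : is_route (sigma p) -> (latency R sigma p <= c%:R%:E)%E ->
  exists2 x, enters sigma p (size (sigma p)) x & x <= depart p + c.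
Proof.
move=> rp lc; apply: contrapT => nf; move: lc; apply/negP; rewrite -ltNge.
apply: (@lt_le_trans _ _ (c.+1)%:R%:E); first by rewrite lte_fin ltr_nat.
apply: latency_ge => // x fx; rewrite leqNgt; apply/negP => xc.
by apply: nf; exists x => //; lia.
Qed.

Lemma latency_ge0 p : (0 <= latency R sigma p)%E.
Proof.
apply: adde_ge0; first by rewrite transit_costE lee_fin ler0n.
by apply: nneseries_ge0 => n _ _; rewrite lee_fin ler0n.
Qed.

Lemma arrival_source p : arrival_time R sigma p (source N) = (depart p)%:R%:E.
Proof.
apply/eqP; rewrite eq_le; apply/andP; split.
  by apply: ereal_inf_lbound; exists (depart p) => //=; rewrite /arrived leqnn eqxx.
by apply: le_ereal_inf_tmp => _ [t /andP[dt _] <-]; rewrite lee_fin ler_nat.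
Qed.

Lemma arrival_le p k x e : onth (sigma p) k = Some e -> enters sigma p k.+1 x ->
  (arrival_time R sigma p (head e) <= x%:R%:E)%E.
Proof.
move=> ke kx; apply: ereal_inf_lbound; exists x => //=.
rewrite /arrived (enters_depart kx) /=; apply/orP; right; apply/hasP; exists e => //.
have [k1 _] := enters_hist kx (leqnn x); have kl := onth_lt ke.
have km : k < (size (hist sigma x p)).-1 by lia.
have nE : nth e (take (size (hist sigma x p)).-1 (sigma p)) k = e.
  by rewrite nth_take //; move: ke; rewrite onthE (nth_map e) // => -[].
by rewrite -{1}nE mem_nth // size_take; case: ifP.
Qed.

Lemma arrival_ge p v a : v != source N ->
  (forall k x e, onth (sigma p) k = Some e -> head e = v -> enters sigma p k.+1 x ->
     a <= x) ->
  (a%:R%:E <= arrival_time R sigma p v)%E.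
Proof.
move=> vs late; apply: le_ereal_inf_tmp => _ [t + <-]; rewrite /= /arrived (negPf vs) /=.
move=> /andP[dt /hasP[e ein /eqP he]]; rewrite lee_fin ler_nat.
set s := take _ _ in ein; have i := index_mem e s; rewrite ein in i.
have nE := nth_index e ein; set k := index e s in i nE.
have kh : k.+1 < size (hist sigma t p).
  by move: i; rewrite size_take; case: ifP; lia.
have [kx le] := hist_enters dt kh; apply: leq_trans le; apply: late he kx.
have kl : k < size (sigma p) by have := size_hist sigma t p; lia.
rewrite onthE (nth_map e) //; congr Some; rewrite -[RHS]nE nth_take //.
by move: i; rewrite size_take; case: ifP; lia.
Qed.

End Latency.

(** * Certificates for uniformly fastest route equilibria *)

Section Certificate.
Variables (R : realType) (N : prenetwork) (delta : nat) (sigma : profile N delta).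
Variable S : player delta -> nat -> nat.
Implicit Types (p q z : player delta).

Lemma deviate_eq p r : deviate sigma p r p = r.
Proof. by rewrite /deviate eqxx. Qed.

Lemma deviate_neq p r q : q != p -> deviate sigma p r q = sigma q.
Proof. by rewrite /deviate => /negPf ->. Qed.

Definition schedule : Prop :=
  [/\ forall q, S q 0 = depart q,
      forall q k e, onth (sigma q) k = Some e -> S q k + transit e <= S q k.+1 &
      forall q k e L, onth (sigma q) k = Some e -> uniq L ->
        (forall zj, zj \in L -> sched_ahead sigma predT S (S q k.+1) q k zj) ->
        size L < capacity e].

Definition blocked_by (Q : pred (player delta)) : Prop :=
  forall q k e, Q q -> onth (sigma q) k = Some e ->
    S q k + transit e < S q k.+1 -> exists L, [/\ uniq L, capacity e <= size L &
    forall zj, zj \in L -> sched_ahead sigma Q S (S q k.+1).-1 q k zj].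

(* The players of Q, all ahead of the others, follow the schedule whatever p
   does, and nobody else reaches a vertex v before stage a v. *)
Record barrier p (Q : pred (player delta)) (a : vertex N -> nat) : Prop := Barrier {
  barrier_out : ~~ Q p;
  barrier_prio : forall q z, Q q -> ~~ Q z -> prio q z;
  barrier_blocked : blocked_by Q;
  barrier_source : forall z, ~~ Q z -> a (source N) <= depart z;
  barrier_before : forall q k e, Q q -> onth (sigma q) k = Some e ->
    S q k <= a (tail e);
  barrier_edge : forall e, e \in edges N -> a (head e) <= a (tail e) + transit e \/
    exists L, [/\ uniq L, capacity e <= size L & forall zj, zj \in L ->
      [/\ Q zj.1, onth (sigma zj.1) zj.2 = Some e & a (head e) <= (S zj.1 zj.2.+1).+1]];
  barrier_tight : forall k e, onth (sigma p) k = Some e ->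
    exists k' f, [/\ onth (sigma p) k' = Some f, head f = head e &
      S p k'.+1 <= a (head e)];
  barrier_dest : S p (size (sigma p)) <= a (dest N)
}.

Hypothesis source_dest : source N != dest N.
Hypothesis sigma_profile : is_profile sigma.
Hypothesis S_schedule : schedule.
Hypothesis S_blocked : blocked_by predT.

(** With Q the set of all players there are no outsiders to bound, and all labels can be 0. *)
Lemma schedule_exact q k u : k <= size (sigma q) -> enters sigma q k u <-> u = S q k.
Proof.
have [S0 S1 S2] := S_schedule => ks.
by apply: (@barrier_exact _ _ sigma predT S (fun=> 0)) => // [q0 j e _|q0 j e L _| e _];
  [exact: S1 | exact: S2 | left].
Qed.

Lemma schedule_latency p :
  latency R sigma p = (S p (size (sigma p)) - depart p)%:R%:E.
Proof. by apply: latency_finish; apply/schedule_exact. Qed.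

Hypothesis barriers : forall p, exists Q a, barrier p Q a.

(** As p lies outside Q, a deviation of hers changes no route in Q, so the same barrier bounds all
    her deviations at once. A route may return to a vertex, which is why [barrier_tight] asks only
    one of the visits to attain the label. *)
Lemma certificate_UFR : sigma \in @UFR R N delta.
Proof.
have [S0 S1 S2] := S_schedule.
have bound p : exists a : vertex N -> nat, [/\
    forall r k u e, is_route r -> onth r k = Some e ->
      enters (deviate sigma p r) p k.+1 u -> a (head e) <= u,
    forall k e, onth (sigma p) k = Some e -> exists k' f,
      [/\ onth (sigma p) k' = Some f, head f = head e & S p k'.+1 <= a (head e)] &
    S p (size (sigma p)) <= a (dest N)].
  have [Q [a [out pr bl so be ed ti de]]] := barriers p; exists a; split=> //.
  move=> r k u e rr ke ku.
  have devQ q : Q q -> deviate sigma p r q = sigma q.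
    by move=> Qq; apply: deviate_neq; apply: contraNneq out => <-.
  apply: (@barrier_bound _ _ (deviate sigma p r) Q S a _ _ _ _ _ _ _ _ _ p k) ku => //.
  - by move=> q j f Qq; rewrite devQ //; exact: S1.
  - move=> q j f L Qq; rewrite devQ // => jf uL sL; apply: (S2 q j f L jf uL) => zj.
    by move=> /sL[Qz]; rewrite !devQ.
  - move=> q j f Qq; rewrite devQ // => jf /(bl q j f Qq jf)[L [uL cL sL]].
    by exists L; split=> // zj /sL[Qz ? ? ?]; split; rewrite ?devQ.
  - by move=> z nQz; rewrite /deviate; case: eqP => // _; exact: sigma_profile.
  - by move=> z q j f _ Qq; rewrite devQ //; exact: be.
  - move=> f /ed[|[L [uL cL sL]]]; first by left.
    by right; exists L; split=> // zj /sL[Qz ? ?]; split; rewrite ?devQ.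
  - by rewrite deviate_eq.
rewrite inE; split; first split=> // p r rr.
  have [a [late _ Sd]] := bound p; rewrite schedule_latency; apply: latency_ge.
    by rewrite deviate_eq.
  move=> x; rewrite deviate_eq => fx; have dx := enters_depart fx.
  have r0 := walk_nonempty source_dest rr.
  have [e re] : exists e, onth r (size r).-1 = Some e by apply: lt_onth; lia.
  have : a (head e) <= x by apply: late rr re _; rewrite prednK.
  by rewrite (walk_last rr re); lia.
move=> p v von [r [rr]]; apply/negP; rewrite -leNgt.
have [->|vs] := eqVneq v (source N); first by rewrite !arrival_source.
have [k [e [ke ev]]] : exists k e, onth (sigma p) k = Some e /\ head e = v.
  move: von => /hasP[e /(nthP e)[k ks ke] ev].
  have {ke} : onth (sigma p) k = Some e by rewrite onthE (nth_map e) // ke.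
  case/orP: ev => /eqP ev ke; last by exists k, e.
  case: k ks ke => [|k] ks ke.
    by rewrite -ev (walk_tail (sigma_profile p) ke) eqxx in vs.
  have [f kf] := lt_onth (ltnW ks).
  by exists k, f; rewrite -(walk_next (sigma_profile p) kf ke).
have [a [late tight _]] := bound p.
have [k' [f [kf fe Sa]]] := tight k e ke.
have kf' := onth_lt kf.
apply: (@le_trans _ _ (S p k'.+1)%:R%:E).
  rewrite -ev -fe; apply: arrival_le kf _; exact/schedule_exact.
apply: (@le_trans _ _ (a v)%:R%:E); first by rewrite lee_fin ler_nat -ev.
apply: arrival_ge => // j x g; rewrite deviate_eq => jg <-.
exact: late rr jg.
Qed.

End Certificate.

(** * Queues *)

Section Queues.
Variables (N : prenetwork) (delta : nat) (sigma : profile N delta).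
Implicit Types (p q z : player delta) (L : seq (player delta * nat)).

Lemma precedes_trans v q j u p k w z l :
  @precedes delta v q j u p k -> precedes u p k w z l -> precedes v q j w z l.
Proof.
rewrite /precedes => /orP[vu|/andP[/eqP<- qp]] /orP[uw|/andP[/eqP<- pz]].
- by rewrite (ltn_trans vu uw).
- by rewrite vu.
- by rewrite uw.
rewrite eqxx ltnn /=; case/orP: qp => [qp|/andP[/eqP-> jk]] //; last first.
  by case/orP: pz => [->//|/andP[-> /(ltn_trans jk)->]]; rewrite orbT.
by case/orP: pz => [/(prio_trans qp)->//|/andP[/eqP<- _]]; rewrite qp.
Qed.

Lemma precedes_irr v q j : @precedes delta v q j v q j = false.
Proof. by rewrite /precedes !ltnn prio_irr !andbF. Qed.

Lemma precedes_total v q j u p k : (q, j) != (p, k) ->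
  @precedes delta v q j u p k || precedes u p k v q j.
Proof.
rewrite /precedes xpair_eqE; case: (ltngtP v u) => //= _.
case: (eqVneq q p) => [->|qp] /=; first by rewrite prio_irr /= neq_ltn.
by case/orP: (prio_total qp) => ->; rewrite ?orbT.
Qed.

Lemma last_to_enter e x L :
  (forall qj, qj \in L -> onth (sigma qj.1) qj.2 = Some e /\ enters sigma qj.1 qj.2.+1 x) ->
  L != [::] -> exists m u, [/\ m \in L, enters sigma m.1 m.2 u & forall qj, qj \in L ->
    qj != m -> queued_ahead sigma x m.1 m.2 u qj].
Proof.
elim: L => [//|[q j] L IH] sL _.
have [/= je jx] := sL _ (mem_head _ _); have [v jv _] := enters_prefix jx (leqnSn j).
have ahead y k z l w u : enters sigma y k w -> onth (sigma y) k = Some e ->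
    enters sigma y k.+1 x -> precedes w y k u z l -> onth (sigma z) l = Some e ->
    queued_ahead sigma x z l u (y, k).
  move=> kw ke kx pr ze; split=> /=; first by exists w.
  - by rewrite ke ze.
  - by apply: not_left_before => t /(enters_uniq kx) ->.
have [L0|L0] := eqVneq L [::].
  exists (q, j), v; split=> //=; first exact: mem_head.
  by move=> qj; rewrite L0 inE => ->.
have [[p k] [u [mL mu sm]]] : exists m u, [/\ m \in L, enters sigma m.1 m.2 u &
    forall qj, qj \in L -> qj != m -> queued_ahead sigma x m.1 m.2 u qj].
  by apply: IH => // qj qjL; apply: sL; rewrite inE qjL orbT.
have [|/= ke kx] := sL (p, k); first by rewrite inE mL orbT.
have [qp|qp] := eqVneq (q, j) (p, k).
  exists (p, k), u; split=> // [|qj]; first by rewrite inE mL orbT.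
  by rewrite inE => /orP[/eqP->|/sm//]; rewrite qp eqxx.
have /orP[pr|pr] := precedes_total v u qp.
  exists (p, k), u; split=> // [|qj]; first by rewrite inE mL orbT.
  by rewrite inE => /orP[/eqP-> _|/sm//]; apply: ahead pr _.
exists (q, j), v; split=> // [|[z l]]; first exact: mem_head.
rewrite inE => /orP[/eqP->|zL _]; first by rewrite eqxx.
have [zp|zp] := eqVneq (z, l) (p, k).
  by rewrite zp; apply: ahead pr _.
have [[w lw prw] _ _] := sm _ zL zp.
have [|/= le lx] := sL (z, l); first by rewrite inE zL orbT.
exact: ahead lw le lx (precedes_trans prw pr) je.
Qed.

(** Among the passages that leave e at x, the last to have entered finds all the others ahead, so
    there are fewer than [capacity e] of those. *)
Lemma exits_per_stage e x L : uniq L ->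
  (forall qj, qj \in L -> onth (sigma qj.1) qj.2 = Some e /\ enters sigma qj.1 qj.2.+1 x) ->
  size L <= capacity e.
Proof.
have [->//|L0] := eqVneq L [::]; move=> uL sL.
have [[p k] [u [mL mu sm]]] := last_to_enter sL L0.
have [/= ke kx] := sL _ mL.
rewrite -(prednK (_ : 0 < size L)) ?lt0n ?size_eq0 // -(size_rem mL).
apply: enters_blocked kx mu ke (rem_uniq _ uL) _ => qj.
by rewrite mem_rem_uniq // inE => /andP[qm qL]; apply: sm.
Qed.

Lemma exits_between e v T L : uniq L ->
  (forall qj, qj \in L -> onth (sigma qj.1) qj.2 = Some e /\
     exists2 x, enters sigma qj.1 qj.2.+1 x & v <= x < v + T) ->
  size L <= capacity e * T.
Proof.
elim: T L => [|T IH] L uL sL.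
  by case: L sL {uL} => [//|qj L] /(_ _ (mem_head _ _))[_ [x _]]; lia.
rewrite mulnS -(count_predC (fun qj => enters sigma qj.1 qj.2.+1 (v + T)) L).
rewrite -!size_filter leq_add //.
  apply: (@exits_per_stage e (v + T)); first exact: filter_uniq.
  by move=> qj; rewrite mem_filter => /andP[? /sL[]].
apply: IH => [|qj]; first exact: filter_uniq.
rewrite mem_filter => /andP[/= nT /sL[-> [x qx vx]]]; split=> //; exists x => //.
by have [xE|] := eqVneq x (v + T); [rewrite -xE qx in nT | lia].
Qed.

(** By induction on the entry stage: whoever entered e earlier has left before p reaches its head,
    so only those who entered together with p can be ahead of her. *)
Lemma no_queue e :
  (forall x L, uniq L -> (forall qj, qj \in L ->
     onth (sigma qj.1) qj.2 = Some e /\ enters sigma qj.1 qj.2 x) ->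
     size L <= capacity e) ->
  forall p k u, onth (sigma p) k = Some e -> enters sigma p k u ->
  enters sigma p k.+1 (u + transit e).
Proof.
move=> few p k u; elim/ltn_ind: u p k => u IH p k ke ku.
have ex : k.+1 < size (hist sigma (u + transit e) p).
  apply: (enters_release ku ke (leqnn _)) => L uL sL.
  have pL : (p, k) \notin L.
    apply/negP => /sL[[v /= kv]]; rewrite (enters_uniq kv ku).
    by rewrite precedes_irr.
  rewrite -[X in X <= _]/(size ((p, k) :: L)).
  apply: (few u); first by rewrite /= pL.
  move=> [q j]; rewrite inE => /orP[/eqP-> //|/sL[[v /= jv prec] je out]].
  rewrite je ke; split=> //.
  have [vu|uv|<-//] := ltngtP v u; last first.
    by move: prec; rewrite /precedes; lia.
  have jx := IH v vu q j (etrans je ke) jv.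
  by move: out; rewrite (left_before jx) //; lia.
have dx : depart p <= u + transit e by have := enters_depart ku; lia.
have [kx le] := hist_enters dx ex.
have ge := enters_transit kx ku ke; move: kx ge le; set y := nth _ _ _ => kx ge le.
by have <- : y = u + transit e by lia.
Qed.

End Queues.

(** * Comparison of two profiles that agree on the players ahead *)

Section Agree.
Variables (N : prenetwork) (delta : nat) (Q : pred (player delta)) (T : nat).
Implicit Types (p q z : player delta) (sigma rho : profile N delta).

Hypothesis Q_prio : forall q z, Q q -> ~~ Q z -> prio q z.

(** A tie is allowed, since [Q_prio] decides it in favour of the player of Q. *)
Definition not_overtaken sigma := forall q k u z j v, Q q -> ~~ Q z ->
  enters sigma q k u -> u <= T -> enters sigma z j v ->
  onth (sigma z) j = onth (sigma q) k -> u <= v.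

Lemma agree_half sigma rho x q k : not_overtaken rho -> (forall z, Q z -> sigma z = rho z) ->
  (forall z j y, Q z -> y < x -> enters sigma z j y <-> enters rho z j y) ->
  (forall z j, Q z -> prio z q || ((z == q) && (j <= k)) ->
     enters sigma z j x <-> enters rho z j x) ->
  Q q -> x <= T -> enters sigma q k.+1 x -> enters rho q k.+1 x.
Proof.
move=> nov same IHx IHq Qq xT kx.
have [u ku ux] := enters_prefix kx (leqnSn k).
have [e ke] := lt_onth (enters_size kx).
have ue := enters_transit kx ku ke.
have ku' : enters rho q k u.
  move: ux; rewrite leq_eqVlt => /orP[/eqP uE|/IHx <- //].
  by rewrite uE in ku *; apply/IHq; rewrite ?eqxx ?leqnn ?orbT.
have ke' : onth (rho q) k = Some e by rewrite -same.
have ex : k.+1 < size (hist rho x q).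
  apply: (enters_release ku' ke' ue) => L uL sL.
  apply: (enters_blocked kx ku ke uL) => -[z j] /sL[[v /= jv prec] je out].
  have vu : v <= u by move: prec; rewrite /precedes; lia.
  have Qz : Q z.
    apply/negPn/negP => nQz; have qz := Q_prio Qq nQz.
    have uv := nov q k u z j v Qq nQz ku' (leq_trans ux xT) jv je.
    move: prec; rewrite /precedes ltnNge uv /= => /andP[_ /orP[/prio_asym/(_ qz)//|]].
    by move=> /andP[/eqP zq]; rewrite zq Qq in nQz.
  split=> /=; last 1 first.
  - apply: not_left_before => y jy; rewrite leqNgt; apply/negP => yx.
    by move/IHx: jy => /(_ Qz yx) jy; move: out; rewrite (left_before jy).
  - exists v => //; move: (leq_trans vu ux); rewrite leq_eqVlt => /orP[/eqP vx|vx].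
      rewrite vx in jv *; apply/IHq => //; move: prec; rewrite /precedes.
      have -> : v < u = false by lia.
      by case/andP=> _ /orP[->//|/andP[-> /ltnW->]]; rewrite orbT.
    exact/IHx.
  - by rewrite !same.
have dx : depart q <= x by have := enters_depart ku; lia.
have [ky le] := hist_enters dx ex.
move: le; rewrite leq_eqVlt => /orP[/eqP <-//|lt].
by move/IHx: ky => /(_ Qq lt) ky; have := enters_uniq kx ky; lia.
Qed.

(** In both profiles only players of Q are ahead of a player of Q up to stage T, so the two
    evolutions have no occasion to part. *)
Lemma agree sigma rho : not_overtaken sigma -> not_overtaken rho ->
  (forall z, Q z -> sigma z = rho z) ->
  forall x q k, Q q -> x <= T -> enters sigma q k x <-> enters rho q k x.
Proof.
move=> novs novr same; elim/ltn_ind => x IHx q k Qq xT; elim/prio_ind: q k Qq => q IHq.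
elim/ltn_ind => -[|k] IHk Qq; first by rewrite !enters0.
have IHx' z j y : Q z -> y < x -> enters sigma z j y <-> enters rho z j y.
  by move=> Qz yx; apply: IHx => //; lia.
have IHq' z j : Q z -> prio z q || ((z == q) && (j <= k)) ->
    enters sigma z j x <-> enters rho z j x.
  by move=> Qz /orP[/IHq|/andP[/eqP-> jk]]; [exact | exact: IHk].
split; first exact: agree_half.
apply: agree_half => // [z Qz|z j y Qz yx|z j Qz zq].
- by rewrite same.
- by split=> /(IHx' z j y Qz yx).
- by split=> /(IHq' z j Qz zq).
Qed.

End Agree.

(** * Long-run averages and efficiency *)

Section FreeFlow.
Variables (R : realType) (N : prenetwork) (delta : nat) (sigma : profile N delta).
Variable dist : vertex N -> nat.
Implicit Types (p q z : player delta) (L : seq (player delta * nat)).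

Hypothesis source_dest : source N != dest N.
Hypothesis sigma_profile : is_profile sigma.
Hypothesis dist_source : dist (source N) = 0.
Hypothesis dist_edge : forall e, e \in edges N -> dist (head e) <= dist (tail e) + transit e.
Hypothesis dist_route : forall q k e, onth (sigma q) k = Some e ->
  dist (head e) = dist (tail e) + transit e.
Hypothesis light : forall g e L, uniq L ->
  (forall qj, qj \in L -> qj.1.1 = g /\ onth (sigma qj.1) qj.2 = Some e) ->
  size L <= capacity e.

Let S q k := depart q + \sum_(0 <= i < k) transit_at sigma q i.

Let S_tail q k e : onth (sigma q) k = Some e -> S q k = depart q + dist (tail e).
Proof.
rewrite /S; elim: k e => [|k IH] f kf.
  by rewrite (walk_tail (sigma_profile q) kf) dist_source big_geq.
have [e ke] : exists e, onth (sigma q) k = Some e.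
  by apply: lt_onth; have := onth_lt kf; lia.
have te : transit_at sigma q k = transit e by rewrite /transit_at ke.
rewrite big_nat_recr //= te addnA (IH e ke) -addnA -(dist_route ke).
by rewrite (walk_next (sigma_profile q) ke kf).
Qed.

Let S_head q k e : onth (sigma q) k = Some e -> S q k.+1 = depart q + dist (head e).
Proof.
move=> ke; have te : transit_at sigma q k = transit e by rewrite /transit_at ke.
by rewrite (dist_route ke) addnA -(S_tail ke) /S big_nat_recr //= te addnA.
Qed.

(** Everybody enters e at distance [dist (tail e)] after departure, so only members of one
    generation can compete for it, and [light] bounds their number. *)
Let S_schedule : schedule sigma S.
Proof.
split=> [q|q k e ke|q k e L ke uL sL].
- by rewrite /S big_geq // addn0.
- by rewrite (S_head ke) (S_tail ke) (dist_route ke) addnA.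
- have qL : (q, k) \notin L.
    by apply/negP => /sL[_ _ /=]; rewrite precedes_irr.
  rewrite -[X in X <= _]/(size ((q, k) :: L)).
  apply: (light (g := q.1)); first by rewrite /= qL.
  move=> [z j]; rewrite inE => /orP[/eqP-> //|/sL[_ /= je prec out]].
  rewrite je ke; split=> //; move: prec out; rewrite /precedes /=.
  rewrite (S_head ke) (S_tail ke) (S_head (etrans je ke)) (S_tail (etrans je ke)).
  by rewrite /depart; lia.
Qed.

Let S_blocked Q : blocked_by sigma S Q.
Proof. by move=> q k e _ ke; rewrite (S_head ke) (S_tail ke) (dist_route ke); lia. Qed.

Let S_dest p : S p (size (sigma p)) = depart p + dist (dest N).
Proof.
have r0 := walk_nonempty source_dest (sigma_profile p).
have [e re] : exists e, onth (sigma p) (size (sigma p)).-1 = Some e.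
  by apply: lt_onth; lia.
have := S_head re; rewrite prednK // => ->.
by rewrite (walk_last (sigma_profile p) re) // prednK.
Qed.

Lemma free_flow_latency p : latency R sigma p = (dist (dest N))%:R%:E.
Proof. by rewrite (schedule_latency R sigma_profile S_schedule) // S_dest addKn. Qed.

(** Every player already travels at the distances of the network, which not even a player alone in
    it could beat. *)
Lemma free_flow_UFR : sigma \in @UFR R N delta.
Proof.
apply: (certificate_UFR R source_dest sigma_profile S_schedule) => // p.
exists (fun q => q.1 < p.1), (fun v => depart p + dist v); split=> //=.
- by rewrite ltnn.
- by move=> q z; rewrite /prio; lia.
- by move=> z; rewrite dist_source /depart; lia.
- by move=> q k e qp ke; rewrite (S_tail ke) /depart; lia.
- by move=> e eN; left; have := dist_edge eN; lia.
- by move=> k e ke; exists k, e; rewrite (S_head ke).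
- by rewrite S_dest.
Qed.

End FreeFlow.

Section Averages.
Variables (R : realType) (N : prenetwork) (delta : nat) (sigma : profile N delta).
Local Open Scope ereal_scope.

Lemma gen_latency_ge0 g : 0 <= gen_latency R sigma g.
Proof. by apply: sume_ge0 => i _; exact: latency_ge0. Qed.

Lemma avg_esup_le (c : nat) : (forall p, latency R sigma p <= c%:R%:E) ->
  limn_esup (avg_latency R sigma) <= (delta * c)%N%:R%:E.
Proof.
move=> le.
have gen_le g : gen_latency R sigma g <= (delta * c)%N%:R%:E.
  apply: (@le_trans _ _ (\sum_(i < delta) c%:R%:E)); first exact: lee_sum.
  by rewrite sumEFin sumr_const card_ord lee_fin natrM mulr_natl.
have avg_le T : avg_latency R sigma T <= (delta * c)%N%:R%:E.
  rewrite /avg_latency; have [->|T0] := posnP T.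
    by rewrite big_geq // mule0 lee_fin.
  apply: (@le_trans _ _ ((T%:R^-1)%:E * (T%:R * (delta * c)%N%:R)%R%:E)).
    apply: lee_wpmul2l; first by rewrite lee_fin invr_ge0.
    apply: (@le_trans _ _ (\sum_(0 <= g < T) (delta * c)%N%:R%:E)); first exact: lee_sum.
    by rewrite sumEFin big_const_nat subn0 iter_addr_0 lee_fin mulr_natl.
  by rewrite -EFinM mulKf // pnatr_eq0 -lt0n.
rewrite limn_esup_lim; apply: lime_le; first exact: is_cvg_esups.
apply: nearW => n; apply: ge_ereal_sup => _ [m /= _ <-].
exact: avg_le.
Qed.

(* The bounded defect C is spread over T generations, so it does not count. *)
Lemma avg_einf_ge (c C : nat) :
  (forall T, (c * T)%N%:R%:E <= \sum_(0 <= g < T) gen_latency R sigma g + C%:R%:E) ->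
  c%:R%:E <= limn_einf (avg_latency R sigma).
Proof.
move=> ge.
have avg_ge T : (0 < T)%N -> (c%:R - C%:R / T%:R)%R%:E <= avg_latency R sigma T.
  move=> T0; have T0' : (T%:R != 0 :> R)%R by rewrite pnatr_eq0 -lt0n.
  have -> : (c%:R - C%:R / T%:R)%R%:E = (T%:R^-1)%:E * ((c * T)%N%:R - C%:R)%R%:E :> \bar R.
    by rewrite -EFinM mulrBr natrM mulrCA mulVf // mulr1 mulrC.
  apply: lee_wpmul2l; first by rewrite lee_fin invr_ge0.
  by rewrite EFinB leeBlDr.
apply/lee_addgt0Pr => e e0; rewrite -leeBlDr // -EFinB.
(* From M generations on, the defect weighs at most e in the average. *)
have [M M0 Me] : exists2 M, (0 < M)%N & (C%:R / M%:R <= e)%R.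
  exists (Num.bound (C%:R / e)).+1 => //.
  have Mb : (C%:R / e < (Num.bound (C%:R / e)).+1%:R)%R.
    apply: lt_le_trans (archi_boundP _) _; last by rewrite ler_nat.
    by rewrite divr_ge0 // ltW.
  by rewrite ler_pdivrMr ?ltr0n // mulrC -ler_pdivrMr // ltW.
rewrite limn_einf_lim (cvg_lim _ (@cvg_einfs_sup _ _)) //.
apply: (@le_trans _ _ (einfs (avg_latency R sigma) M)); last first.
  by apply: ereal_sup_ubound; exists M.
apply: le_ereal_inf_tmp => _ [m /= Mm <-].
have m0 : (0 < m)%N by exact: leq_trans Mm.
apply: le_trans (avg_ge m m0); rewrite lee_fin lerD2l lerN2.
apply: le_trans Me; apply: ler_wpM2l => //.
by rewrite lef_pV2 ?posrE ?ltr0n // ler_nat.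
Qed.

End Averages.

(** * Removal of edges *)

Section Removal.
Variables (R : realType) (N : prenetwork) (delta : nat) (F : {set edge N}).

(** The dynamics reads routes, transit costs and capacities, but never the set [edges]. *)
Lemma hist_remove (sigma : profile N delta) t :
  hist (N := remove_edges F) sigma t = hist (N := N) sigma t.
Proof. by elim: t => [//|t IH] /=; rewrite IH. Qed.

Lemma latency_remove (sigma : profile N delta) :
  latency R (N := remove_edges F) sigma = latency R (N := N) sigma.
Proof.
apply/funext => p; congr (_ + _)%E; apply/congr_lim/funext => n.
by apply: eq_bigr => t _; rewrite /waits hist_remove.
Qed.

Lemma arrival_time_remove (sigma : profile N delta) p v :
  arrival_time R (N := remove_edges F) sigma p v = arrival_time R (N := N) sigma p v.
Proof.
rewrite /arrival_time; congr (ereal_inf (image _ _)); apply/funext => t.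
by rewrite /= /arrived hist_remove.
Qed.

Lemma avg_latency_remove (sigma : profile N delta) :
  avg_latency R (N := remove_edges F) sigma = avg_latency R (N := N) sigma.
Proof. by apply/funext => T; rewrite /avg_latency /gen_latency latency_remove. Qed.

Lemma walk_remove u r v : walk (N := remove_edges F) u r v -> walk (N := N) u r v.
Proof.
elim: r u => [//|e r IH] u /= /and3P[eF -> /IH ->].
by move: eF; rewrite /= finset.inE => /andP[_ ->].
Qed.

Lemma is_profile_remove (sigma : profile N delta) :
  is_profile (N := remove_edges F) sigma -> is_profile sigma.
Proof. by move=> h p; have := h p => /walk_remove. Qed.

(** Removing edges leaves fewer deviations to compare with. *)
Lemma UFR_remove (sigma : profile N delta) : sigma \in @UFR R N delta ->
  is_profile (N := remove_edges F) sigma -> sigma \in @UFR R (remove_edges F) delta.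
Proof.
rewrite !inE => -[[_ nash] fast] prof; split; first split=> // p r /walk_remove rr.
  by rewrite !latency_remove; exact: nash.
move=> p v /fast nr [r [/walk_remove rr lt]]; apply: nr; exists r; split=> //.
by rewrite !arrival_time_remove in lt.
Qed.

End Removal.

(** * From latency bounds to the three efficiency measures *)

Section Efficiency.
Variables (R : realType) (N : prenetwork) (delta c K : nat) (F : {set edge N}).
Variables good bad : profile N delta.
Local Open Scope ereal_scope.

Hypothesis c_gt0 : (0 < c)%N.
Variable delta0 : 'I_delta.
Hypothesis lower : forall sigma : profile N delta, is_profile sigma ->
  c%:R%:E <= limn_einf (avg_latency R sigma).
Hypothesis good_UFR : good \in @UFR R N delta.
Hypothesis good_le : limn_esup (avg_latency R good) <= c%:R%:E.
Hypothesis upper : forall sigma, sigma \in @UFR R N delta ->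
  limn_esup (avg_latency R sigma) <= (c * K)%N%:R%:E.
Hypothesis bad_UFR : bad \in @UFR R N delta.
Hypothesis bad_ge : (c * K)%N%:R%:E <= limn_einf (avg_latency R bad).
Hypothesis F_edges : F \subset edges N.
Hypothesis F_neq0 : F != finset.set0.
Hypothesis F_UFR : exists sigma, sigma \in @UFR R (remove_edges F) delta.
Hypothesis F_upper : forall sigma, sigma \in @UFR R (remove_edges F) delta ->
  limn_esup (avg_latency R sigma) <= c%:R%:E.

Let UFR_profile M (sigma : profile M delta) : sigma \in @UFR R M delta -> is_profile sigma.
Proof. by rewrite inE => -[[]]. Qed.

Let c_neq0 : (c%:R != 0 :> R)%R. Proof. by rewrite pnatr_eq0 -lt0n. Qed.

Let WEqE : WEq R N delta = (c * K)%N%:R%:E.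
Proof.
apply/eqP; rewrite eq_le; apply/andP; split.
  by apply: ge_ereal_sup => _ [sigma /mem_set su <-]; exact: upper.
apply: (le_trans bad_ge); apply: (le_trans (limn_einf_sup _)).
by apply: ereal_sup_ubound; exists bad => //; exact: set_mem.
Qed.

Let goodE : limn_einf (avg_latency R good) = c%:R%:E /\
  limn_esup (avg_latency R good) = c%:R%:E.
Proof.
have lo := lower (UFR_profile good_UFR); have le := limn_einf_sup (avg_latency R good).
split; apply/eqP; rewrite eq_le ?lo ?good_le ?andbT //=; first exact: le_trans good_le.
exact: le_trans le.
Qed.

Let BEqE : BEq R N delta = c%:R%:E.
Proof.
apply/eqP; rewrite eq_le; apply/andP; split.
  by rewrite -goodE.2; apply: ereal_inf_lbound; exists good => //; exact: set_mem.
apply: le_ereal_inf_tmp => _ [sigma /mem_set/UFR_profile su <-].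
exact: le_trans (lower su) (limn_einf_sup _).
Qed.

Let OptE : Opt R N delta = c%:R%:E.
Proof.
have good_opt : socially_optimal R good.
  split=> [|sigma ps]; first exact: UFR_profile.
  by rewrite goodE.2; exact: lower.
rewrite /Opt; apply: xget_unique => [|x [sigma [[ps opt] <- e]]].
  by exists good; split=> //; [exact: goodE.1 | exact: goodE.2].
apply/eqP; rewrite eq_le lower // andbT.
apply: le_trans (limn_einf_sup _) _.
by rewrite -goodE.1; apply: opt; exact: UFR_profile.
Qed.

(** The Braess ratio cannot exceed the price of anarchy: an equilibrium after a removal is still a
    profile of the whole network and so costs at least the optimum c. The removal of F attains this
    bound. *)
Lemma efficiency :
  [/\ PoA R N delta = K%:R%:E, BR R N delta = K%:R%:E & PoS R N delta = 1].
Proof.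
have ratioE : (c * K)%N%:R%:E / c%:R%:E = K%:R%:E :> \bar R.
  by rewrite inver (negPf c_neq0) -EFinM natrM mulrAC divff // mul1r.
have WEq_ge (F' : {set edge N}) (sigma : profile (remove_edges F') delta) :
    sigma \in @UFR R (remove_edges F') delta -> c%:R%:E <= WEq R (remove_edges F') delta.
  move=> su; have := lower (is_profile_remove (UFR_profile su)).
  rewrite -(avg_latency_remove R F') => /le_trans; apply.
  apply: le_trans (limn_einf_sup _) _; apply: ereal_sup_ubound.
  by exists sigma => //; exact: set_mem.
split.
- by rewrite /PoA WEqE OptE ratioE.
- rewrite /BR WEqE; apply/eqP; rewrite eq_le; apply/andP; split; last first.
    have [sigma su] := F_UFR.
    have -> : K%:R%:E = (c * K)%N%:R%:E / WEq R (remove_edges F) delta.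
      rewrite -ratioE; congr (_ * inve _); apply/eqP; rewrite eq_le (WEq_ge _ _ su).
      by apply: ge_ereal_sup => _ [tau /mem_set tu <-]; exact: F_upper.
    apply: ereal_sup_ubound; exists F => //; split=> //.
    by exists (sigma (0%N, delta0)); exact: UFR_profile su _.
  apply: ge_ereal_sup => _ [F' _ <-].
  have [[sigma su]|none] := pselect (exists sigma, sigma \in @UFR R (remove_edges F') delta).
    have := WEq_ge F' sigma su; case: (WEq _ _ _) => [r||//] rc; last first.
      (* A worst equilibrium of value +oo has inverse 0. *)
      by rewrite invey mule0 lee_fin.
    rewrite lee_fin in rc; have r0 : (0 < r)%R by apply: lt_le_trans rc; rewrite ltr0n.
    rewrite inver gt_eqF // -EFinM lee_fin natrM mulrAC -[leRHS]mul1r.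
    by apply: ler_wpM2r => //; rewrite ler_pdivrMr // mul1r.
  (* Without equilibria after the removal the supremum is -oo; its inverse is again -oo, so the
     ratio does not exceed K. *)
  have -> : WEq R (remove_edges F') delta = -oo.
    apply/eqP; rewrite -leeNy_eq; apply: ge_ereal_sup => x [sigma /mem_set su _].
    by case: none; exists sigma.
  have [->|K0] := posnP K; first by rewrite muln0 mul0e.
  by rewrite inveNy gt0_muleNy ?leNye // lte_fin ltr0n muln_gt0 c_gt0.
by rewrite /PoS BEqE OptE inver (negPf c_neq0) -EFinM divff.
Qed.

End Efficiency.

Section Capacity.
Variable N : prenetwork.

Lemma edges_is_cut : source N != dest N -> is_cut (edges N).
Proof.
move=> sd; split=> // r rr; have [e re] := lt_onth (walk_nonempty sd rr).
apply/hasP; exists e; last exact: walk_edges rr re.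
by case: r re {rr} => //= x r [->]; exact: mem_head.
Qed.

Lemma net_capacityE (C : {set edge N}) gamma : source N != dest N ->
  is_cut C -> cut_capacity C = gamma ->
  (forall C' : {set edge N}, is_cut C' -> gamma <= cut_capacity C') -> net_capacity N = gamma.
Proof.
move=> sd cutC capC min; rewrite /net_capacity.
case: arg_minnP => [|D /asboolP/min gD leD].
  by apply/asboolP; exact: edges_is_cut.
by apply/eqP; rewrite eqn_leq gD andbT -capC leD //; exact/asboolP.
Qed.

End Capacity.

Section SourceEdges.
Variables (R : realType) (N : prenetwork) (delta : nat).
Implicit Types (sigma : profile N delta) (p q : player delta).

Lemma is_profile_deviate sigma p r :
  is_profile sigma -> is_route r -> is_profile (deviate sigma p r).
Proof. by move=> ps rr q; rewrite /deviate; case: eqP. Qed.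

Lemma source_edge_first sigma q j e : is_profile sigma -> only_outgoing (source N) ->
  onth (sigma q) j = Some e -> tail e = source N -> j = 0.
Proof.
move=> ps out; case: j => // j je te.
have [f jf] : exists f, onth (sigma q) j = Some f.
  by apply: lt_onth; have := onth_lt je; lia.
have := out f (walk_edges (ps q) jf).
by rewrite -(walk_next (ps q) jf je) te eqxx.
Qed.

(** An edge out of the source can only come first on a route, so those who enter it at one stage
    belong to a single generation of delta players. *)
Lemma no_queue_source sigma e : is_profile sigma -> only_outgoing (source N) ->
  tail e = source N -> delta <= capacity e ->
  forall p k u, onth (sigma p) k = Some e -> enters sigma p k u ->
  enters sigma p k.+1 (u + transit e).
Proof.
move=> ps out te cap; apply: no_queue => x L uL sL.
apply: leq_trans cap.
have sub : {subset L <= [seq ((x.-1, i), 0) | i <- enum 'I_delta]}.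
  move=> [[g i] j] /sL[/= je jx].
  have j0 := source_edge_first ps out je te.
  rewrite j0 enters0 in jx *; apply/mapP; exists i; first by rewrite mem_enum.
  by rewrite (eqP jx).
by have := uniq_leq_size uL sub; rewrite size_map size_enum_ord.
Qed.

Lemma latency_ge_dist sigma p (dist : vertex N -> nat) : dist (source N) = 0 ->
  (forall e, e \in edges N -> dist (head e) <= dist (tail e) + transit e) ->
  is_route (sigma p) -> ((dist (dest N))%:R%:E <= latency R sigma p)%E.
Proof.
move=> d0 de rp.
suff le : dist (dest N) <= \sum_(e <- sigma p) transit e.
  apply: (@le_trans _ _ (transit_cost R sigma p)).
    by rewrite /transit_cost sumEFin -natr_sum lee_fin ler_nat.
  rewrite leeDl //; apply: nneseries_ge0 => n _ _; by rewrite lee_fin ler0n.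
have walk_le u r v : walk u r v -> dist v <= dist u + \sum_(e <- r) transit e.
  elim: r u => [|e r IH] u /=; first by move=> /eqP ->; rewrite big_nil addn0.
  by move=> /and3P[/de + /eqP <- /IH]; rewrite big_cons; lia.
by have := walk_le _ _ _ rp; rewrite d0.
Qed.

(** The first g0 generations form the bounded defect, at most [delta * c * g0] in total. *)
Lemma avg_einf_ge_latency sigma (c g0 : nat) :
  (forall p, g0 <= p.1 -> (c%:R%:E <= latency R sigma p)%E) ->
  ((delta * c)%N%:R%:E <= limn_einf (avg_latency R sigma))%E.
Proof.
move=> ge; apply: (@avg_einf_ge _ _ _ _ _ (delta * c * g0)) => T.
apply: (@le_trans _ _ (\sum_(0 <= g < T) (delta * c * (g0 <= g))%N%:R%:E
    + (delta * c * g0)%N%:R%:E)%E).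
  rewrite sumEFin -natr_sum -big_distrr /= sum_leq_nat // -EFinD -natrD lee_fin ler_nat.
  by rewrite -mulnDr leq_mul2l; apply/orP; right; lia.
rewrite leeD2r //; apply: lee_sum => g _; have [gg|_] := leqP g0 g; last first.
  by rewrite muln0 gen_latency_ge0.
rewrite muln1; apply: (@le_trans _ _ (\sum_(i < delta) c%:R%:E)%E).
  by rewrite sumEFin sumr_const card_ord lee_fin natrM mulr_natl.
by apply: lee_sum => i _; apply: ge.
Qed.

End SourceEdges.

(** * The network for n = 2 *)

Section TwoVertices.
Variable R : realType.

(* The second edge has capacity 0, so that removing it changes nothing. *)
Definition two_edges_on (E : {set bool}) : prenetwork :=
  @Prenetwork bool bool E (fun=> false) (fun=> true) false true (fun=> 1) (fun e => ~~ e).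

Definition two_edges := two_edges_on [set: bool].

Lemma two_edges_straight : is_route (N := two_edges) [:: false].
Proof. by rewrite /is_route /= finset.inE. Qed.

Lemma two_edges_network : is_network two_edges.
Proof.
split=> //.
- move=> [|]; split=> //; first by move/(_ false); rewrite finset.inE eqxx => /(_ isT).
- by move=> [|]; split=> //; move/(_ false); rewrite finset.inE eqxx => /(_ isT).
- by case.
Qed.

Lemma two_edges_capacity : net_capacity two_edges = 1.
Proof.
apply: (@net_capacityE _ (edges two_edges)) => //; first exact: edges_is_cut.
  rewrite /cut_capacity (eq_bigl xpredT) => [|e]; first by rewrite big_bool.
  by rewrite finset.inE.
move=> C [_ /(_ _ two_edges_straight)] /=; rewrite orbF => fC.
by rewrite /cut_capacity (bigD1 _ fC) /=; lia.
Qed.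

Let straight : profile two_edges 1 := fun=> [:: false].

(** [BR] is a supremum over nonempty removals that leave a route; with one edge only it would be
    -oo. The edge [true], on which a player would wait forever, is there to be removed. *)
Lemma two_edges_efficiency : let N := two_edges in
  [/\ PoA R N 1 = 1%:R%:E, BR R N 1 = 1%:R%:E & PoS R N 1 = 1%E].
Proof.
have prof : is_profile straight by move=> p; exact: two_edges_straight.
have straight_load g (e : edge two_edges) L : uniq L ->
    (forall qj, qj \in L -> qj.1.1 = g /\ onth (straight qj.1) qj.2 = Some e) ->
    size L <= capacity e.
  move=> uL sL; case: e sL => sL.
    case: L uL sL => // -[q [|[|j]]] L _ sL; have [_] := sL _ (mem_head _ _); by [].
  apply: (@uniq_leq_size _ L [:: ((g, ord0), 0)] uL) => -[[g' i] [|[|j]]] /sL[/= -> //] _.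
  by rewrite (ord1 i) mem_head.
have straight_edge q k e : onth (straight q) k = Some e -> e = false.
  by case: k => [|[|k]] //= [].
have straight_UFR : straight \in @UFR R two_edges 1.
  by apply: (@free_flow_UFR _ _ _ _ (fun v : vertex two_edges => v : nat)).
have straight_latency p : latency R straight p = 1%:R%:E.
  by apply: (@free_flow_latency R two_edges 1 straight (fun v => v : nat)).
have lower1 (sigma : profile two_edges 1) : is_profile sigma ->
    (1%:R%:E <= limn_einf (avg_latency R sigma))%E.
  move=> ps; apply: (@avg_einf_ge_latency R two_edges 1 sigma 1 0) => p _.
  by have := @latency_ge_dist R two_edges 1 sigma p (fun v => v : nat) erefl
    (fun e _ => leqnn 1) (ps p).
have upper1 (E : {set bool}) (sigma : profile (two_edges_on E) 1) : false \in E ->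
    sigma \in @UFR R (two_edges_on E) 1 -> (limn_esup (avg_latency R sigma) <= 1%:R%:E)%E.
  move=> fE; rewrite inE => -[[ps nash] _].
  apply: (@avg_esup_le R (two_edges_on E) 1 sigma 1) => p.
  have rE : is_route (N := two_edges_on E) [:: false] by rewrite /is_route /= fE.
  apply: le_trans (nash p [:: false] rE) _.
  have pd := is_profile_deviate p ps rE.
  have e0 : enters (deviate sigma p [:: false]) p 0 (depart p) by rewrite enters0.
  have := no_queue_source pd _ _ _ _ e0; rewrite deviate_eq => /(_ false) e1.
  have fin : enters (deviate sigma p [:: false]) p 1 (depart p + 1) by exact: e1.
  have := @latency_finish R _ _ (deviate sigma p [:: false]) p (depart p + 1).
  by rewrite deviate_eq addKn => ->.
have T0 : true \in finset.set1 true by rewrite finset.inE.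
have fT : false \in finset.setD (edges two_edges) (finset.set1 true).
  by rewrite !finset.inE.
have straight_le : (limn_esup (avg_latency R straight) <= 1%:R%:E)%E.
  by apply: upper1; rewrite ?finset.inE.
apply: (@efficiency R two_edges 1 1 1 (finset.set1 true) straight straight).
- exact: isT.
- exact: ord0.
- exact: lower1.
- exact: straight_UFR.
- exact: straight_le.
- by move=> sigma su; rewrite muln1; apply: upper1 su; rewrite finset.inE.
- exact: straight_UFR.
- by rewrite muln1; apply: lower1.
- exact: finset.subsetT.
- by apply/eqP => /setP/(_ true); rewrite T0 finset.inE.
- exists straight; apply: UFR_remove; first exact: straight_UFR.
  by move=> p; rewrite /is_route /= fT.
- by move=> sigma; apply: upper1.
Qed.

End TwoVertices.

(** * Bounds on the queues inside a network *)

Section InnerEdges.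
Variables (N : prenetwork) (delta : nat).
Implicit Types (sigma : profile N delta) (p q : player delta).

(** Whoever enters e at stage x leaves an edge into its tail at x, and these edges release at most
    their total capacity per stage. *)
Lemma no_queue_inner sigma e : is_profile sigma -> tail e != source N ->
  \sum_(f in edges N | head f == tail e) capacity f <= capacity e ->
  forall p k u, onth (sigma p) k = Some e -> enters sigma p k u ->
  enters sigma p k.+1 (u + transit e).
Proof.
move=> ps ts cap; apply: no_queue => x L uL sL; apply: leq_trans cap.
pose prev (qj : player delta * nat) f := onth (sigma qj.1) qj.2.-1 == Some f.
have prevP qj : qj \in L -> 0 < qj.2 /\
    exists2 f, (f \in edges N) && (head f == tail e) & prev qj f.
  case: qj => q j qL; have [/= je jx] := sL _ qL; case: j je jx {qL} => [|j] je jx.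
    by rewrite (walk_tail (ps q) je) eqxx in ts.
  split=> //; have [f jf] : exists f, onth (sigma q) j = Some f.
    by apply: lt_onth; have := onth_lt je; lia.
  exists f; last by rewrite /prev /= jf.
  by rewrite (walk_edges (ps q) jf) (walk_next (ps q) jf je) eqxx.
have -> : size L = \sum_(qj <- L) \sum_(f in edges N | head f == tail e) prev qj f.
  rewrite -sum1_size; apply: eq_big_seq => qj /prevP[_ [f fP pf]].
  rewrite (bigD1 f) //= pf big1 ?addn0 // => f' /andP[_ f'f].
  move: pf; rewrite /prev => /eqP ->; rewrite eq_sym.
  by case: eqP => // -[E]; rewrite E eqxx in f'f.
rewrite exchange_big /=; apply: leq_sum => f _.
rewrite -[X in X <= _](_ : size [seq (qj.1, qj.2.-1) | qj <- L & prev qj f] = _).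
  apply: (@exits_per_stage _ _ sigma f x).
    rewrite map_inj_in_uniq ?filter_uniq // => -[q j] [q' j'].
    rewrite !mem_filter => /andP[_ /prevP[/= j0 _]] /andP[_ /prevP[/= j0' _]] [-> jj'].
    by congr (_, _); lia.
  move=> _ /mapP[[q j] + ->] /=; rewrite mem_filter => /andP[/eqP pf qL].
  by have [_ jx] := sL _ qL; have [/= j0 _] := prevP _ qL; rewrite pf prednK.
by rewrite size_map size_filter -sum1_count big_mkcond; apply: eq_bigr => qj _; case: (prev qj f).
Qed.

Lemma walk_mkseq (f : nat -> edge N) (w : nat -> vertex N) n :
  (forall i, i < n -> [/\ f i \in edges N, tail (f i) = w i & head (f i) = w i.+1]) ->
  walk (w 0) (mkseq f n) (w n).
Proof.
elim: n f w => [|n IH] f w fw; first exact: eqxx.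
rewrite /mkseq /=; have [-> -> ->] := fw 0 isT; rewrite eqxx /=.
rewrite -[1]addn0 iotaDl -map_comp; apply: (IH (f \o S) (w \o S)) => i i_n.
exact: (fw i.+1).
Qed.

End InnerEdges.

Lemma onth_mkseq (T : Type) (f : nat -> T) n k x :
  onth (mkseq f n) k = Some x <-> k < n /\ x = f k.
Proof.
split=> [kx|[kn ->]].
  have kn := onth_lt kx; rewrite size_mkseq in kn; split=> //.
  by move: kx; rewrite onthE (nth_map x) ?size_mkseq // nth_mkseq // => -[].
by rewrite onthE (nth_map (f k)) ?size_mkseq // nth_mkseq.
Qed.

Section QueueLength.
Variables (N : prenetwork) (delta : nat) (sigma : profile N delta).
Implicit Types (p q z : player delta).

Lemma left_by q k s : (k.+1 < size (hist sigma s q)) <->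
  exists2 x, enters sigma q k.+1 x & x <= s.
Proof.
split=> [ks|[x kx xs]]; last by have [] := enters_hist kx xs.
have [ds|sd] := leqP (depart q) s; last by rewrite hist_early in ks.
by have [en le] := hist_enters ds ks; exists (nth 0 (hist sigma s q) k.+1).
Qed.

(** By induction on m: anybody ahead of p has strictly fewer players ahead of herself, as those also
    precede p, and is therefore out one stage before p needs it. *)
Lemma queue_release p k u e x m : enters sigma p k u -> onth (sigma p) k = Some e ->
  0 < capacity e -> u + transit e <= x ->
  (forall L, uniq L -> (forall qj, qj \in L -> queued_ahead sigma x p k u qj) -> size L <= m) ->
  exists2 y, enters sigma p k.+1 y & y <= x + m.
Proof.
move=> + + cap; elim: m p k u => [|m IH] p k u ku ke ux few.
  rewrite addn0; apply/left_by/(enters_release ku ke ux) => L uL sL.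
  by apply: leq_ltn_trans (few L uL sL) cap.
apply/left_by/(enters_release ku ke); first by lia.
case=> [_ _|[z j] L _ /(_ _ (mem_head _ _))[/= [v jv prec] je out]]; [exact: cap | exfalso].
have vu : v <= u by move: prec; rewrite /precedes; lia.
have zp : (z, j) != (p, k).
  apply/eqP => -[zE jE]; rewrite zE jE in jv prec.
  by rewrite (enters_uniq jv ku) precedes_irr in prec.
have self : queued_ahead sigma x p k u (z, j).
  split=> //=; first by exists v.
  apply: contra out => /left_by[y jy yx]; apply/left_by; exists y => //; lia.
have [||y jy yx] := IH z j v jv (etrans je ke); first lia.
  move=> L' uL' sL'; rewrite -ltnS; apply: (few ((z, j) :: L')).
    by rewrite /= uL' andbT; apply/negP => /sL'[[w /= jw]];
      rewrite (enters_uniq jw jv) precedes_irr.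
  move=> qj; rewrite inE => /orP[/eqP-> //|/sL'[[w qw pr] qe qout]].
  split; [exists w => // | by rewrite qe | exact: qout].
  exact: precedes_trans pr prec.
by move/negP: out; apply; apply/left_by; exists y => //; lia.
Qed.

(** Nobody else enters any edge before stage [depart p], and ties at that stage go to the higher
    priority. *)
Lemma agree_before (rho : profile N delta) p : (forall z, prio z p -> sigma z = rho z) ->
  forall z k y, prio z p -> y <= depart p -> enters sigma z k y <-> enters rho z k y.
Proof.
move=> same z k y zp yp.
have late (tau : profile N delta) : not_overtaken (fun z => prio z p) (depart p) tau.
  move=> q l u z' j v _ z'p _ uT /enters_depart vd _; apply: (leq_trans uT).
  by apply: leq_trans vd; move: z'p; rewrite /prio /depart; lia.
apply: (agree _ (late sigma) (late rho) same _ zp yp) => q z' qp z'p.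
have [->//|z'p'] := eqVneq z' p; apply: prio_trans qp _.
by have := prio_total z'p'; rewrite (negPf z'p).
Qed.

End QueueLength.

(** * The queue on an edge of capacity 1 out of the source *)

Section FirstEdges.
Variables (N : prenetwork) (delta : nat) (sigma : profile N delta) (e : edge N).
Implicit Types (p q z : player delta).

Hypothesis sigma_profile : is_profile sigma.
Hypothesis source_out : only_outgoing (source N).
Hypothesis tail_e : tail e = source N.
Hypothesis cap_e : capacity e = 1.

Definition waiting_at s z : bool :=
  (onth (sigma z) 0 == Some e) && (size (hist sigma s z) <= 1).

Definition waiting T s : seq (player delta) :=
  [seq z <- players_upto delta T | waiting_at s z].

Lemma mem_waiting T s z : (z \in waiting T s) = (depart z <= T) && waiting_at s z.
Proof. by rewrite mem_filter mem_players_upto andbC. Qed.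

Lemma uniq_waiting T s : uniq (waiting T s).
Proof. exact/filter_uniq/uniq_players_upto. Qed.

(** On such an edge the entry stage is the departure, so the order of the queue is [prio]. *)
Lemma queued_first x p qj : onth (sigma p) 0 = Some e ->
  queued_ahead sigma x p 0 (depart p) qj <->
  [/\ qj.2 = 0, prio qj.1 p & waiting_at x.-1 qj.1].
Proof.
case: qj => z j pe; split=> [[/= [v jv prec] je out]|[/= -> zp /andP[/eqP ze out]]].
  have j0 : j = 0 by apply: (source_edge_first sigma_profile source_out (etrans je pe)).
  rewrite j0 in je jv prec out *; split=> //.
    move: prec; rewrite enters0 in jv; rewrite (eqP jv) /precedes ltnn andbF orbF.
    by rewrite /prio /depart; lia.
  by rewrite /waiting_at (etrans je pe) eqxx /= leqNgt.
split=> /=; [exists (depart z); first by rewrite enters0 | exact: etrans ze (esym pe) | by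
  rewrite -leqNgt].
by rewrite /precedes zp; move: zp; rewrite /prio /depart; lia.
Qed.

(** Stage [p.1 + transit e] is the last one before p reaches the head of e; each player ahead of her
    who is still there at its end costs her one stage. *)
Lemma first_exit_le p m : onth (sigma p) 0 = Some e ->
  (forall L, uniq L -> (forall z, z \in L -> prio z p && waiting_at (p.1 + transit e) z) ->
     size L <= m) ->
  exists2 x, enters sigma p 1 x & x <= depart p + transit e + m.
Proof.
move=> pe few; have p0 : enters sigma p 0 (depart p) by rewrite enters0.
apply: (queue_release p0 pe) => //; first by rewrite cap_e.
move=> L uL sL; have fst_inj : {in L &, injective (@fst (player delta) nat)}.
  by move=> [z j] [z' j'] /sL/(queued_first _ _ pe)[/= -> _ _] /sL/(queued_first _ _ pe)[/= -> _
    _] ->.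
rewrite -(size_map fst); apply: few; first by rewrite map_inj_in_uniq.
by move=> _ /mapP[qj /sL/(queued_first _ _ pe)[_ zp w] ->]; rewrite zp.
Qed.

(** With capacity 1 the players of L must leave one per stage, from [depart p + transit e] on and
    before p does. *)
Lemma first_exit_ge p x L : onth (sigma p) 0 = Some e -> enters sigma p 1 x -> uniq L ->
  (forall z, z \in L -> prio z p && waiting_at (p.1 + transit e) z) ->
  depart p + transit e + size L <= x.
Proof.
move=> pe p1 uL sL; have p0 : enters sigma p 0 (depart p) by rewrite enters0.
have px := enters_transit p1 p0 pe.
suff : size [seq (z, 0) | z <- L] <= capacity e * (x - (depart p + transit e)).
  by rewrite size_map cap_e mul1n leq_subRL.
apply: (@exits_between _ _ sigma e (depart p + transit e)).
  by rewrite map_inj_uniq // => z z' [].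
move=> _ /mapP[z /sL/andP[zp w] ->] /=; have /andP[/eqP ze nout] := w; split=> //.
have : 1 < size (hist sigma x.-1 z).
  rewrite ltnNge; apply/negP => nx.
  have : size [:: (z, 0)] < capacity e; last by rewrite cap_e.
  apply: (enters_blocked p1 p0 pe) => // qj; rewrite inE => /eqP ->.
  by apply/(queued_first _ _ pe); split=> //=; rewrite /waiting_at ze eqxx.
move=> /left_by[y z1 yx]; exists y => //; rewrite subnKC //.
have : p.1 + transit e < y.
  by rewrite ltnNge; apply/negP => yp; rewrite leqNgt in nout; move/negP: nout; apply;
    apply/left_by; exists y.
have := enters_depart z1; rewrite /depart; lia.
Qed.

(** By stage s all of the first T generations have reached the head of e, so the first player still
    there is released. *)
Lemma waiting_step T : 0 < T ->
  size (waiting T (T + transit e)) <= (size (waiting T (T + transit e).-1)).-1.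
Proof.
move=> T0; set s := T + transit e.
have sub : {subset waiting T s <= waiting T s.-1}.
  move=> z; rewrite !mem_waiting /waiting_at => /and3P[-> -> out] /=.
  rewrite leqNgt; apply/negP => /left_by[y z1 ys].
  by move: out; rewrite leqNgt => /negP; apply; apply/left_by; exists y => //; lia.
have [W0|p0] : waiting T s.-1 = [::] \/ exists p, p \in waiting T s.-1 /\
    forall z, z \in waiting T s.-1 -> z != p -> prio p z.
  have := pairwise_filter (waiting_at s.-1) (pairwise_players_upto delta T).
  rewrite -/(waiting T s.-1); case: (waiting T s.-1) => [|p W] /=; first by left.
  move=> /andP[/allP pW _]; right; exists p; split=> [|z]; first exact: mem_head.
  by rewrite inE => /orP[/eqP->|/pW//]; rewrite eqxx.
- by have := uniq_leq_size (uniq_waiting T s) sub; rewrite W0.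
have [p [pW first]] := p0; have := pW; rewrite mem_waiting => /and3P[pT /eqP pe _].
have [y p1 ys] : exists2 y, enters sigma p 1 y & y <= s + 0.
  apply: (@queue_release _ _ sigma p 0 (depart p) e) => //.
  - by rewrite enters0.
  - by rewrite cap_e.
  - by rewrite /s leq_add2r.
  move=> [//|qj L] _ /(_ _ (mem_head _ _))/(queued_first _ _ pe)[_ qp wq].
  have : prio p qj.1.
    apply: first; last by apply: contraTneq qp => ->; rewrite prio_irr.
    by rewrite mem_waiting wq andbT; apply: leq_trans pT; rewrite /depart ltnS;
      case/orP: qp => [/ltnW//|/andP[/eqP-> _]].
  by move/(prio_asym qp).
rewrite -(size_rem pW); apply: uniq_leq_size; first exact: uniq_waiting.
move=> z zW; rewrite mem_rem_uniq ?uniq_waiting // inE sub // andbT.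
apply: contraTneq zW => ->; rewrite mem_waiting; apply/negP => /and3P[_ _];
  rewrite leqNgt => /negP; apply.
by apply/left_by; exists y => //; rewrite -[s]addn0.
Qed.

Lemma not_out_before z : onth (sigma z) 0 = Some e -> waiting_at (z.1 + transit e) z.
Proof.
move=> ze; rewrite /waiting_at ze eqxx leqNgt; apply/negP => /left_by[y z1 yz].
have z0 : enters sigma z 0 (depart z) by rewrite enters0.
by have := enters_transit z1 z0 ze; rewrite /depart; lia.
Qed.

End FirstEdges.

(** * The chain *)

Section ChainTimes.
Variable J : nat.
Hypothesis J_ge2 : 1 < J.
Implicit Types (g j k m : nat) (b : bool).

(* The link which generation g traverses twice; J.+2 stands for none. *)
Definition doubled g : nat :=
  if g <= J then g else if g == J.+1 then J.-1 else if g == J.+2 then J else J.+2.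

Definition chain_length k : nat := if k <= J then J.+4 else J.+2.

Definition chain_edge k m : nat :=
  if m <= k then m else if m == k.+1 then J.+1 + k else m - 2.

Definition chain_vertex k m : nat := if m <= k.+1 then m else m - 2.

(* The stage at which player b of generation g first reaches vertex j. *)
Definition chain_arrival g b j : nat :=
  if g < minn j J.+1 then g + g + b
  else if (g <= J.+1) || (j < J) then g + minn j J.+1
  else if (g == J.+2) && (J < j) then g + J.+1 + b else (g + minn j J.+1).+1.

(* The stage at which she enters her m-th edge. *)
Definition chain_time g b m : nat :=
  if m == (doubled g).+2 then chain_arrival g b (doubled g).+1
  else chain_arrival g b (chain_vertex (doubled g) m) + ((g == J.+1) && (m == J.+2)).

Lemma doubledP g : 0 < g -> [\/ [/\ g <= J, doubled g = g & chain_length (doubled g) = J.+4],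
  [/\ g = J.+1, doubled g = J.-1 & chain_length (doubled g) = J.+4],
  [/\ g = J.+2, doubled g = J & chain_length (doubled g) = J.+4] |
  [/\ J.+3 <= g, doubled g = J.+2 & chain_length (doubled g) = J.+2]].
Proof.
move=> _; rewrite /chain_length /doubled; case: (leqP g J) => [h0|h1].
  by apply: Or41; rewrite h0.
case: (eqVneq g J.+1) => [e|h2]; first by apply: Or42; rewrite leq_pred.
case: (eqVneq g J.+2) => [e|h3]; first by apply: Or43; rewrite leqnn.
by apply: Or44; split=> //; [lia | case: leqP => //; lia].
Qed.

Lemma chain_edgeP k m : [\/ [/\ m <= k, chain_edge k m = m & chain_vertex k m = m],
  [/\ m = k.+1, chain_edge k m = J.+1 + k & chain_vertex k m = k.+1] |
  [/\ k.+2 <= m, chain_edge k m = m - 2 & chain_vertex k m = m - 2]].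
Proof.
rewrite /chain_edge /chain_vertex; case: (leqP m k) => h1.
  by apply: Or31; rewrite (leqW h1).
case: (eqVneq m k.+1) => [->|h2]; first by apply: Or32; rewrite leqnn.
by apply: Or33; split=> //; [lia | case: leqP => //; lia].
Qed.

Lemma arrivalP g b j : [\/ g < minn j J.+1 /\ chain_arrival g b j = g + g + b,
  [/\ minn j J.+1 <= g, (g <= J.+1) || (j < J) & chain_arrival g b j = g + minn j J.+1],
  [/\ g = J.+2, J < j & chain_arrival g b j = g + J.+1 + b] |
  [/\ J.+2 <= g, J <= j, (g != J.+2) || (j == J) &
      chain_arrival g b j = (g + minn j J.+1).+1]].
Proof.
rewrite /chain_arrival; case: (ltnP g (minn j J.+1)) => h1; first by apply: Or41.
case: ifPn => h2; first by apply: Or42.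
case: ifPn => [/andP[/eqP e1 e2]|h3]; first by apply: Or43.
by apply: Or44; split=> //; lia.
Qed.

Lemma arrival_mono g b j j' : j <= j' -> chain_arrival g b j <= chain_arrival g b j'.
Proof.
move=> jj; have b1 : b <= 1 by case: b.
by have [[]|[]|[]|[]] := arrivalP g b j; have [[]|[]|[]|[]] := arrivalP g b j'; lia.
Qed.

Lemma arrival_lt g b g' b' j : g < g' -> 0 < j ->
  chain_arrival g b j + ((g == J.+1) && (j == J)) < chain_arrival g' b' j.
Proof.
move=> gg' j0; have b1 : b <= 1 by case: b.
by have [[]|[]|[]|[]] := arrivalP g b j; have [[]|[]|[]|[]] := arrivalP g' b' j; lia.
Qed.

Lemma arrival0 g b : chain_arrival g b 0 = g.
Proof. by have [[]|[]|[]|[]] := arrivalP g b 0; lia. Qed.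

Lemma arrival1 g b : 0 < g -> chain_arrival g b 1 = g.+1.
Proof. by move=> g0; have [[]|[]|[]|[]] := arrivalP g b 1; lia. Qed.

(** The extra term is due to generation J.+1 alone: held up on its second crossing of link J.-1, it
    returns to vertex J one stage after its first arrival there. *)
Lemma time_vertex g b m : m != (doubled g).+2 ->
  chain_arrival g b (chain_vertex (doubled g) m) <= chain_time g b m <=
  chain_arrival g b (chain_vertex (doubled g) m)
    + ((g == J.+1) && (chain_vertex (doubled g) m == J)).
Proof.
rewrite /chain_time => /negPf ->; rewrite leq_addr leq_add2l /=.
rewrite /chain_vertex; case: (eqVneq g J.+1) => //= gE; case: (eqVneq m J.+2) => //= ->.
have g0 : 0 < g by lia.
have -> : doubled g = J.-1 by have [[]|[]|[]|[]] := doubledP g0; lia.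
have -> : (J.+2 <= J.-1.+1) = false by lia.
by lia.
Qed.

Lemma time_double g b : chain_time g b (doubled g).+2 = chain_arrival g b (doubled g).+1.
Proof. by rewrite /chain_time eqxx. Qed.

Lemma vertex_double k : chain_vertex k k.+2 = k.
Proof. by rewrite /chain_vertex ltnn subn2. Qed.

(** The critical case is the second entry into the doubled link: it takes place when vertex
    [(doubled g).+1] is first reached, which is not after the next generation reaches the tail of
    the link. *)
Lemma time_before g b g' b' m : 0 < g -> g < g' -> m < chain_length (doubled g) ->
  chain_time g b m <= chain_arrival g' b' (chain_vertex (doubled g) m).
Proof.
move=> g0 gg' ml; have b1 : b <= 1 by case: b.
have [->|mk] := eqVneq m (doubled g).+2; last first.
  have /andP[_] := time_vertex b mk; set v := chain_vertex _ _.
  have [->|v0] := posnP v; first by rewrite !arrival0; lia.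
  by have := arrival_lt b b' gg' v0; lia.
rewrite time_double vertex_double.
have [[gJ kE lE]|[gJ kE lE]|[gJ kE lE]|[gJ kE lE]] := doubledP g0; rewrite kE in lE *.
all: rewrite ?kE ?lE in ml *.
all: have [[]|[]|[]|[]] := arrivalP g b (doubled g).+1; rewrite kE.
all: have [[]|[]|[]|[]] := arrivalP g' b' (doubled g); rewrite kE.
all: lia.
Qed.

Lemma arrival_bool g j : chain_arrival g false j <= chain_arrival g true j.
Proof. by have [[]|[]|[]|[]] := arrivalP g false j; have [[]|[]|[]|[]] := arrivalP g true j;
  lia. Qed.

(** Generation J.+1 is excluded because its first mate enters link J.-1 again one stage after the
    second mate has come there, so she cannot serve in a barrier for her mate. *)
Lemma mate_before g m : 0 < g -> g != J.+1 -> m < chain_length (doubled g) ->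
  chain_time g false m <= chain_arrival g true (chain_vertex (doubled g) m).
Proof.
move=> g0 gJ ml; have [->|mk] := eqVneq m (doubled g).+2; last first.
  have /andP[_] := time_vertex false mk; rewrite (negPf gJ) addn0 => /leq_trans; apply.
  exact: arrival_bool.
rewrite time_double vertex_double.
have [[gJ' kE lE]|[gJ' kE lE]|[gJ' kE lE]|[gJ' kE lE]] := doubledP g0; rewrite kE.
all: have [[]|[]|[]|[]] := arrivalP g false (doubled g).+1; rewrite kE.
all: have [[]|[]|[]|[]] := arrivalP g true (doubled g); rewrite kE.
all: lia.
Qed.

Lemma doubled_gt0 g : 0 < g -> 0 < doubled g.
Proof. by move=> g0; have [[]|[]|[]|[]] := doubledP g0; lia. Qed.

Lemma vertex_next k m : 0 < k -> chain_edge k m <= J.+1 ->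
  m != k.+1 /\ chain_vertex k m.+1 = (chain_edge k m).+1.
Proof.
move=> k0; have [[h -> _]|[-> -> _]|[h -> _]] := chain_edgeP k m; last 2 first.
- by lia.
- by rewrite /chain_vertex; case: (leqP m.+1 k.+1); lia.
- by rewrite /chain_vertex; case: (leqP m.+1 k.+1); lia.
Qed.

Lemma arrival_step g b j : chain_arrival g b j + ((g == J.+1) && (j == J)) <= chain_arrival g b
  j.+1.
Proof.
have b1 : b <= 1 by case: b.
by have [[]|[]|[]|[]] := arrivalP g b j; have [[]|[]|[]|[]] := arrivalP g b j.+1; lia.
Qed.

Lemma time_transit g b m : 0 < g -> m < chain_length (doubled g) ->
  chain_time g b m + (m == 0) <= chain_time g b m.+1.
Proof.
move=> g0 ml; set k := doubled g; have k0 := doubled_gt0 g0.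
have [->|m0] := eqVneq m 0.
  have n2 : 0 != (doubled g).+2 by [].
  have n2' : 1 != (doubled g).+2 by [].
  have /andP[_] := time_vertex b n2; have /andP[+ _] := time_vertex b n2'.
  rewrite /chain_vertex /= arrival0 arrival1 //.
  have -> : (0 == J) = false by lia.
  by rewrite andbF addn0 => lo hi; rewrite addn1; apply: leq_ltn_trans hi lo.
rewrite addn0; have [mk|mk] := eqVneq m (doubled g).+2.
  have n3 : m.+1 != (doubled g).+2 by lia.
  have /andP[+ _] := time_vertex b n3; rewrite mk time_double.
  by rewrite /chain_vertex; have -> : ((doubled g).+3 <= (doubled g).+1) = false by lia.
have [mk1|mk1] := eqVneq m.+1 (doubled g).+2.
  have -> : m = (doubled g).+1 by lia.
  rewrite time_double /chain_time /chain_vertex leqnn ltn_eqF //.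
  have [gE|_] := eqVneq g J.+1; last by rewrite addn0.
  have kE : doubled g = J.-1 by have [[]|[]|[]|[]] := doubledP g0; lia.
  have -> : ((doubled g).+1 == J.+2) = false by lia.
  by rewrite addn0.
have /andP[_ hi] := time_vertex b mk; apply: (leq_trans hi).
have /andP[lo' _] := time_vertex b mk1; apply: leq_trans lo'.
apply: (leq_trans (arrival_step g b _)); apply: arrival_mono.
by rewrite /chain_vertex; case: (leqP m (doubled g).+1); case: (leqP m.+1 (doubled g).+1); lia.
Qed.

End ChainTimes.

(** * Capacities and blockers in the timetable of the chain *)

Section ChainQueues.
Variable J : nat.
Hypothesis J_ge2 : 1 < J.
Implicit Types (g j k m : nat) (b : bool).
Local Notation doubled := (doubled J).
Local Notation chain_length := (chain_length J).
Local Notation chain_edge := (chain_edge J).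
Local Notation arrival := (chain_arrival J).
Local Notation time := (chain_time J).

Lemma time0 g b : time g b 0 = g.
Proof. by rewrite /chain_time /= arrival0 //; lia. Qed.

Lemma time_ge_arrival g b m : arrival g b (chain_vertex (doubled g) m) <= time g b m.
Proof.
have [->|mk] := eqVneq m (doubled g).+2; last by case/andP: (time_vertex J_ge2 b mk).
by rewrite time_double vertex_double; apply: arrival_mono.
Qed.

Lemma time_mate g m : time g false m <= time g true m.
Proof.
by rewrite /chain_time; case: ifP => _; rewrite ?leq_add2r; apply: arrival_bool.
Qed.

Lemma vertex_gt0 g m : 0 < g -> 0 < chain_vertex (doubled g) m.+1.
Proof.
move=> g0; have := doubled_gt0 J_ge2 g0.
by have [[_ _ ->]|[_ _ ->]|[? _ ->]] := chain_edgeP J_ge2 (doubled g) m.+1; lia.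
Qed.

Lemma edge_inj k m m' : 0 < k -> k <= J.+2 -> m < chain_length k -> m' < chain_length k ->
  chain_edge k m = chain_edge k m' -> [\/ m = m', m = k /\ m' = k.+2 | m = k.+2 /\ m' = k].
Proof.
move=> k0 kJ ml ml' e; suff : (m == m') || ((m == k) && (m' == k.+2)) || ((m == k.+2) && (m' ==
  k)).
  case/orP=> [/orP[/eqP->|/andP[/eqP-> /eqP->]]|/andP[/eqP-> /eqP->]].
  - exact: Or31.
  - exact: Or32.
  - exact: Or33.
move: ml ml' e; rewrite /chain_length.
by have [[? -> _]|[? -> _]|[? -> _]] := chain_edgeP J_ge2 k m;
  have [[? -> _]|[? -> _]|[? -> _]] := chain_edgeP J_ge2 k m'; case: (leqP k J); lia.
Qed.

Lemma edge_back k k' m m' : 0 < k -> 0 < k' -> m < chain_length k -> m' < chain_length k' ->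
  chain_edge k m = chain_edge k' m' -> (m == k.+1) = (m' == k'.+1) /\
  (m = k.+1 -> k = k').
Proof.
move=> k0 k0'; rewrite /chain_length.
have [[? -> _]|[? -> _]|[? -> _]] := chain_edgeP J_ge2 k m;
  have [[? -> _]|[? -> _]|[? -> _]] := chain_edgeP J_ge2 k' m'; case: (leqP k J);
    case: (leqP k' J); lia.
Qed.

(** Hence nobody of an earlier generation counts against the capacity at the stage when a later
    player is due to exit. *)
Lemma exit_lt g b g' b' m m' : 0 < g -> g < g' -> m < chain_length (doubled g) ->
  m' < chain_length (doubled g') ->
  chain_edge (doubled g) m = chain_edge (doubled g') m' ->
  chain_vertex (doubled g) m.+1 = chain_vertex (doubled g') m'.+1 ->
  time g b m.+1 < time g' b' m'.+1.
Proof.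
move=> g0 gg' ml ml' ee vv; have g0' : 0 < g' by lia.
have [eb kk] := edge_back (doubled_gt0 J_ge2 g0) (doubled_gt0 J_ge2 g0') ml ml' ee.
have [mk|mk] := eqVneq m.+1 (doubled g).+2.
  have mk' : m = (doubled g).+1 by lia.
  have := eb; rewrite mk' eqxx => /esym/eqP ->; rewrite !time_double (kk mk').
  by have := arrival_lt J_ge2 b b' gg' (ltn0Sn (doubled g')); lia.
have /andP[_ hi] := time_vertex J_ge2 b mk; apply: (leq_ltn_trans hi).
apply: leq_trans (time_ge_arrival _ _ _).
by rewrite -vv; apply: arrival_lt => //; apply: vertex_gt0.
Qed.

(* The four stages around the doubled link, which the two mates leave one after
   the other, except those of generation J + 1, who share both visits. *)
Lemma double_times g : 0 < g -> doubled g <= J -> let k := doubled g in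
  (forall b, [/\ time g b k = arrival g b k, time g b k.+1 = arrival g b k.+1,
     time g b k.+2 = arrival g b k.+1 &
     time g b k.+3 = arrival g b k.+1 + (g == J.+1)]) /\
  [/\ arrival g true k <= arrival g false k.+1,
      arrival g true k = arrival g false k,
      arrival g true k < arrival g true k.+1 &
      arrival g true k.+1 = arrival g false k.+1 + (g != J.+1)] /\
  ((g == J.+1) -> arrival g true k < arrival g false k.+1) /\
  ((g != J.+1) -> arrival g true k = arrival g false k.+1).
Proof.
move=> g0 kJ k; split=> [b|].
  rewrite /chain_time /chain_vertex /k !eqxx.
  have -> : (doubled g == (doubled g).+2) = false by lia.
  have -> : ((doubled g).+1 == (doubled g).+2) = false by lia.
  have -> : ((doubled g).+3 == (doubled g).+2) = false by lia.
  rewrite leqW // leqnn; have -> : ((doubled g).+3 <= (doubled g).+1) = false by lia.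
  have -> : (doubled g == J.+2) = false by lia.
  have -> : ((doubled g).+3 - 2) = (doubled g).+1 by lia.
  have -> : ((doubled g).+1 == J.+2) = false by lia.
  rewrite !andbF !addn0; split=> //; congr (_ + _).
  by have [[]|[]|[]|[]] := doubledP J_ge2 g0; lia.
rewrite /k; have [[gJ -> _]|[gJ -> _]|[gJ -> _]|[gJ kE _]] := doubledP J_ge2 g0.
- have -> : (g == J.+1) = false by lia.
  have [[? ->]|[? ? ->]|[? ? ->]|[? ? ? ->]] := arrivalP J_ge2 g true g; try lia.
  have [[? ->]|[? ? ->]|[? ? ->]|[? ? ? ->]] := arrivalP J_ge2 g false g; try lia.
  have [[? ->]|[? ? ->]|[? ? ->]|[? ? ? ->]] := arrivalP J_ge2 g true g.+1; try lia.
  have [[? ->]|[? ? ->]|[? ? ->]|[? ? ? ->]] := arrivalP J_ge2 g false g.+1; do ?[split]; lia.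
- rewrite gJ eqxx prednK; last lia.
  have [[? ->]|[? ? ->]|[? ? ->]|[? ? ? ->]] := arrivalP J_ge2 J.+1 true J.-1; try lia.
  have [[? ->]|[? ? ->]|[? ? ->]|[? ? ? ->]] := arrivalP J_ge2 J.+1 false J.-1; try lia.
  have [[? ->]|[? ? ->]|[? ? ->]|[? ? ? ->]] := arrivalP J_ge2 J.+1 true J; try lia.
  have [[? ->]|[? ? ->]|[? ? ->]|[? ? ? ->]] := arrivalP J_ge2 J.+1 false J; do ?[split]; lia.
- have -> : (g == J.+1) = false by lia.
  have [[? ->]|[? ? ->]|[? ? ->]|[? ? ? ->]] := arrivalP J_ge2 g true J; try lia.
  have [[? ->]|[? ? ->]|[? ? ->]|[? ? ? ->]] := arrivalP J_ge2 g false J; try lia.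
  have [[? ->]|[? ? ->]|[? ? ->]|[? ? ? ->]] := arrivalP J_ge2 g true J.+1; try lia.
  have [[? ->]|[? ? ->]|[? ? ->]|[? ? ? ->]] := arrivalP J_ge2 g false J.+1; do ?[split]; lia.
- by rewrite kE in kJ; lia.
Qed.


Lemma doubled_le g : doubled g <= J.+2.
Proof. by rewrite /doubled; do ?case: ifP; lia. Qed.

Lemma length_doubled_le g m : 0 < g -> (doubled g).+2 <= m -> m < chain_length (doubled g) ->
  doubled g <= J.
Proof. by move=> g0; have [[]|[]|[]|[]] := doubledP J_ge2 g0; lia. Qed.

(** At most one passage of the own generation is still ahead, which capacity 2 allows: the player's
    own first crossing if she crosses her doubled link again, and otherwise, or in generation J.+1,
    the same passage of the first mate. *)
Lemma same_generation_ahead g b m b' m' : 0 < g ->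
  m < chain_length (doubled g) -> m' < chain_length (doubled g) ->
  chain_edge (doubled g) m' = chain_edge (doubled g) m ->
  (time g b' m' < time g b m) || ((time g b' m' == time g b m) &&
    ((b' < b) || ((b' == b) && (m' < m)))) ->
  time g b m.+1 <= time g b' m'.+1 ->
  (b', m') = if (m == (doubled g).+2) && (g != J.+1) then (b, doubled g) else (false, m).
Proof.
move=> g0 ml ml' ee prec out.
have [mm|[mk mk']|[mk mk']] := edge_inj (doubled_gt0 J_ge2 g0) (doubled_le g) ml' ml ee.
- rewrite mm in prec *; have := time_mate g m.
  case: eqP => [mE|_] /=; last by case: b b' prec out => -[] //=; lia.
  have kJ : doubled g <= J by apply: length_doubled_le ml => //; rewrite mE.
  have [tk [[a1 a2 a3 a4] [a5 a6]]] := double_times g0 kJ.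
  have [_ _ t2 t3] := tk b; have [_ _ t2' t3'] := tk b'.
  move: prec out; rewrite mm mE t2 t3 t2' t3'.
  by case: (eqVneq g J.+1) a4 a5 a6 => gE /=; case: b b' {t2 t3 t2' t3'} => -[] //=; lia.
- have kJ : doubled g <= J by apply: length_doubled_le ml => //; rewrite mk'.
  have [tk [[a1 a2 a3 a4] [a5 a6]]] := double_times g0 kJ.
  have [t0 t1 _ _] := tk b'; have [_ _ t2 t3] := tk b.
  move: prec out; rewrite mk mk' t0 t1 t2 t3 eqxx /=.
  by case: (eqVneq g J.+1) a4 a5 a6 => gE /=; case: b b' {t0 t1 t2 t3} => -[] //=; lia.
- have kJ : doubled g <= J by apply: length_doubled_le ml' => //; rewrite mk.
  have [tk [[a1 a2 a3 a4] [a5 a6]]] := double_times g0 kJ.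
  have [t0 t1 _ _] := tk b; have [_ _ t2 t3] := tk b'.
  move: prec out; rewrite mk mk' t0 t1 t2 t3.
  by case: (eqVneq g J.+1) a4 a5 a6 => gE /=; case: b b' {t0 t1 t2 t3} => -[] //=; lia.
Qed.


(* Passage m' of player b' of generation g' holds up player b of generation g at
   link j, at the stage before she can reach the end of this link. *)
Definition chain_blocker g b j (y : nat * bool * nat) : Prop := let: (g', b', m') := y in
  [/\ 0 < g', (g' < g) || [&& g' == g, g != J.+1, b & ~~ b'],
      m' < chain_length (doubled g'), chain_edge (doubled g') m' = j &
      arrival g b j.+1 <= (time g' b' m'.+1).+1].

(** Both units of capacity of link j are taken just before, either by one player crossing it twice
    or by the two mates of the preceding generation. *)
Lemma chain_blocked g b j : 0 < g -> 0 < j -> j <= J -> arrival g b j < arrival g b j.+1 ->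
  exists y1 y2, [/\ y1 != y2, chain_blocker g b j y1 & chain_blocker g b j y2].
Proof.
move=> g0 j0 jJ blk.
(* Outside generation J.+1, both crossings of a doubled link by the same player end at the same
   stage. *)
have twice g' b' : 0 < g' -> doubled g' = j -> g' != J.+1 ->
    (g' < g) || [&& g' == g, g != J.+1, b & ~~ b'] ->
    arrival g b j.+1 <= (arrival g' b' j.+1).+1 ->
    exists y1 y2, [/\ y1 != y2, chain_blocker g b j y1 & chain_blocker g b j y2].
  move=> g'0 kE gJ pr le; have kJ : doubled g' <= J by rewrite kE.
  exists (g', b', j), (g', b', j.+2); have [tk _] := double_times g'0 kJ.
  have [_ t1 _ t3] := tk b'; rewrite kE (negPf gJ) addn0 in t1 t3.
  split; first by rewrite xpair_eqE eqxx /=; lia.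
    by split=> //; rewrite ?t1 // kE /chain_length /chain_edge ?jJ ?leqnn //; lia.
  split=> //; rewrite ?t3 // kE /chain_length ?jJ //.
    by lia.
  by have [[]|[]|[_ ->]] := chain_edgeP J_ge2 j j.+2; lia.
(* The second mate of a generation that doubles link j waits for the first mate. *)
case: (boolP [&& b, doubled g == j & g != J.+1]) => [/and3P[bT /eqP kE gJ]|own].
  rewrite bT in twice *; apply: (twice g false) => //; first by rewrite eqxx gJ orbT.
  have kJ : doubled g <= J by rewrite kE.
  by have [_ [[_ _ _]]] := double_times g0 kJ; rewrite kE gJ => -> _; rewrite addn1.
have g1 : 1 < g.
  rewrite ltnNge; apply/negP => gle {twice}; have gE : g = 1 by lia.
  move: blk own; have [[_ -> _]|[]|[]|[]] := doubledP J_ge2 g0; [|lia|lia|lia].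
  rewrite gE; have [[? ->]|[? ? ->]|[? ? ->]|[? ? ? ->]] := arrivalP J_ge2 1 b j;
    have [[? ->]|[? ? ->]|[? ? ->]|[? ? ? ->]] := arrivalP J_ge2 1 b j.+1; case: (b); lia.
have g'0 : 0 < g.-1 by lia.
have gg : g.-1 < g by lia.
case: (boolP ((doubled g.-1 == j) && (g.-1 != J.+1))) => [/andP[/eqP kE gJ]|last].
  apply: (twice g.-1 true) => //; [by rewrite gg | move: own blk].
  have [[? dE _]|[? dE _]|[? dE _]|[? dE _]] := doubledP J_ge2 g'0; rewrite dE in kE;
  have [[? ->]|[? ? ->]|[? ? ->]|[? ? ? ->]] := arrivalP J_ge2 g b j.+1; try lia;
  have [[? ->]|[? ? ->]|[? ? ->]|[? ? ? ->]] := arrivalP J_ge2 g.-1 true j.+1; lia.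
have both m : m < chain_length (doubled g.-1) -> chain_edge (doubled g.-1) m = j ->
    (forall b', arrival g b j.+1 <= (time g.-1 b' m.+1).+1) ->
    exists y1 y2, [/\ y1 != y2, chain_blocker g b j y1 & chain_blocker g b j y2].
  move=> ml me le; exists (g.-1, false, m), (g.-1, true, m).
  by split; [rewrite !xpair_eqE eqxx | |]; split=> //; rewrite ?gg.
case: (eqVneq j (doubled g.-1)) => jk.
  (* Behind generation J.+1 it is the second crossings of both mates that block. *)
  have gJ : g.-1 = J.+1 by move: last; rewrite -jk eqxx negbK => /eqP.
  have kE : doubled g.-1 = J.-1 by have [[]|[]|[]|[]] := doubledP J_ge2 g'0; lia.
  apply: (both j.+2) => [||b'].
  - by rewrite /chain_length kE leq_pred; lia.
  - by have [[]|[]|[_ -> _]] := chain_edgeP J_ge2 (doubled g.-1) j.+2; lia.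
  have [|tk _] := double_times g'0; first by rewrite kE leq_pred.
  have [_ _ _] := tk b'; rewrite -jk gJ eqxx => ->.
  have [[? ->]|[? ? ->]|[? ? ->]|[? ? ? ->]] := arrivalP J_ge2 g b j.+1; try lia;
  have [[? ->]|[? ? ->]|[? ? ->]|[? ? ? ->]] := arrivalP J_ge2 J.+1 b' j.+1; lia.
have k0 := doubled_gt0 J_ge2 g'0; have kJ := doubled_le g.-1.
apply: (both (if j <= doubled g.-1 then j else j.+2)) => [||b'].
- by rewrite /chain_length; case: (leqP j); case: (leqP (doubled g.-1) J); lia.
- case: (leqP j (doubled g.-1)) => jk'; first by rewrite /chain_edge jk'.
  by have [[]|[]|[_ -> _]] := chain_edgeP J_ge2 (doubled g.-1) j.+2; lia.
apply: (@leq_trans (arrival g.-1 b' j.+1).+1).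
  move: blk own last; have [[? ->]|[? ? ->]|[? ? ->]|[? ? ? ->]] := arrivalP J_ge2 g b j.+1;
  have [[? ->]|[? ? ->]|[? ? ->]|[? ? ? ->]] := arrivalP J_ge2 g b j; try lia;
  have [[? ->]|[? ? ->]|[? ? ->]|[? ? ? ->]] := arrivalP J_ge2 g.-1 b' j.+1; try lia;
  have [[? dE _]|[? dE _]|[? dE _]|[? dE _]] := doubledP J_ge2 g0; rewrite ?dE;
  have [[? dE' _]|[? dE' _]|[? dE' _]|[? dE' _]] := doubledP J_ge2 g'0; rewrite ?dE'; lia.
rewrite ltnS; apply: leq_trans (time_ge_arrival _ _ _); apply: arrival_mono => //.
case: (leqP j (doubled g.-1)) => jk'.
  by rewrite /chain_vertex ltnS jk'.
by have [[]|[]|[_ _ ->]] := chain_edgeP J_ge2 (doubled g.-1) j.+3; lia.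
Qed.


End ChainQueues.

(** * The stages of first arrival as labels *)

Section ChainBarrier.
Variable J : nat.
Hypothesis J_ge2 : 1 < J.
Implicit Types (g j k m : nat) (b : bool).
Local Notation doubled := (doubled J).
Local Notation chain_length := (chain_length J).
Local Notation chain_edge := (chain_edge J).
Local Notation arrival := (chain_arrival J).
Local Notation time := (chain_time J).

Local Notation chain_blocker := (chain_blocker J).

Lemma edge_vertex g m : 0 < g -> chain_edge (doubled g) m <= J.+1 ->
  chain_vertex (doubled g) m = chain_edge (doubled g) m.
Proof.
move=> /(doubled_gt0 J_ge2).
by have [[? -> ->]|[? -> ->]|[? -> ->]] := chain_edgeP J_ge2 (doubled g) m; lia.
Qed.

Lemma blocker_before g b j g' b' m' : j <= J -> chain_blocker g b j (g', b', m') ->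
  time g' b' m' <= arrival g b j.
Proof.
move=> jJ [g'0 pr ml me _].
have <- : chain_vertex (doubled g') m' = j by rewrite edge_vertex // me; lia.
case/orP: pr => [gg|/and4P[/eqP gE gJ bT b'F]]; first exact: time_before.
by rewrite -gE in gJ *; rewrite bT (negPf b'F); apply: mate_before.
Qed.

(** The labels record first arrivals only, so the wait of generation J.+1 on its second crossing is
    a case apart. *)
Lemma time_blocked g b m : 0 < g -> m < chain_length (doubled g) ->
  time g b m + (m == 0) < time g b m.+1 ->
  (g = J.+1 /\ m = (doubled g).+2) \/
  [/\ 0 < chain_edge (doubled g) m, chain_edge (doubled g) m <= J,
      arrival g b (chain_edge (doubled g) m) <= time g b m &
      time g b m.+1 <= arrival g b (chain_edge (doubled g) m).+1].
Proof.
move=> g0 ml; have k0 := doubled_gt0 J_ge2 g0.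
have lo := time_ge_arrival J_ge2 g b m.
have [->|m0] := eqVneq m 0.
  rewrite (time0 J_ge2) /chain_time /chain_vertex /= (arrival1 J_ge2) //.
  have -> : (1 == J.+2) = false by lia.
  by rewrite andbF addn0 addn1 ltnn.
rewrite addn0 => blk.
have [mk|mk] := eqVneq m (doubled g).+2.
  have kJ : doubled g <= J by apply: (length_doubled_le J_ge2 _ _ ml) => //; rewrite mk.
  have [/(_ b)[_ _ t2 t3] _] := double_times J_ge2 g0 kJ.
  by move: blk; rewrite mk t2 t3; case: eqVneq; [left | rewrite addn0 ltnn].
have [mk'|mk'] := eqVneq m (doubled g).+1.
  have kJ : doubled g <= J.
    by move: ml mk'; have [[]|[]|[]|[]] := doubledP J_ge2 g0; lia.
  have [/(_ b)[_ t1 t2 _] _] := double_times J_ge2 g0 kJ.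
  by move: blk; rewrite mk' t1 t2 ltnn.
right.
have me : chain_edge (doubled g) m <= J.+1.
  move: ml mk'; have := doubled_le J_ge2 g; rewrite /chain_length.
  by have [[? -> _]|[? -> _]|[? -> _]] := chain_edgeP J_ge2 (doubled g) m;
    case: (leqP (doubled g) J); lia.
rewrite (edge_vertex g0 me) in lo.
have [_ vS] := vertex_next J_ge2 k0 me.
have mk2 : m.+1 != (doubled g).+2 by lia.
have hi : time g b m.+1 <= arrival g b (chain_edge (doubled g) m).+1.
  rewrite /chain_time (negPf mk2) vS; case: (eqVneq g J.+1) => [gE|_]; last by rewrite addn0.
  have kE : doubled g = J.-1 by have [[]|[]|[]|[]] := doubledP J_ge2 g0; lia.
  rewrite kE in mk2; have -> : (m.+1 == J.+2) = false by lia.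
  by rewrite addn0.
split=> //.
  by have [[? -> _]|[? -> _]|[? -> _]] := chain_edgeP J_ge2 (doubled g) m; lia.
rewrite leqNgt; apply/negP => jJ.
have eJ : chain_edge (doubled g) m = J.+1 by lia.
rewrite eJ in lo hi; have : arrival g b J.+2 = arrival g b J.+1; last by lia.
have [[? ->]|[? ? ->]|[? ? ->]|[? ? ? ->]] := arrivalP J_ge2 g b J.+1;
  have [[? ->]|[? ? ->]|[? ? ->]|[? ? ? ->]] := arrivalP J_ge2 g b J.+2; lia.
Qed.

(** For the return to vertex [doubled g], and for the second arrival at the vertex after it, m' is
    the first visit. *)
Lemma time_tight g b m : 0 < g -> m < chain_length (doubled g) ->
  exists m', [/\ m' < chain_length (doubled g),
    chain_vertex (doubled g) m'.+1 = chain_vertex (doubled g) m.+1 &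
    time g b m'.+1 <= arrival g b (chain_vertex (doubled g) m.+1)].
Proof.
move=> g0 ml; have k0 := doubled_gt0 J_ge2 g0.
have [mk|mk] := eqVneq m.+1 (doubled g).+2.
  exists (doubled g).-1; rewrite mk vertex_double prednK //.
  split; [by lia | by rewrite /chain_vertex leqW |].
  rewrite /chain_time ltn_eqF; last by lia.
  rewrite /chain_vertex leqW //; have := doubled_le J_ge2 g.
  by have [[]|[]|[]|[]] := doubledP J_ge2 g0; case: (eqVneq g J.+1); case: eqVneq; lia.
have [mk2|mk2] := eqVneq m (doubled g).+2.
  have kJ : doubled g <= J by apply: (length_doubled_le J_ge2 _ _ ml) => //; rewrite mk2.
  have [/(_ b)[_ t1 _ _] _] := double_times J_ge2 g0 kJ.
  have vE : chain_vertex (doubled g) m.+1 = (doubled g).+1.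
    by rewrite mk2; have [[]|[]|[_ _ ->]] := chain_edgeP J_ge2 (doubled g) (doubled g).+3; lia.
  exists (doubled g); rewrite t1 vE; split=> //; first by lia.
  by rewrite /chain_vertex leqnn.
exists m; split=> //; rewrite /chain_time (negPf mk).
have -> : (g == J.+1) && (m.+1 == J.+2) = false; last by rewrite addn0.
by have [[]|[]|[]|[]] := doubledP J_ge2 g0; lia.
Qed.

Lemma time_last g b : 0 < g ->
  time g b (chain_length (doubled g)) = arrival g b J.+2.
Proof.
move=> g0; have D := doubledP J_ge2 g0; rewrite /chain_time.
have -> : (chain_length (doubled g) == (doubled g).+2) = false by case: D => -[]; lia.
have -> : (g == J.+1) && (chain_length (doubled g) == J.+2) = false.
  by case: D => -[]; lia.
rewrite addn0; congr (arrival g b _).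
have [[? _ ->]|[? _ ->]|[? _ ->]] := chain_edgeP J_ge2 (doubled g) (chain_length (doubled g));
  by case: D => -[]; lia.
Qed.

(** The bypass, which leaves vertex 1, is never strictly faster than the chain. *)
Lemma arrival_out g b : 0 < g -> arrival g b J.+2 <= arrival g b 1 + J.+1.
Proof.
move=> g0; rewrite (@arrival1 _ J_ge2 g b g0).
by have [[? ->]|[? ? ->]|[? ? ->]|[? ? ? ->]] := arrivalP J_ge2 g b J.+2; case: b; lia.
Qed.

Lemma arrival_last g b : J.+2 < g -> arrival g b J.+2 = g + J.+2.
Proof.
by move=> ?; have [[? ->]|[? ? ->]|[? ? ->]|[? ? ? ->]] := arrivalP J_ge2 g b J.+2; lia.
Qed.

End ChainBarrier.

Lemma sum_le_seq (T : finType) (P : pred T) (F : T -> nat) (s : seq T) : uniq s ->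
  (forall x, P x -> x \in s) -> \sum_(x | P x) F x <= \sum_(x <- s) F x.
Proof.
move=> us Ps; rewrite [leqRHS](big_uniq _ us) big_mkcond [leqRHS]big_mkcond.
by apply: leq_sum => x _; case: ifP => // /Ps ->.
Qed.

Section Chain.
Variables (R : realType) (J : nat).
Hypothesis J_ge2 : 1 < J.

(* Forward links e -> e.+1 for e <= J.+1, then the backward links j.+1 -> j at
   label J.+1 + j for 0 < j <= J, and a bypass of the last J.+1 links. *)
Definition chain_tail e : nat := if e <= J.+1 then e else if e <= J.*2.+1 then e - J else 1.
Definition chain_head e : nat :=
  if e <= J.+1 then e.+1 else if e <= J.*2.+1 then e - J.+1 else J.+2.

Definition chain_on (E : {set 'I_(J.*2.+3)}) : prenetwork :=
  @Prenetwork 'I_J.+3 'I_(J.*2.+3) E (fun e => inord (chain_tail e))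
    (fun e => inord (chain_head e)) (inord 0) (inord J.+2)
    (fun e => if e == 0 :> nat then 1 else if e == J.*2.+2 :> nat then J.+1 else 0)
    (fun e => if e == J.*2.+2 :> nat then 4 else 2).

Definition chain := chain_on [set: 'I_(J.*2.+3)].
Definition link i : 'I_(J.*2.+3) := inord i.
Definition stop i : 'I_J.+3 := inord i.

Lemma linkK i : i <= J.*2.+2 -> link i = i :> nat.
Proof. by move=> h; rewrite /link inordK. Qed.

Lemma stopK i : i <= J.+2 -> stop i = i :> nat.
Proof. by move=> h; rewrite /stop inordK. Qed.

Lemma eq_stop i j : i <= J.+2 -> j <= J.+2 -> (stop i == stop j) = (i == j).
Proof. by move=> hi hj; rewrite -val_eqE /= !stopK. Qed.

Lemma chain_tail_le e : chain_tail e < J.+2.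
Proof. by rewrite /chain_tail; do 2?case: ifP; lia. Qed.

Lemma chain_head_le e : 0 < chain_head e <= J.+2.
Proof. by rewrite /chain_head; do 2?case: ifP; lia. Qed.

Lemma chain_edgeE g m : 0 < g -> m < chain_length J (doubled J g) ->
  [/\ chain_edge J (doubled J g) m <= J.*2.+1,
      chain_tail (chain_edge J (doubled J g) m) = chain_vertex (doubled J g) m &
      chain_head (chain_edge J (doubled J g) m) = chain_vertex (doubled J g) m.+1].
Proof.
move=> g0; have k0 := doubled_gt0 J_ge2 g0; have kJ := doubled_le J_ge2 g.
rewrite /chain_length /chain_tail /chain_head; case: (leqP (doubled J g) J) => kJ' ml.
  have [[? -> ->]|[? -> ->]|[? -> ->]] := chain_edgeP J_ge2 (doubled J g) m;
  have [[? _ ->]|[? _ ->]|[? _ ->]] := chain_edgeP J_ge2 (doubled J g) m.+1;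
  by split; repeat case: ifP; lia.
have [[? -> ->]|[? -> ->]|[? -> ->]] := chain_edgeP J_ge2 (doubled J g) m;
have [[? _ ->]|[? _ ->]|[? _ ->]] := chain_edgeP J_ge2 (doubled J g) m.+1;
by split; repeat case: ifP; lia.
Qed.

Section Subchain.
Variable E : {set 'I_(J.*2.+3)}.
Hypothesis E_forward : forall i, i <= J.+1 -> link i \in E.
Local Notation N := (chain_on E).

Lemma subchain_source_dest : source N != dest N.
Proof. by rewrite /= -/(stop 0) -/(stop _) eq_stop. Qed.

Lemma forward_walk i j : i <= j <= J.+2 ->
  walk (N := N) (stop i) (mkseq (fun l => link (i + l)) (j - i)) (stop j).
Proof.
move=> /andP[ij jJ].
have := @walk_mkseq N (fun l => link (i + l)) (fun l => stop (i + l)) (j - i).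
rewrite /= addn0 subnKC //; apply=> l lj; have lJ : i + l <= J.+1 by lia.
have lJ' : i + l <= J.*2.+2 by lia.
split; first exact: E_forward.
  by rewrite /= linkK // /chain_tail lJ.
by rewrite /= linkK // /chain_head lJ addnS.
Qed.

Definition straight_route : seq (edge N) := mkseq link J.+2.

Lemma straight_is_route : is_route straight_route.
Proof. by have := @forward_walk 0 J.+2 (leqnn _). Qed.

Lemma subchain_only_outgoing (v : vertex N) : only_outgoing v <-> v = source N.
Proof.
split=> [out|-> e _]; last first.
  by rewrite /= -/(stop _) -/(stop 0) eq_stop //; have := chain_head_le e; lia.
apply: val_inj; rewrite /= -/(stop 0) stopK //; apply/eqP; rewrite -leqn0 leqNgt.
apply/negP => v0; have vJ := ltn_ord v; have := out (link v.-1).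
rewrite E_forward; last lia.
move=> /(_ isT)/eqP; apply; apply: val_inj; rewrite /= linkK; last lia.
by rewrite /chain_head; case: ifP => [_|]; last lia; rewrite prednK // inordK.
Qed.

Lemma subchain_only_incoming (v : vertex N) : only_incoming v <-> v = dest N.
Proof.
split=> [inc|-> e _]; last first.
  by rewrite /= -/(stop _) -/(stop J.+2) eq_stop //; have := chain_tail_le e; lia.
apply: val_inj; rewrite /= -/(stop _) stopK //; have vJ := ltn_ord v.
apply/eqP; rewrite eqn_leq -ltnS vJ /= leqNgt.
apply/negP => v0; have := inc (link v); rewrite E_forward; last lia.
move=> /(_ isT)/eqP; apply; apply: val_inj; rewrite /= linkK; last lia.
by rewrite /chain_tail; case: ifP => [_|]; last lia; rewrite inordK.
Qed.

Lemma subchain_network : is_network N.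
Proof.
split; [exact: subchain_source_dest|exact: subchain_only_outgoing|exact: subchain_only_incoming|].
move=> v _ _; have vJ := ltn_ord v; have vE : v = stop v by apply: val_inj; rewrite /= inordK.
split; first by exists (mkseq (fun l => link (0 + l)) (v - 0));
  rewrite [v in X in walk _ _ X]vE; apply: forward_walk; lia.
by exists (mkseq (fun l => link (v + l)) (J.+2 - v)); rewrite {1}vE; apply: forward_walk; lia.
Qed.

End Subchain.
End Chain.

(** * Straight routes, the bypass, and removal of the other edges *)

Section ChainFlow.
Variables (R : realType) (J : nat).
Hypothesis J_ge2 : 1 < J.
Local Notation link := (link J).
Local Notation stop := (stop J).

Section Subchain.
Variable E : {set 'I_(J.*2.+3)}.
Hypothesis E_forward : forall i, i <= J.+1 -> link i \in E.
Local Notation N := (chain_on E).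

Let source_dest : source N != dest N := subchain_source_dest E.

Lemma subchain_source_edge e : tail (p := N) e = source N -> e = link 0.
Proof.
move/eqP; rewrite /= -/(stop _) -/(stop 0) eq_stop //; last by have := chain_tail_le J_ge2 e; lia.
have := ltn_ord e; rewrite /chain_tail => eJ te; apply: val_inj; rewrite /= linkK //.
by move: te; do 2?case: ifP; lia.
Qed.

Lemma subchain_capacity : net_capacity N = 2.
Proof.
apply: (@net_capacityE N (finset.set1 (link 0))) => //.
- split; first by rewrite finset.sub1set E_forward.
  move=> r rr; apply/hasP; have [e re] := lt_onth (walk_nonempty source_dest rr).
  exists e; last by rewrite finset.inE; apply/eqP/subchain_source_edge; exact: walk_tail rr re.
  by case: r re {rr} => //= x r [->]; exact: mem_head.
- rewrite /cut_capacity (eq_bigl (pred1 (link 0))) => [|e]; last by rewrite finset.inE.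
  by rewrite big_pred1_eq /= linkK.
move=> C [_ /(_ _ (straight_is_route J_ge2 E_forward))] /hasP[e _ eC].
by rewrite /cut_capacity (bigD1 _ eC) /=; case: ifP; lia.
Qed.

(** Apart from the bypass only link 0 costs anything, so all vertices but the source are at distance
    1. *)
Let dist (v : vertex N) : nat := v != stop 0.

Lemma chain_dist e : dist (tail e) + transit e = (if e == J.*2.+2 :> nat then J.+2 else 1).
Proof.
rewrite /dist /= -/(stop _) eq_stop //; last by have := chain_tail_le J_ge2 e; lia.
by have := ltn_ord e; rewrite /chain_tail; do ?case: ifP; lia.
Qed.

Lemma chain_dist_head e : dist (head e) = 1.
Proof. by rewrite /dist /= -/(stop _) eq_stop //; have := chain_head_le J_ge2 e; lia. Qed.

Lemma subchain_latency_ge (sigma : profile N 2) p : is_profile sigma ->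
  (1%:R%:E <= latency R sigma p)%E.
Proof.
move=> ps; rewrite -[X in (X%:R)%R](_ : dist (dest N) = _); last by rewrite /dist eq_stop.
apply: latency_ge_dist => // [|e _]; first by rewrite /dist eqxx.
by rewrite chain_dist chain_dist_head; case: ifP.
Qed.

Definition straight : profile N 2 := fun=> straight_route E.

Lemma straight_profile : is_profile straight.
Proof. by move=> p; apply: straight_is_route. Qed.

Lemma straight_onth p k e : onth (straight p) k = Some e -> k <= J.+1 /\ e = k :> nat.
Proof. by move=> /onth_mkseq[kJ ->]; rewrite linkK //; lia. Qed.

Lemma straight_free g e (L : seq (player 2 * nat)) : uniq L ->
  (forall qj, qj \in L -> qj.1.1 = g /\ onth (straight qj.1) qj.2 = Some e) ->
  size L <= capacity (p := N) e.
Proof.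
move=> uL sL; have sub : {subset L <= [seq ((g, i), e : nat) | i <- enum 'I_2]}.
  move=> [[g' i] j] /sL[/= -> /straight_onth[_ ->]].
  by apply/mapP; exists i => //; rewrite mem_enum.
apply: leq_trans (uniq_leq_size uL sub) _; rewrite size_map size_enum_ord /=.
by case: ifP.
Qed.

Lemma straight_dist q k e : onth (straight q) k = Some e ->
  dist (head e) = dist (tail e) + transit e.
Proof.
by move=> /straight_onth[kJ ek]; rewrite chain_dist chain_dist_head; case: ifP => //; lia.
Qed.

Lemma straight_UFR : straight \in @UFR R N 2.
Proof.
apply: (@free_flow_UFR R N 2 straight dist).
- exact: source_dest.
- exact: straight_profile.
- by rewrite /dist eqxx.
- by move=> e _; rewrite chain_dist chain_dist_head; case: ifP.
- exact: straight_dist.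
- exact: straight_free.
Qed.

Lemma straight_latency p : latency R straight p = 1%:R%:E.
Proof.
rewrite -[X in (X%:R)%R](_ : dist (dest N) = _); last by rewrite /dist eq_stop.
apply: free_flow_latency; [exact: source_dest | exact: straight_profile | by rewrite /dist eqxx
  | exact: straight_dist | exact: straight_free].
Qed.

End Subchain.

Definition bypass : seq 'I_(J.*2.+3) := [:: link 0; link J.*2.+2].

Lemma chain_upper (sigma : profile (chain J) 2) p : sigma \in @UFR R (chain J) 2 ->
  (latency R sigma p <= (J.+2)%:R%:E)%E.
Proof.
rewrite inE => -[[ps nash] _].
have l0 : link 0 = 0 :> nat by rewrite linkK.
have l1 : link J.*2.+2 = J.*2.+2 :> nat by rewrite linkK.
have t0 : chain_tail J (link 0) = 0 by rewrite /chain_tail l0.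
have h0 : chain_head J (link 0) = 1 by rewrite /chain_head l0.
have t1 : chain_tail J (link J.*2.+2) = 1.
  by rewrite /chain_tail l1; case: ifP; [lia | case: ifP; lia].
have h1 : chain_head J (link J.*2.+2) = J.+2.
  by rewrite /chain_head l1; case: ifP; [lia | case: ifP; lia].
have rb : is_route (N := chain J) bypass.
  by rewrite /is_route /= !finset.inE t0 h0 t1 h1 !eqxx.
apply: le_trans (nash p bypass rb) _.
have pd := is_profile_deviate p ps rb; set rho := deviate _ _ _ in pd *.
have out : only_outgoing (source (chain J)).
  by apply/(subchain_only_outgoing J_ge2) => // i _; rewrite finset.inE.
have rE : rho p = bypass by rewrite /rho deviate_eq.
have p0 : enters rho p 0 (depart p) by rewrite enters0.
have p1 : enters rho p 1 (depart p + 1).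
  have tr : transit (p := chain J) (link 0) = 1 by rewrite /= l0.
  rewrite -[X in _ + X]tr; apply: (no_queue_source pd out _ _ _ p0); rewrite ?rE //= ?l0 //.
have p2 : enters rho p 2 (depart p + 1 + J.+1).
  have tr : transit (p := chain J) (link J.*2.+2) = J.+1 by rewrite /= l1 eqxx.
  rewrite -[X in _ + X]tr; apply: (no_queue_inner pd _ _ _ p1); rewrite ?rE //.
    by rewrite /= t1 -/(stop 1) -/(stop 0) eq_stop.
  (* [link J.+2] is the backward link into vertex 1. With link 0 it is all that enters this vertex,
     whence the capacity 4 of the bypass. *)
  apply: (leq_trans (@sum_le_seq _ _ _ [:: link 0; link J.+2] _ _)).
  - by rewrite /= inE -val_eqE /= !linkK //; lia.
  - move=> f /andP[_]; rewrite /= t1 -/(stop _) -/(stop 1) eq_stop //;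
    last by have := chain_head_le J_ge2 f; lia.
    have := ltn_ord f; rewrite !inE -!val_eqE /= !linkK //; last lia.
    by rewrite /chain_head; case: ifP; [lia | case: ifP; lia].
  rewrite !big_cons big_nil /= !linkK //; last lia.
  by rewrite eqxx ifN /=; lia.
rewrite (@latency_finish R _ _ rho p (depart p + 1 + J.+1)); last by rewrite rE.
by rewrite lee_fin ler_nat; lia.
Qed.

Definition backward : {set edge (chain J)} := [set e : 'I_(J.*2.+3) | J.+1 < e]%SET.

Lemma forward_upper (sigma : profile (remove_edges backward) 2) p :
  sigma \in @UFR R (remove_edges backward) 2 -> (latency R sigma p <= 1%:R%:E)%E.
Proof.
pose E := (finset.setD [set: 'I_(J.*2.+3)] backward).
have EP e : (e \in E) = (e <= J.+1) by rewrite !finset.inE andbT -leqNgt.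
have EF i : i <= J.+1 -> link i \in E by move=> iJ; rewrite EP linkK //; lia.
rewrite -/(chain_on E) in sigma *; rewrite inE => -[[ps nash] _].
have rs := straight_is_route J_ge2 EF.
apply: le_trans (nash p _ rs) _.
have pd := is_profile_deviate p ps rs; set rho := deviate _ _ _ in pd *.
have out : only_outgoing (source (chain_on E)) by apply/(subchain_only_outgoing J_ge2).
have rE k : k <= J.+1 -> onth (rho p) k = Some (link k).
  by move=> kJ; rewrite /rho deviate_eq; apply/onth_mkseq.
have pk k : k <= J.+2 -> enters rho p k (depart p + (0 < k)).
  elim: k => [|k IH] kJ; first by rewrite addn0 enters0.
  have := IH (ltnW kJ); have [->|k0] := posnP k.
    rewrite addn0 => p0; have tr : transit (p := chain_on E) (link 0) = (0 < 1).
      by rewrite /= linkK.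
    by rewrite -[X in _ + X]tr; apply: (no_queue_source pd out _ _ _ p0); rewrite ?rE //= linkK.
  move=> pk; have -> : depart p + (0 < k.+1) = depart p + 1 + transit (p := chain_on E) (link k).
    by rewrite /= linkK; [case: ifP; [lia | case: ifP; lia] | lia].
  have tk : tail (p := chain_on E) (link k) = stop k.
    by rewrite /= linkK /chain_tail; [case: ifP => //; lia | lia].
  apply: (no_queue_inner pd _ _ _ pk); rewrite ?rE //.
    by rewrite tk -/(stop 0) eq_stop //; lia.
  apply: (leq_trans (@sum_le_seq _ _ _ [:: link k.-1] _ _)) => //.
    move=> f /andP[]; rewrite EP tk => fJ.
    rewrite /= -/(stop _) eq_stop; [|by have := chain_head_le J_ge2 f; lia | lia].
    by rewrite !inE -!val_eqE /= linkK /chain_head ?fJ; lia.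
  rewrite big_cons big_nil /= !linkK //; try lia.
  by case: ifP; case: ifP; lia.
have sz : size (rho p) = J.+2 by rewrite /rho deviate_eq size_mkseq.
rewrite (@latency_finish R _ _ rho p (depart p + 1)); last by rewrite sz; apply: pk.
by rewrite lee_fin ler_nat; lia.
Qed.

End ChainFlow.

Section TwoPlayers.
Implicit Types p q z : player 2.

Definition second p : bool := 0 < p.2.
Lemma prio_second q p :
  prio q p = (depart q < depart p) || ((depart q == depart p) && (second q < second p)).
Proof.
by case: q p => [g [[|[|]] ilt]] // [h [[|[|]] jlt]].
Qed.

Lemma eq_second q p : (q == p) = (depart q == depart p) && (second q == second p).
Proof.
case: q p => [g [[|[|]] ilt]] // [h [[|[|]] jlt]] //.
Qed.

(** [prio] is generated by the steps from the first mate to the second and from the second to the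
    first of the next generation. *)
Lemma prio_chain (P : player 2 -> player 2 -> Prop) :
  (forall p q z, P p q -> P q z -> P p z) -> (forall g, P (g, ord0) (g, ord_max)) ->
  (forall g, P (g, ord_max) (g.+1, ord0)) -> forall q p, prio q p -> P q p.
Proof.
move=> tr mate next; have up b g d : P (g, ord_max) ((g + d).+1, if b then ord_max else ord0).
  elim: d b => [|d IH] b.
    by rewrite addn0; case: b; [exact: (tr _ _ _ (next g) (mate _)) | exact: next].
  rewrite addnS; have le := tr _ _ _ (IH true) (next _).
  by case: b; [exact: (tr _ _ _ le (mate _)) | exact: le].
move=> [g i] [h j]; have -> : i = if second (g, i) then ord_max else ord0.
  by apply: val_inj; case: i => -[|[|]].
have -> : j = if second (h, j) then ord_max else ord0.
  by apply: val_inj; case: j => -[|[|]].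
move: (second _) (second _) => c b; rewrite /prio /= => /orP[gh|/andP[/eqP<-]]; last first.
  by case: b; case: c => // _; exact: mate.
have -> : h = (g + (h - g.+1)).+1 by lia.
have le := up c g (h - g.+1).
  by case: b => /=; [exact: le | exact: (tr _ _ _ (mate g) le)].
Qed.

End TwoPlayers.

(** * The congested profile of the chain *)

Section ChainCongestion.
Variables (R : realType) (J : nat).
Hypothesis J_ge2 : 1 < J.
Local Notation link := (link J).
Local Notation stop := (stop J).
Local Notation N := (chain J).
Local Notation doubled := (doubled J).
Local Notation chain_length := (chain_length J).
Local Notation chain_edge := (chain_edge J).
Local Notation arrival := (chain_arrival J).
Local Notation time := (chain_time J).
Implicit Types p q z : player 2.

Definition congested : profile N 2 := fun p =>
  mkseq (fun m => link (chain_edge (doubled (depart p)) m))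
    (chain_length (doubled (depart p))).

Definition chain_player g b : player 2 := (g.-1, if b then ord_max else ord0).
Definition congested_time p m : nat := time (depart p) (second p) m.

Lemma depart_chain_player g b : 0 < g -> depart (chain_player g b) = g.
Proof. by move=> g0; rewrite /depart /= prednK. Qed.

Lemma second_chain_player g b : second (chain_player g b) = b.
Proof. by case: b. Qed.

Definition chain_passage (y : nat * bool * nat) : player 2 * nat :=
  (chain_player y.1.1 y.1.2, y.2).

Lemma chain_passage_neq y1 y2 : 0 < y1.1.1 -> 0 < y2.1.1 -> y1 != y2 ->
  chain_passage y1 != chain_passage y2.
Proof.
case: y1 y2 => [[g b] m] [[g' b'] m'] /= g0 g0'; apply: contraNneq => e.
have /= p1 := congr1 fst e; have /= -> := congr1 snd e.
rewrite -(depart_chain_player b g0) -[X in (_, X, _)](second_chain_player g b) p1.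
by rewrite depart_chain_player // second_chain_player.
Qed.

Lemma congested_onth p m e : onth (congested p) m = Some e ->
  let k := doubled (depart p) in
  [/\ m < chain_length k, e = chain_edge k m :> nat,
      chain_tail J e = chain_vertex k m & chain_head J e = chain_vertex k m.+1].
Proof.
move=> /onth_mkseq[ml ->] k; have [el tl hl] := chain_edgeE J_ge2 (ltn0Sn p.1) ml.
by rewrite linkK; [split | rewrite -[p.1.+1]/(depart p) in el; lia].
Qed.

Lemma onth_congested p m : m < chain_length (doubled (depart p)) ->
  onth (congested p) m = Some (link (chain_edge (doubled (depart p)) m)).
Proof. by move=> ml; apply/onth_mkseq. Qed.

Lemma congested_profile : is_profile congested.
Proof.
move=> p; set k := doubled (depart p).
have := @walk_mkseq N (fun m => link (chain_edge k m)) (fun m => stop (chain_vertex k m))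
  (chain_length k).
have -> : stop (chain_vertex k (chain_length k)) = dest N.
  congr inord; rewrite /chain_length /chain_vertex.
  by case: (leqP k J) => kJ; case: ifP; have := doubled_le J_ge2 (depart p); lia.
have -> : stop (chain_vertex k 0) = source N by [].
apply=> m ml; have me := onth_congested ml.
by have [_ _ tl hl] := congested_onth me; rewrite finset.inE /= tl hl.
Qed.

Lemma congested_transit p m e : onth (congested p) m = Some e -> transit e = (m == 0).
Proof.
move=> me; have [ml eE _ _] := congested_onth me.
have [el _ _] := chain_edgeE J_ge2 (ltn0Sn p.1) ml; rewrite -[p.1.+1]/(depart p) -eE in el.
have k0 := doubled_gt0 J_ge2 (ltn0Sn p.1); rewrite -[p.1.+1]/(depart p) in k0.
have -> : (m == 0) = (e == 0 :> nat).
  by rewrite eE; have [[? -> _]|[? -> _]|[? -> _]] := chain_edgeP J_ge2 (doubled (depart p)) m;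
    lia.
rewrite /=; have -> : (e == J.*2.+2 :> nat) = false by lia.
by case: eqP.
Qed.

Lemma congested_capacity p m e : onth (congested p) m = Some e -> capacity e = 2.
Proof.
move=> me; have [ml eE _ _] := congested_onth me.
have [el _ _] := chain_edgeE J_ge2 (ltn0Sn p.1) ml; rewrite -[p.1.+1]/(depart p) -eE in el.
by rewrite /=; have -> : (e == J.*2.+2 :> nat) = false by lia.
Qed.

Lemma congested_schedule : schedule congested congested_time.
Proof.
split=> [q|q m e me|q m e L me uL sL].
- exact: time0.
- have [ml _ _ _] := congested_onth me.
  by rewrite (congested_transit me); apply: time_transit.
have [ml eE tE hE] := congested_onth me; have gq : 0 < depart q by [].
(* By [same_generation_ahead], c describes the only passage that can still be ahead of q when she
   exits. *)
pose c := if (m == (doubled (depart q)).+2) && (depart q != J.+1)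
  then (second q, doubled (depart q)) else (false, m).
rewrite (congested_capacity me) ltnS.
apply: (@uniq_leq_size _ L [:: (chain_player (depart q) c.1, c.2)] uL) => -[z j].
move=> /sL[_ /=]; rewrite me => je prec out; have gz : 0 < depart z by [].
have [jl eE' tE' hE'] := congested_onth je.
have [gg|gg|gg] := ltngtP (depart z) (depart q).
- suff : congested_time z j.+1 < congested_time q m.+1 by rewrite ltnNge out.
  by apply: exit_lt => //; rewrite -?eE -?eE' // -hE -hE'.
- have before : congested_time q m <= congested_time z j.
    apply: (leq_trans (time_before J_ge2 (second q) (second z) gq gg ml)).
    by rewrite -tE tE'; apply: time_ge_arrival.
  move: prec; rewrite /precedes prio_second eq_second; lia.
have := same_generation_ahead J_ge2 gq ml (b := second q) (b' := second z) (m' := j).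
rewrite gg in jl eE'; rewrite -eE' -eE -/c => /(_ jl erefl) cE.
rewrite inE xpair_eqE eq_second depart_chain_player // second_chain_player gg eqxx /=.
rewrite -xpair_eqE -surjective_pairing; apply/eqP/cE; last by rewrite -[in leqRHS]gg.
move: prec; rewrite /precedes prio_second eq_second gg ltnn eqxx /=.
by rewrite /congested_time gg.
Qed.

(** Stated for any Q that contains the blockers of its members, to serve both for the set of all
    players and for the barriers. *)
Lemma congested_blocked (Q : pred (player 2)) :
  (forall q g b, Q q -> 0 < g ->
     (g < depart q) || [&& g == depart q, depart q != J.+1, second q & ~~ b] ->
     Q (chain_player g b)) ->
  (forall q b, Q q -> depart q = J.+1 -> Q (chain_player J.+1 b)) ->
  blocked_by congested congested_time Q.
Proof.
move=> closed closed' q m e Qq me; have [ml eE _ _] := congested_onth me.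
have gq : 0 < depart q by []; rewrite (congested_transit me) => blk.
rewrite (congested_capacity me).
have [[gJ mE]|[j0 jJ lo hi]] := time_blocked J_ge2 gq ml blk.
  have kJ : doubled (depart q) <= J by apply: (length_doubled_le J_ge2 _ _ ml) => //; rewrite mE.
  have [tk [[_ a2 _ a4] [a5 _]]] := double_times J_ge2 gq kJ.
  have kl : doubled (depart q) < chain_length (doubled (depart q)) by rewrite mE in ml; lia.
  (* The second crossing of generation J.+1 waits for the first crossings of both mates, which fill
     the link one stage earlier. *)
  exists [:: (chain_player J.+1 false, doubled (depart q));
    (chain_player J.+1 true, doubled (depart q))].
  split=> //; first by rewrite /= inE xpair_eqE eq_second !second_chain_player andbF.
  have eE2 : chain_edge (doubled (depart q)) (doubled (depart q)) = e.
    rewrite eE mE; have [[]|[]|[_ -> _]] := chain_edgeP J_ge2 (doubled (depart q)) (doubled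
      (depart q)).+2; try lia.
    by rewrite /chain_edge leqnn; lia.
  have sub b : sched_ahead congested Q congested_time (congested_time q m.+1).-1 q m
      (chain_player J.+1 b, doubled (depart q)).
    have [t0 t1 _ _] := tk b; have [_ _ t2 t3] := tk (second q).
    have dE : depart (chain_player J.+1 b) = depart q by rewrite depart_chain_player.
    split=> /=; first exact: closed' gJ.
    - rewrite me onth_congested ?dE // eE2; congr Some; apply: val_inj.
      by rewrite /= linkK //; have := ltn_ord e; lia.
    - rewrite /precedes /congested_time dE second_chain_player t0 mE t2.
      by apply/orP; left; case: b {t0 t1 dE} => //=; case: (second q) {t2 t3}; move: a2 a4 a5;
        rewrite gJ eqxx; lia.
    - rewrite /congested_time dE second_chain_player t1 mE t3 gJ eqxx addn1 /=.
      by case: b {t0 t1 dE} => //=; case: (second q) {t2 t3}; move: a4; rewrite gJ eqxx; lia.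
  by move=> zj; rewrite !inE => /orP[|] /eqP->.
have blk' : arrival (depart q) (second q) (chain_edge (doubled (depart q)) m) <
    arrival (depart q) (second q) (chain_edge (doubled (depart q)) m).+1.
  by move: blk lo hi; rewrite /congested_time; lia.
have [y1 [y2 [yy c1 c2]]] := chain_blocked J_ge2 gq j0 jJ blk'.
exists [:: chain_passage y1; chain_passage y2]; split=> //.
  by rewrite /= inE andbT; apply: chain_passage_neq yy => //;
    [case: y1 c1 | case: y2 c2] => -[? ?] ? [].
have sub y : chain_blocker J (depart q) (second q) (chain_edge (doubled (depart q)) m) y ->
    sched_ahead congested Q congested_time (congested_time q m.+1).-1 q m (chain_passage y).
  case: y => -[g b] m' cy; have := blocker_before J_ge2 jJ cy;
    case: cy => g0 pr ml' me' le before.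
  have dE : depart (chain_player g b) = g by rewrite depart_chain_player.
  split=> /=.
  - exact: closed Qq g0 pr.
  - rewrite me onth_congested ?dE // me' -eE; congr Some; apply: val_inj.
    by rewrite /= linkK //; have := ltn_ord e; lia.
  - rewrite /precedes /congested_time dE second_chain_player prio_second dE second_chain_player.
    by move: pr lo before; case: b {c1 c2 dE le} => /=; lia.
  - rewrite /congested_time dE second_chain_player.
    by move: hi le; rewrite /congested_time; lia.
by move=> x; rewrite !inE => /orP[|] /eqP->; exact: sub.
Qed.

End ChainCongestion.

Section ChainEfficiency.
Variables (R : realType) (J : nat).
Hypothesis J_ge2 : 1 < J.
Local Notation link := (link J).
Local Notation stop := (stop J).
Local Notation N := (chain J).
Local Notation doubled := (doubled J).
Local Notation chain_length := (chain_length J).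
Local Notation chain_edge := (chain_edge J).
Local Notation arrival := (chain_arrival J).
Local Notation time := (chain_time J).
Local Notation congested := (congested J).
Local Notation congested_time := (congested_time J).
Implicit Types p q z : player 2.

Lemma congested_barrier p : exists Q a, barrier congested congested_time p Q a.
Proof.
(* The first mate belongs to the barrier of the second, except in generation J.+1, which
   [mate_before] does not cover. *)
pose Q q := (q.1 < p.1) || [&& q.1 == p.1, depart p != J.+1, second p & ~~ second q].
have gp : 0 < depart p by [].
exists Q, (fun v : 'I_J.+3 => arrival (depart p) (second p) v).
have Qmate q : Q q -> (depart q < depart p) \/ [/\ depart q = depart p, depart p != J.+1,
    second p = true & second q = false].
  by move=> /orP[?|/and4P[/eqP e -> -> /negPf ->]]; [left | right; rewrite /depart e].
have Qprio q z : Q q -> ~~ Q z -> prio q z.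
  move=> /Qmate[qp|[qp pJ bp bq]]; rewrite /Q prio_second /depart in qp *; first lia.
  by rewrite bp bq -[p.1.+1]/(depart p) (negPf pJ) qp; case: (second z); lia.
have dK v : v <= J.+2 -> (inord v : 'I_J.+3) = v :> nat by move=> h; rewrite inordK.
constructor=> //=.
- by rewrite /Q ltnn; case: (second p); rewrite ?andbF.
- apply: congested_blocked => // [q g b Qq g0 pr|q b Qq gJ].
    rewrite /Q second_chain_player /chain_player /=.
    move: pr; case: (Qmate q Qq) => [qp|[qp pJ bp bq]]; rewrite ?bq /depart in qp *; lia.
  rewrite /Q second_chain_player /chain_player /=.
  case: (Qmate q Qq) => [qp|[qp pJ _ _]]; last by rewrite -qp gJ eqxx in pJ.
  by rewrite /depart in gJ qp; lia.
- move=> z nQ; rewrite inordK // arrival0 //.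
  by move: nQ; rewrite /Q /depart; lia.
- move=> q m e Qq me; have [ml _ tE _] := congested_onth J_ge2 me.
  have := chain_tail_le J_ge2 e; rewrite tE dK => [tJ|]; last by have := chain_tail_le J_ge2 e;
    rewrite tE; lia.
  rewrite /congested_time; case: (Qmate q Qq) => [qp|[qp pJ bp bq]].
    exact: time_before.
  by rewrite bq bp -qp in pJ *; apply: mate_before.
- move=> e _; have eJ := ltn_ord e; have tJ := chain_tail_le J_ge2 e;
  have hJ := chain_head_le J_ge2 e.
  rewrite !dK; [|lia|lia].
  have [eq2|ne2] := eqVneq (e : nat) J.*2.+2.
    left; have -> : chain_tail J e = 1 by rewrite /chain_tail eq2; do 2?case: ifP; lia.
    have -> : chain_head J e = J.+2 by rewrite /chain_head eq2; do 2?case: ifP; lia.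
    by rewrite eq2 /=; apply: arrival_out.
  have [eF|eB] := leqP e J.+1; last first.
    left; have -> : chain_tail J e = e - J by rewrite /chain_tail; do 2?case: ifP; lia.
    have -> : chain_head J e = e - J.+1 by rewrite /chain_head; do 2?case: ifP; lia.
    by apply: leq_trans (leq_addr _ _); apply: arrival_mono => //; lia.
  have -> : chain_tail J e = e by rewrite /chain_tail eF.
  have -> : chain_head J e = e.+1 by rewrite /chain_head eF.
  have [e0|e0] := posnP e.
    by left; rewrite e0 arrival0 // (arrival1 J_ge2) // addn1.
  have [le|gt] := leqP (arrival (depart p) (second p) e.+1) (arrival (depart p) (second p) e).
    by left; apply: leq_trans le (leq_addr _ _).
  have eJ' : e <= J.
    rewrite leqNgt; apply/negP => h; have eE : e = J.+1 :> nat by lia.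
    move: gt; rewrite eE.
    have [[? ->]|[? ? ->]|[? ? ->]|[? ? ? ->]] := arrivalP J_ge2 (depart p) (second p) J.+1;
    have [[? ->]|[? ? ->]|[? ? ->]|[? ? ? ->]] := arrivalP J_ge2 (depart p) (second p) J.+2; lia.
  right; have [y1 [y2 [yy c1 c2]]] := chain_blocked J_ge2 gp e0 eJ' gt.
  have sub y : chain_blocker J (depart p) (second p) e y -> [/\ Q (chain_passage y).1,
      onth (congested (chain_passage y).1) (chain_passage y).2 = Some e &
      arrival (depart p) (second p) e.+1 <=
        (congested_time (chain_passage y).1 (chain_passage y).2.+1).+1].
    case: y => -[g b] m [g0 pr ml me le].
    have dE : depart (chain_player g b) = g by rewrite depart_chain_player.
    split=> /=.
    - by move: pr; rewrite /Q second_chain_player /depart /=; lia.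
    - rewrite onth_congested ?dE // me; congr Some; apply: val_inj.
      by rewrite /= linkK //; lia.
    - by rewrite /congested_time dE second_chain_player.
  exists [:: chain_passage y1; chain_passage y2]; split=> [||x].
  - by rewrite /= inE andbT; apply: chain_passage_neq yy => //;
    [case: y1 c1 | case: y2 c2] => -[? ?] ? [].
  - exact: isT.
  - by rewrite !inE => /orP[|] /eqP->; apply: sub.
- move=> m e me; have [ml _ _ hE] := congested_onth J_ge2 me.
  have [m' [ml' vE le]] := time_tight J_ge2 (second p) gp ml.
  have me' := onth_congested ml'.
  have [_ _ _ hE'] := congested_onth J_ge2 me'.
  exists m', (link (chain_edge (doubled (depart p)) m')); split=> //.
    by rewrite hE' vE hE.
  by rewrite hE dK // -hE; have := chain_head_le J_ge2 e; lia.
- by rewrite size_mkseq dK // /congested_time (time_last J_ge2).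
Qed.

Lemma congested_UFR : congested \in @UFR R N 2.
Proof.
apply: (certificate_UFR R (subchain_source_dest _) (congested_profile J_ge2)
  (congested_schedule J_ge2)); last exact: congested_barrier.
by apply: congested_blocked.
Qed.

Lemma congested_latency p : J.+2 <= p.1 -> latency R congested p = (J.+2)%:R%:E.
Proof.
move=> pJ; rewrite (schedule_latency R (congested_profile J_ge2) (congested_schedule J_ge2)).
  rewrite size_mkseq /congested_time time_last // arrival_last //.
  by rewrite /depart addKn.
by apply: congested_blocked.
Qed.

Lemma chain_efficiency :
  [/\ PoA R N 2 = (J.+2)%:R%:E, BR R N 2 = (J.+2)%:R%:E & PoS R N 2 = 1%E].
Proof.
have NE i : i <= J.+1 -> link i \in [set: 'I_(J.*2.+3)] by rewrite finset.inE.
have EF i : i <= J.+1 -> link i \in finset.setD [set: 'I_(J.*2.+3)] (backward J).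
  by move=> iJ; rewrite !finset.inE andbT -leqNgt linkK //; lia.
have lower (sigma : profile N 2) : is_profile sigma ->
    ((2 * 1)%N%:R%:E <= limn_einf (avg_latency R sigma))%E.
  move=> ps; apply: (@avg_einf_ge_latency R N 2 sigma 1 0) => p _.
  exact: subchain_latency_ge.
apply: (@efficiency R N 2 2 J.+2 (backward J) (straight _) congested).
- exact: isT.
- exact: ord0.
- exact: lower.
- exact: (straight_UFR R J_ge2 NE).
- apply: (@avg_esup_le R N 2 (straight _) 1) => p.
  by rewrite (straight_latency R J_ge2 NE).
- move=> sigma su; apply: (@avg_esup_le R N 2 sigma J.+2) => p; exact: chain_upper.
- exact: congested_UFR.
- apply: (@avg_einf_ge_latency R N 2 congested J.+2 J.+2) => p pJ.
  by rewrite congested_latency.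
- exact: finset.subsetT.
- by apply/eqP => /setP/(_ (link J.*2.+2)); rewrite !finset.inE linkK //; lia.
- exists (straight _); exact: (straight_UFR R J_ge2 EF).
- move=> sigma su; apply: (@avg_esup_le R _ 2 sigma 1) => p; exact: forward_upper.
Qed.

End ChainEfficiency.

(** * The Braess network *)

Section Braess.
Variable R : realType.

(* Vertices: (false, false) is the source, (true, false) = a and
   (false, true) = b are the two middle ones, and (true, true) is the
   destination.  Edges: Some (x, v) lies on the side v (of a or of b) and leaves
   the source if x is false; None is the edge from a to b. *)
Definition braess_tail (e : option (bool * bool)) : bool * bool :=
  if e is Some (x, v) then (x && ~~ v, x && v) else (true, false).
Definition braess_head (e : option (bool * bool)) : bool * bool :=
  if e is Some (x, v) then (x || ~~ v, x || v) else (false, true).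

Definition braess_on (E : {set option (bool * bool)}) : prenetwork :=
  @Prenetwork (bool * bool)%type (option (bool * bool)) E braess_tail braess_head
    (false, false) (true, true) (fun e => if e is Some (x, v) then x (+) v else false)
    (fun=> 1).

Definition braess := braess_on [set: option (bool * bool)].

Definition outer (v : bool) : seq (option (bool * bool)) :=
  [:: Some (false, v); Some (true, v)].
Definition zigzag : seq (option (bool * bool)) :=
  [:: Some (false, false); None; Some (true, true)].

Section Subnetwork.
Variable E : {set option (bool * bool)}.
Hypothesis E_outer : forall x, Some x \in E.
Local Notation N := (braess_on E).

Lemma braess_source_dest : source N != dest N. Proof. by []. Qed.

Lemma outer_is_route v : is_route (N := N) (outer v).
Proof. by rewrite /is_route /= !E_outer; case: v. Qed.

Lemma braess_routes r : is_route (N := N) r ->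
  [\/ r = outer false, r = outer true | r = zigzag /\ None \in E].
Proof.
have dP l : walk (N := N) (true, true) l (true, true) -> l = [::].
  by case: l => [//|[[[|] [|]]|] l] /and3P[].
have bP l : walk (N := N) (false, true) l (true, true) -> l = [:: Some (true, true)].
  by case: l => [//|[[[|] [|]]|] l] /and3P[] // _ _ /dP ->.
have aP l : walk (N := N) (true, false) l (true, true) ->
    l = [:: Some (true, false)] \/ l = [:: None; Some (true, true)] /\ None \in E.
  case: l => [//|[[[|] [|]]|] l] /and3P[] // lE _; first by move=> /dP ->; left.
  by move=> /bP ->; right.
case: r => [//|[[[|] [|]]|] r] /and3P[] // _ _; first by move=> /bP ->; apply: Or32.
by case/aP=> [->|[-> nE]]; [exact: Or31 | exact: Or33].
Qed.

Lemma braess_only_outgoing (v : vertex N) : only_outgoing v <-> v = source N.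
Proof.
split=> [out|-> [[[|] [|]]|] //].
case: v out => [[|] [|]] out //.
- by have := out _ (E_outer (true, true)).
- by have := out _ (E_outer (false, false)).
- by have := out _ (E_outer (false, true)).
Qed.

Lemma braess_only_incoming (v : vertex N) : only_incoming v <-> v = dest N.
Proof.
split=> [inc|-> [[[|] [|]]|] //].
case: v inc => [[|] [|]] inc //.
- by have := inc _ (E_outer (true, false)).
- by have := inc _ (E_outer (true, true)).
- by have := inc _ (E_outer (false, true)).
Qed.

Lemma braess_network : is_network N.
Proof.
split; [by []|exact: braess_only_outgoing|exact: braess_only_incoming|].
move=> [[|] [|]] // _ _; split.
- by exists [:: Some (false, false)]; rewrite /= E_outer.
- by exists [:: Some (true, false)]; rewrite /= E_outer.
- by exists [:: Some (false, true)]; rewrite /= E_outer.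
- by exists [:: Some (true, true)]; rewrite /= E_outer.
Qed.

Lemma braess_capacity : net_capacity N = 2.
Proof.
pose C : {set edge N} := [set Some (false, false); Some (false, true)]%SET.
apply: (@net_capacityE N C) => //.
- split; first by apply/fintype.subsetP => e; rewrite !finset.inE => /orP[] /eqP->;
  exact: E_outer.
  move=> r /braess_routes[->|->|[-> _]]; rewrite /= ?finset.inE //.
- by rewrite /cut_capacity finset.big_setU1 ?finset.inE //= finset.big_set1.
move=> C' [_ hit]; have /hasP[e eo eC] := hit _ (outer_is_route false).
have /hasP[f fo fC] := hit _ (outer_is_route true).
have ef : f != e by move: eo fo; rewrite !inE => /orP[] /eqP-> /orP[] /eqP->.
by rewrite /cut_capacity (bigD1 e) //= (bigD1 f) /= ?fC ?ef // addnA leq_addr.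
Qed.

Lemma top_no_queue (sigma : profile N 2) : is_profile sigma ->
  forall p k u, onth (sigma p) k = Some (Some (true, false)) -> enters sigma p k u ->
  enters sigma p k.+1 u.+1.
Proof.
move=> ps p k u ke ku; rewrite -[u.+1]addn1.
apply: (no_queue_inner ps _ _ ke ku) => //.
apply: (leq_trans (@sum_le_seq _ _ _ [:: Some (false, false)] _ _)) => //.
  by move=> [[[|] [|]]|] //=; rewrite ?andbF ?inE.
by rewrite big_cons big_nil.
Qed.

Lemma bottom_no_queue (sigma : profile N 2) : None \notin E -> is_profile sigma ->
  forall p k u, onth (sigma p) k = Some (Some (true, true)) -> enters sigma p k u ->
  enters sigma p k.+1 u.
Proof.
move=> nE ps p k u ke ku; rewrite -[u]addn0.
apply: (no_queue_inner ps _ _ ke ku) => //.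
apply: (leq_trans (@sum_le_seq _ _ _ [:: Some (false, true)] _ _)) => //.
  by move=> [[[|] [|]]|] //=; rewrite ?andbF ?inE // (negPf nE).
by rewrite big_cons big_nil.
Qed.

End Subnetwork.
End Braess.

(** * The optimum of the Braess network *)

Section BraessOptimum.
Variables (R : realType) (sigma : profile braess 2).
Hypothesis sigma_profile : is_profile sigma.
Implicit Types p q : player 2.

Let left_source T p : bool :=
  (onth (sigma p) 0 == Some (Some (false, false))) && (1 < size (hist sigma T p)).
Let left_dest T p : bool :=
  (onth (sigma p) (size (sigma p)).-1 == Some (Some (true, true))) &&
  (size (sigma p) < size (hist sigma T.+1 p)).

(* A player with latency less than 2 has left the edge source -> a or the edge
   b -> dest early, and the capacities limit how many players can do so. *)
Let latency_left T p : depart p <= T ->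
  ((2 - (left_source T p + left_dest T p))%:R%:E <= latency R sigma p)%E.
Proof.
move=> pT; apply: latency_ge => // x px; have p0 : enters sigma p 0 (depart p) by rewrite enters0.
have stay k y : enters sigma p k.+1 y -> forall s, (k.+1 < size (hist sigma s p)) || (s < y).
  move=> ky s; have [ys|_] := leqP y s; last by rewrite orbT.
  by rewrite orbF; apply/left_by; exists y.
have [y1 p1 y1x] := enters_prefix px (walk_nonempty (braess_source_dest _) (sigma_profile p)).
have l1 := stay _ _ p1 T; have lx : forall s, (size (sigma p) < size (hist sigma s p)) || (s < x).
  move: (walk_nonempty (braess_source_dest _) (sigma_profile p)) px.
  by case: (size (sigma p)) => // k _; exact: stay.
have {lx} := lx T.+1; move: px p1 p0; rewrite /left_source /left_dest.
case: (braess_routes (sigma_profile p)) => [rE|rE|[rE _]].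
- rewrite rE eqxx /= ?andbF => px p1 p0.
  have e1 : onth (sigma p) 1 = Some (Some (true, false)) by rewrite rE.
  have e0 : onth (sigma p) 0 = Some (Some (false, false)) by rewrite rE.
  by have := enters_transit px p1 e1; have := enters_transit p1 p0 e0; move: l1; rewrite /=; lia.
- rewrite rE eqxx /= => px p1 p0.
  have e1 : onth (sigma p) 1 = Some (Some (true, true)) by rewrite rE.
  have e0 : onth (sigma p) 0 = Some (Some (false, true)) by rewrite rE.
  by have := enters_transit px p1 e1; have := enters_transit p1 p0 e0; move: l1; rewrite /=; lia.
- rewrite rE eqxx /= => px p1 p0; have := enters_depart p1; move: l1; lia.
Qed.

(** Of the 2T players of T generations, at most T leave the edge to a by stage T and at most T.+1
    leave the edge from b to the destination by stage T.+1. The total latency is at least 4T - (2T +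
    1), so the defect is 1. *)
Lemma braess_lower : ((2 * 1)%N%:R%:E <= limn_einf (avg_latency R sigma))%E.
Proof.
apply: (@avg_einf_ge R braess 2 sigma 2 1) => T.
pose x p := 2 - (left_source T p + left_dest T p).
have few (left : pred (player 2)) k e m : (forall p, left p -> p \in players_upto 2 T ->
    onth (sigma p) (k p) = Some e /\ exists2 y, enters sigma p (k p).+1 y & 1 <= y < 1 + m) ->
    \sum_(p <- players_upto 2 T) left p <= m.
  move=> leftP; rewrite -[X in X <= _](_ : size [seq (p, k p) | p <- players_upto 2 T & left p]
    = _); last first.
    by rewrite size_map size_filter -sum1_count big_mkcond; apply: eq_bigr => p _; case: (left p).
  rewrite -[m]mul1n -[X in X * m]/(capacity e); apply: (@exits_between _ _ sigma e 1).
    rewrite map_inj_uniq; first exact/filter_uniq/uniq_players_upto.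
    by move=> p q [].
  by move=> _ /mapP[p + ->]; rewrite mem_filter => /andP[lp pin]; exact: leftP lp pin.
have fewS : \sum_(p <- players_upto 2 T) left_source T p <= T.
  apply: (few _ (fun=> 0) (Some (false, false))) => p /andP[/eqP e0 /left_by[y p1 yT]] _.
  by split=> //; exists y => //; have := enters_depart p1; rewrite /depart; lia.
have fewD : \sum_(p <- players_upto 2 T) left_dest T p <= T.+1.
  apply: (few _ (fun p => (size (sigma p)).-1) (Some (true, true))) => p /andP[/eqP e0 out] _.
  split=> //; move: out; have r0 := walk_nonempty (braess_source_dest _) (sigma_profile p).
  rewrite -{1}(prednK r0) => /left_by[y p1 yT].
  by exists y => //; have := enters_depart p1; rewrite /depart; lia.
have sumx : 2 * T <= \sum_(p <- players_upto 2 T) x p + 1.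
  have : \sum_(p <- players_upto 2 T) 2 <= \sum_(p <- players_upto 2 T) x p +
      (\sum_(p <- players_upto 2 T) left_source T p + \sum_(p <- players_upto 2 T) left_dest T p).
    by rewrite -!big_split /=; apply: leq_sum => p _; rewrite /x; lia.
  rewrite big_const_seq count_predT iter_addn_0 /players_upto size_allpairs size_iota
    size_enum_ord.
  rewrite -/(players_upto 2 T); lia.
apply: (@le_trans _ _ ((\sum_(p <- players_upto 2 T) x p)%N%:R%:E + 1%:R%:E)%E).
  by rewrite -EFinD -natrD lee_fin ler_nat.
rewrite leeD2r // /players_upto big_allpairs_dep /= natr_sum -sumEFin /index_iota subn0.
rewrite [leLHS]big_seq [leRHS]big_seq; apply: lee_sum => g; rewrite mem_iota => gT.
rewrite natr_sum -sumEFin /gen_latency big_enum /=; apply: lee_sum => i _.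
by apply: latency_left; rewrite /depart /=; lia.
Qed.

End BraessOptimum.

(** * Equilibria from labels when all capacities are 1 *)

Section Labels.
Variables (R : realType) (N : prenetwork) (delta : nat) (sigma : profile N delta).
Variable label : player delta -> vertex N -> nat.
Implicit Types p q z : player delta.

Hypothesis source_dest : source N != dest N.
Hypothesis capacity1 : forall e : edge N, capacity e = 1.
Hypothesis sigma_profile : is_profile sigma.
Hypothesis sigma_uniq : forall p, uniq (sigma p).
Hypothesis label_source : forall p, label p (source N) = depart p.
Hypothesis label_transit : forall p e, e \in sigma p ->
  label p (tail e) + transit e <= label p (head e).
Hypothesis label_mono : forall q p v, prio q p -> label q v <= label p v.
Hypothesis label_mono_strict : forall q p e, prio q p -> e \in sigma q -> e \in sigma p ->
  label q (head e) < label p (head e).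
Hypothesis label_edge : forall p e, e \in edges N ->
  label p (head e) <= label p (tail e) + transit e \/
  exists z, [/\ prio z p, e \in sigma z & label p (head e) <= (label z (head e)).+1].

Let S p k := if k is k'.+1 then
  (if onth (sigma p) k' is Some e then label p (head e) else 0) else depart p.

Let onth_in p k e : onth (sigma p) k = Some e -> e \in sigma p.
Proof.
move=> ke; have kl := onth_lt ke; move: ke; rewrite onthE (nth_map e) // => -[<-].
exact: mem_nth.
Qed.

Let in_onth p e : e \in sigma p -> exists k, onth (sigma p) k = Some e.
Proof.
move=> /(nthP e)[k kl ke]; exists k; by rewrite onthE (nth_map e) // ke.
Qed.

Let S_head p k e : onth (sigma p) k = Some e -> S p k.+1 = label p (head e).
Proof. by rewrite /S => ->. Qed.

Let S_tail p k e : onth (sigma p) k = Some e -> S p k = label p (tail e).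
Proof.
case: k => [|k] ke; first by rewrite (walk_tail (sigma_profile p) ke) label_source.
have [f kf] := lt_onth (ltnW (onth_lt ke)).
by rewrite (S_head kf) (walk_next (sigma_profile p) kf ke).
Qed.

(** With capacity 1 nobody may be ahead at the exit: a player of higher priority has left the edge
    strictly before, by [label_mono_strict], and one of lower priority does not enter it first. *)
Let S_schedule : schedule sigma S.
Proof.
split=> // [q k e ke|q k e L ke _ sL].
  by rewrite (S_tail ke) (S_head ke); apply/label_transit/onth_in/ke.
rewrite capacity1; case: L sL => [//|zj L] /(_ _ (mem_head _ _))[_ je prec out]; exfalso.
move: zj.1 zj.2 je prec out => z j; rewrite ke => je.
rewrite /precedes (S_tail ke) (S_tail je) (S_head ke) (S_head je) => prec out.
have [zq|zq] := eqVneq z q.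
  rewrite zq in je prec; move: prec; suff -> : j = k by rewrite !ltnn andbF orbF prio_irr andbF.
  apply/eqP; rewrite -(nth_uniq e (onth_lt je) (onth_lt ke)) ?sigma_uniq //.
  have jl := onth_lt je; have kl := onth_lt ke.
  by move: je ke; rewrite !onthE !(nth_map e) // => -[->] [->].
move: prec; rewrite (negPf zq) /= orbF; have /orP[zp|qz] := prio_total zq.
  by have := label_mono_strict zp (onth_in je) (onth_in ke); lia.
have := label_mono (tail e) qz; have : ~~ prio z q by apply/negP => /(prio_asym qz).
by move=> /negPf ->; rewrite andbF orbF; lia.
Qed.

Let S_blocked (Q : pred (player delta)) : (forall q z, Q q -> prio z q -> Q z) -> blocked_by
  sigma S Q.
Proof.
move=> closed q k e Qq ke; rewrite (S_tail ke) (S_head ke) => blk.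
have [|[z [zq ez le]]] := label_edge q (walk_edges (sigma_profile q) ke); first by lia.
have [j je] := in_onth ez; exists [:: (z, j)]; split=> //; first by rewrite capacity1.
move=> _ /[!inE]/eqP->; split; rewrite -?[(z, j).1]/z -?[(z, j).2]/j.
- exact: closed zq.
- by rewrite je ke.
- rewrite /precedes (S_tail je) (S_tail ke) zq.
  by have := label_mono (tail e) zq; lia.
- by rewrite (S_head je); lia.
Qed.

Let S_dest p : S p (size (sigma p)) = label p (dest N).
Proof.
have r0 := walk_nonempty source_dest (sigma_profile p).
have [e re] : exists e, onth (sigma p) (size (sigma p)).-1 = Some e.
  by apply: lt_onth; lia.
have := S_head re; rewrite prednK // => ->.
by rewrite (walk_last (sigma_profile p) re) // prednK.
Qed.

(** All players of higher priority than p form her set Q, so the labels yield both the timetable and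
    the barriers. *)
Lemma label_UFR : sigma \in @UFR R N delta.
Proof.
apply: (certificate_UFR R source_dest sigma_profile S_schedule); first exact: S_blocked.
move=> p; exists (fun q => prio q p), (label p); split=> //.
- by rewrite prio_irr.
- move=> q z qp zp; have [->//|zp'] := eqVneq z p; apply: prio_trans qp _.
  by have := prio_total zp'; rewrite (negPf zp).
- by apply: S_blocked => q z qp zq; exact: prio_trans zq qp.
- by move=> z; rewrite label_source /prio /depart; lia.
- by move=> q k e qp ke; rewrite (S_tail ke); apply: label_mono.
- move=> e /(label_edge p)[|[z [zp ez le]]]; first by left.
  have [j je] := in_onth ez; right; exists [:: (z, j)]; split=> //; first by rewrite capacity1.
  by move=> _ /[!inE]/eqP->; split; rewrite -?[(z, j).1]/z -?[(z, j).2]/j // (S_head je).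
- by move=> k e ke; exists k, e; rewrite (S_head ke).
- by rewrite S_dest.
Qed.

Lemma label_latency p : latency R sigma p = (label p (dest N) - depart p)%:R%:E.
Proof. by rewrite (schedule_latency R sigma_profile S_schedule) ?S_dest //; exact: S_blocked. Qed.

End Labels.

(** * The best and the worst equilibrium of the Braess network *)

Section BraessEquilibria.
Variable R : realType.
Implicit Types p q z : player 2.

Section Table.
Variables (route : nat -> bool -> seq (option (bool * bool))).
Variable times : nat -> bool -> nat * nat * nat.

Definition table_profile : profile braess 2 := fun p => route p.1 (second p).

Definition table_label p (v : vertex braess) : nat :=
  let: (ta, tb, td) := times p.1 (second p) in
  match v with
  | (false, false) => depart p
  | (true, false) => ta
  | (false, true) => tb
  | (true, true) => td
  end.

Lemma table_mono v q p :
  (forall g, table_label (g, ord0) v <= table_label (g, ord_max) v) ->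
  (forall g, table_label (g, ord_max) v <= table_label (g.+1, ord0) v) ->
  prio q p -> table_label q v <= table_label p v.
Proof.
move=> mate next; apply: (@prio_chain (fun q p => table_label q v <= table_label p v)) => //.
by move=> a b c; exact: leq_trans.
Qed.

End Table.

(* Only the first player profits from the edge from a to b. *)
Definition fast_route g b := if (g == 0) && ~~ b then zigzag else outer b.
Definition fast_times g b : nat * nat * nat :=
  if (g == 0) && ~~ b then (1, 1, 1) else if b then (g.+2, g.+2, g.+2) else (g.+1, g.+1, g.+2).

Definition fast := table_profile fast_route.

Lemma fast_profile : is_profile fast.
Proof.
move=> p; rewrite /fast /table_profile /fast_route.
by case: ifP => _; rewrite /is_route /= ?finset.inE //; case: (second p).
Qed.

(** After generation 0, the first player could still be at b as soon as at a, at stage g.+1, but at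
    that stage the last edge releases the second player of the preceding generation. So she gains
    nothing by the edge from a to b. *)
Lemma fast_equilibrium : fast \in @UFR R braess 2 /\ forall p, (latency R fast p <= 1%:R%:E)%E.
Proof.
pose L := @label_UFR R braess 2 fast (table_label fast_times).
have uniq p : uniq (fast p).
  by rewrite /fast /table_profile /fast_route; case: ifP => _; case: (second p).
have src p : table_label fast_times p (source braess) = depart p.
  by rewrite /table_label /=; case: (fast_times _ _) => [[? ?] ?].
have tra p (e : edge braess) : e \in fast p -> table_label fast_times p (tail e) + transit e <=
    table_label fast_times p (head e).
  case: p => g [[|[|]] ilt] //; rewrite /fast /table_profile /table_label /fast_route
    /fast_times /second /depart /=;
  by case: g => [|g]; case: e => [[[|] [|]]|]; rewrite /= ?inE //=; lia.
have mono q p (v : vertex braess) : prio q p -> table_label fast_times q v <= table_label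
  fast_times p v.
  apply: table_mono; rewrite /table_label /fast_times /second /depart /= => g.
    by case: v => [[|] [|]]; case: g => [|g] /=; lia.
  by case: v => [[|] [|]]; case: g => [|g] /=; lia.
have strict q p (e : edge braess) : prio q p -> e \in fast q -> e \in fast p ->
    table_label fast_times q (head e) < table_label fast_times p (head e).
  case: q p => [g [[|[|]] ilt]] // [h [[|[|]] jlt]] //;
    rewrite /prio /fast /table_profile /table_label /fast_route /fast_times /second /depart /=;
  by case: g => [|g]; case: h => [|h]; case: e => [[[|] [|]]|]; rewrite /= ?inE //=; lia.
have edge p (e : edge braess) : e \in edges braess ->
    table_label fast_times p (head e) <= table_label fast_times p (tail e) + transit e \/
    exists z, [/\ prio z p, e \in fast z & table_label fast_times p (head e) <= (table_label
      fast_times z (head e)).+1].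
  move=> _; pose z g b : player 2 := (g, if b then ord_max else ord0).
  case: p => g [[|[|]] ilt] //.
    case: e => [[[|] [|]]|]; rewrite /table_label /fast_times /second /depart /=; try by left;
      case: ifP => //=; lia.
    case: g => [|g] /=; first by left.
    right; exists (z g true); rewrite /prio /fast /table_profile /fast_route /= andbF /=;
      split=> //.
    by rewrite ltnSn.
  case: e => [[[|] [|]]|]; rewrite /table_label /fast_times /second /depart /= ?andbF;
    try by left; lia.
  right; exists (z g false); rewrite /prio /fast /table_profile /fast_route /second /= ltnn eqxx
    andbT.
  by split=> //; case: g ilt {z} => [|g] _ /=.
split; first by apply: L => //; exact: fast_profile.
move=> p; rewrite (@label_latency R braess 2 fast (table_label fast_times)) //;
  last exact: fast_profile.
rewrite lee_fin ler_nat /table_label /fast_times /depart /=.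
by case: (second p); case: (p.1) => [|g] /=; lia.
Qed.


(* The first four generations fill the queues, so that every later one finds two
   players ahead at a and one player on her way to b. *)
Definition slow_route g b : seq (option (bool * bool)) :=
  match g, b with
  | 0, _ | 1, true | 2, false | 3, true => zigzag
  | 1, false | 3, false => outer true
  | 2, true => outer false
  | _, _ => outer b
  end.

Definition slow_times g b : nat * nat * nat :=
  match g, b with
  | 0, false => (1, 1, 1)
  | 0, true => (2, 2, 2)
  | 1, false => (3, 3, 3)
  | 1, true => (3, 3, 4)
  | 2, false => (4, 4, 5)
  | 2, true => (5, 4, 6)
  | 3, false => (6, 5, 6)
  | 3, true => (6, 6, 7)
  | _, _ => ((g + b).+3, g.+2, g.+4)
  end.

Definition slow := table_profile slow_route.

Lemma slow_profile : is_profile slow.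
Proof.
move=> p; rewrite /slow /table_profile; move: (second p) (p.1) => b g.
by case: g => [|[|[|[|g]]]]; case: b; rewrite /is_route /= ?finset.inE.
Qed.

Lemma slow_equilibrium : slow \in @UFR R braess 2 /\
  forall p, 4 <= p.1 -> latency R slow p = 3%:R%:E.
Proof.
pose T := table_label slow_times.
have TE p v : T p v = table_label slow_times p v by [].
have uniq p : uniq (slow p).
  by rewrite /slow /table_profile; case: (second p); case: (p.1) => [|[|[|[|g]]]].
have src p : T p (source braess) = depart p.
  by rewrite TE /table_label /=; case: (slow_times _ _) => [[? ?] ?].
have tra p (e : edge braess) : e \in slow p -> T p (tail e) + transit e <= T p (head e).
  rewrite !TE; case: p => g [[|[|]] ilt] //; rewrite /slow /table_profile /table_label /second
    /depart /=;
  by case: g => [|[|[|[|g]]]]; case: e => [[[|] [|]]|]; rewrite /= ?inE //=; lia.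
have mono q p (v : vertex braess) : prio q p -> T q v <= T p v.
  apply: table_mono; rewrite /table_label /second /depart /= => g;
  by case: v => [[|] [|]]; case: g => [|[|[|[|g]]]] /=; lia.
have strict q p (e : edge braess) : prio q p -> e \in slow q -> e \in slow p ->
    T q (head e) < T p (head e).
  rewrite !TE; case: q p => [g [[|[|]] ilt]] // [h [[|[|]] jlt]] //;
    rewrite /prio /slow /table_profile /table_label /second /depart /=;
  by case: g => [|[|[|[|g]]]]; case: h => [|[|[|[|h]]]] //=; case: e => [[[|] [|]]|];
    rewrite /= ?inE //=; lia.
have edge p (e : edge braess) : e \in edges braess ->
    T p (head e) <= T p (tail e) + transit e \/
    exists z, [/\ prio z p, e \in slow z & T p (head e) <= (T z (head e)).+1].
  (* The blocker can always be chosen as the mate or a member of the preceding generation. *)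
  move=> _; pose ok z := [&& prio z p, e \in slow z & T p (head e) <= (T z (head e)).+1].
  suff : [|| T p (head e) <= T p (tail e) + transit e, ok (p.1, ord0), ok (p.1.-1, ord0) | ok
    (p.1.-1, ord_max)].
    by case/or4P=> [?|/and3P[]|/and3P[]|/and3P[]]; [left | right; eexists; split; eassumption ..].
  rewrite /ok !TE; case: p {ok} => g [[|[|]] ilt] //;
    rewrite /prio /slow /table_profile /table_label /second /depart /=;
  by case: g => [|[|[|[|[|g]]]]]; case: e => [[[|] [|]]|]; rewrite /= ?inE //=; lia.
split; first by apply: (@label_UFR R braess 2 slow T) => //; exact: slow_profile.
move=> p p4; rewrite (@label_latency R braess 2 slow T) //; last exact: slow_profile.
congr (_%:R%:E)%E; rewrite TE /table_label /depart /=.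
by move: p4; case: (second p); case: (p.1) => [|[|[|[|g]]]] //= _; lia.
Qed.

End BraessEquilibria.

(** * Queues on the two edges out of the source *)

Section BraessLoads.
Variables (R : realType) (E : {set option (bool * bool)}).
Hypothesis E_outer : forall x, Some x \in E.
Local Notation N := (braess_on E).
Variable sigma : profile N 2.
Hypothesis sigma_profile : is_profile sigma.
Implicit Types (p q z : player 2) (v : bool).

Let source_out : only_outgoing (source N). Proof. exact/(braess_only_outgoing E_outer). Qed.

Definition uses p v : bool := onth (sigma p) 0 == Some (Some (false, v)).

(* The players of the first g generations who are still on the first edge of
   side v when the players of generation g.+1 reach its head. *)
Definition load v g : nat := size (waiting sigma (Some (false, v) : edge N) g (g + v)).

(** The number of players whom p finds ahead of her on the first edge of side v, or would find there
    if she deviated to it. *)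
Definition load_ahead v p : nat := load v p.1 + (second p && uses (p.1, ord0) v).

Lemma players_upto2 g : players_upto 2 g.+1 = players_upto 2 g ++ [:: (g, ord0); (g, ord_max)].
Proof.
rewrite /players_upto -[g.+1]addn1 iotaD add0n allpairs_cat; congr (_ ++ _).
rewrite /= cats0 /=; have -> : enum 'I_2 = [:: ord0; ord_max] by apply: (inj_map val_inj);
  rewrite val_enum_ord.
by [].
Qed.

Lemma uses1 p : uses p true = ~~ uses p false.
Proof.
by rewrite /uses; case: (braess_routes (sigma_profile p)) => [->|->|[-> _]].
Qed.

(** One player leaves per stage if there is anybody to leave; the truncated predecessor keeps track
    of this. *)
Lemma load_next v g :
  load v g.+1 <= (load v g + (uses (g, ord0) v + uses (g, ord_max) v)).-1.
Proof.
have := @waiting_step N 2 sigma (Some (false, v)) sigma_profile source_out erefl erefl g.+1 isT.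
rewrite /= -/(load v g.+1) => /leq_trans; apply; rewrite -!subn1; apply: leq_sub2r.
rewrite /waiting players_upto2 filter_cat size_cat leq_add //= /waiting_at /uses.
by do 2?[case: ifP => /= [/andP[-> _]|_]]; rewrite ?addn0 ?leq_addl.
Qed.

Let predecessors v p : seq (player 2) := waiting sigma (Some (false, v) : edge N) p.1 (p.1 + v) ++
  (if second p && uses (p.1, ord0) v then [:: (p.1, ord0)] else [::]).

Let size_predecessors v p : size (predecessors v p) = load_ahead v p.
Proof. by rewrite /predecessors size_cat /load_ahead; congr (_ + _); case: ifP. Qed.

Let mem_predecessors v p z : (z \in predecessors v p) =
  prio z p && waiting_at sigma (Some (false, v) : edge N) (p.1 + v) z.
Proof.
have prioE : prio z p = (z.1 < p.1) || (second p && (z == (p.1, ord0))).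
  by case: z p => [g [[|[|]] ilt]] // [h [[|[|]] jlt]] //;
    rewrite /prio /second xpair_eqE -val_eqE /= ?andbT ?andbF.
have w0 : waiting_at sigma (Some (false, v) : edge N) (p.1 + v) (p.1, ord0) = uses (p.1, ord0) v.
  apply/idP/idP => [/andP[]//|/eqP u0].
  exact: (not_out_before (e := Some (false, v) : edge N) _ u0).
rewrite mem_cat mem_waiting prioE andb_orl; congr (_ || _).
case: ifP => [/andP[-> u0]|/negbT]; rewrite ?inE /=.
  by case: eqP => // ->; rewrite w0.
by case: (second p) => //=; case: eqP => // ->; rewrite w0 => /negPf ->.
Qed.

Lemma outer_exit_ge v p x : uses p v -> enters sigma p 1 x ->
  depart p + v + load_ahead v p <= x.
Proof.
move=> /eqP pe p1; rewrite -size_predecessors.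
apply: (first_exit_ge sigma_profile source_out _ _ pe p1) => //.
  rewrite cat_uniq uniq_waiting /=; case: ifP => _ //=; rewrite andbT orbF mem_waiting.
  by rewrite /depart ltnn.
by move=> z; rewrite mem_predecessors.
Qed.

(** The load is measured at stage [p.1 + v], hence no later than [depart p]; until then the
    deviation does not affect the players ahead of p. *)
Lemma deviation_exit_le v p : exists2 x, enters (deviate sigma p (outer v)) p 1 x &
  x <= depart p + v + load_ahead v p.
Proof.
set rho := deviate _ _ _; have same z : prio z p -> sigma z = rho z.
  by move=> zp; rewrite /rho deviate_neq //; apply: contraTneq zp => ->; rewrite prio_irr.
have pe : onth (rho p) 0 = Some (Some (false, v)) by rewrite /rho deviate_eq.
have rho_profile : is_profile rho by apply: is_profile_deviate => //; exact: outer_is_route.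
have := @first_exit_le N 2 rho (Some (false, v)) rho_profile source_out erefl erefl p
  (load_ahead v p) pe.
apply=> L uL sL; rewrite -size_predecessors; apply: uniq_leq_size => // z /sL/andP[zp /andP[ze
  out]].
rewrite mem_predecessors zp /waiting_at (same z zp) ze /=.
apply: contraTT out; rewrite -!ltnNge => /left_by[y z1 yp]; apply/left_by; exists y => //.
by apply/(agree_before same _ zp) => //; rewrite /depart; case: (v) yp => /=; lia.
Qed.

Lemma deviation_top p : (latency R (deviate sigma p (outer false)) p <= (load_ahead false
  p).+1%:R%:E)%E.
Proof.
set rho := deviate _ _ _; have [x p1 px] := deviation_exit_le false p.
have rho_profile : is_profile rho by apply: is_profile_deviate => //; exact: outer_is_route.
have rE : rho p = outer false by rewrite /rho deviate_eq.
have p2 : enters rho p 2 x.+1 by apply: (top_no_queue rho_profile _ p1); rewrite rE.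
rewrite (@latency_finish R _ _ rho p x.+1); last by rewrite rE.
by rewrite lee_fin ler_nat; move: px; rewrite addn0; lia.
Qed.

Lemma deviation_bottom p : None \notin E ->
  (latency R (deviate sigma p (outer true)) p <= (load_ahead true p).+1%:R%:E)%E.
Proof.
move=> nE; set rho := deviate _ _ _; have [x p1 px] := deviation_exit_le true p.
have rho_profile : is_profile rho by apply: is_profile_deviate => //; exact: outer_is_route.
have rE : rho p = outer true by rewrite /rho deviate_eq.
have p2 : enters rho p 2 x by apply: (bottom_no_queue nE rho_profile _ p1); rewrite rE.
rewrite (@latency_finish R _ _ rho p x); last by rewrite rE.
by rewrite lee_fin ler_nat; move: px; lia.
Qed.

Lemma outer_latency v p c : sigma p = outer v -> (latency R sigma p <= c%:R%:E)%E ->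
  load_ahead v p < c.
Proof.
move=> rE /(latency_le (sigma_profile p))[y]; rewrite rE => p2 yc.
have [x p1 _] := enters_prefix p2 (isT : 1 <= 2).
have e1 : onth (sigma p) 1 = Some (Some (true, v)) by rewrite rE.
have := enters_transit p2 p1 e1; have := @outer_exit_ge v p x _ p1.
by rewrite /uses rE eqxx => /(_ isT); case: (v) e1 => e1 /=; lia.
Qed.

End BraessLoads.

(** * Upper bounds on equilibrium latencies in the Braess network *)

Section BraessUpper.
Variables (R : realType) (E : {set option (bool * bool)}).
Hypothesis E_outer : forall x, Some x \in E.
Local Notation N := (braess_on E).
Variable sigma : profile N 2.
Hypothesis sigma_UFR : sigma \in @UFR R N 2.
Implicit Types (p q z : player 2) (v : bool).

Let sigma_profile : is_profile sigma. Proof. by move: sigma_UFR; rewrite inE => -[[]]. Qed.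

Let nash p v c : (latency R (deviate sigma p (outer v)) p <= c%:R%:E)%E ->
  (latency R sigma p <= c%:R%:E)%E.
Proof.
apply: le_trans; move: sigma_UFR; rewrite inE => -[[_ best] _].
by apply: best; exact: outer_is_route.
Qed.

Let second_case p : p = (p.1, ord0) \/ p = (p.1, ord_max).
Proof.
by case: p => g [[|[|]] ilt] //; [left | right]; congr (_, _); apply: val_inj.
Qed.

(** The invariant is that both loads vanish. The second player then finds one side free, and her
    latency of at most 1 forces her onto the side that her mate did not take, so both edges drain
    again. *)
Lemma outer_upper p : None \notin E -> (latency R sigma p <= 1%:R%:E)%E.
Proof.
move=> nE.
have top q : load_ahead sigma false q = 0 -> (latency R sigma q <= 1%:R%:E)%E.
  by move=> l0; apply: (@nash q false); have := deviation_top R E_outer sigma_profile q;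
    rewrite l0; exact.
have bottom q : load_ahead sigma true q = 0 -> (latency R sigma q <= 1%:R%:E)%E.
  by move=> l0; apply: (@nash q true); have := deviation_bottom R E_outer sigma_profile q nE;
    rewrite l0; exact.
have step g : load sigma false g = 0 /\ load sigma true g = 0 ->
    (latency R sigma (g, ord0) <= 1%:R%:E)%E /\ (latency R sigma (g, ord_max) <= 1%:R%:E)%E.
  move=> [lF lT]; split; first by apply: top; rewrite /load_ahead lF.
  case u0 : (uses sigma (g, ord0) false); last by apply: top; rewrite /load_ahead lF /= u0.
  by apply: bottom; rewrite /load_ahead lT /= (uses1 sigma_profile) u0.
have loads g : load sigma false g = 0 /\ load sigma true g = 0.
  elim: g => [//|g IH]; have [_ le1] := step g IH; have [lF lT] := IH.
  have nF := load_next E_outer sigma_profile false g;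
    have nT := load_next E_outer sigma_profile true g.
  have [v rE] : exists v, sigma (g, ord_max) = outer v.
    by case: (braess_routes (sigma_profile (g, ord_max))) => [->|->|[_ /negPf]];
      [exists false|exists true|rewrite (negPf nE)].
  have := outer_latency E_outer sigma_profile rE le1; rewrite ltnS leqn0 /load_ahead.
  have um w : uses sigma (g, ord_max) w = (w == v).
    by rewrite /uses rE /=; case: w; case: (v).
  move: nF nT; rewrite !um lF lT; case: v {rE um} => /=.
    by rewrite lT (uses1 sigma_profile); case: (uses _ _ _) => /=; lia.
  by rewrite lF (uses1 sigma_profile); case: (uses _ _ _) => /=; lia.
have [s1 s2] := step p.1 (loads p.1).
by case: (second_case p) => ->.
Qed.

(* The last edge of the deviating player p is used at stage depart p + 2 by the
   only player of the previous generations still there, who arrives in time. *)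
Let crowded_deviation g : let p : player 2 := (g, ord_max) in
  (forall q, q.1 < g -> (latency R sigma q <= 3%:R%:E)%E) ->
  load sigma false g = 2 -> load sigma true g = 0 -> uses sigma (g, ord0) false ->
  (latency R (deviate sigma p (outer true)) p <= 3%:R%:E)%E.
Proof.
move=> p in_time lF lT u0; set rho := deviate _ _ _.
have rho_profile : is_profile rho by apply: is_profile_deviate => //; exact: outer_is_route.
have rE : rho p = outer true by rewrite /rho deviate_eq.
have source_out : only_outgoing (source N) by exact/(braess_only_outgoing E_outer).
have same z : prio z p -> sigma z = rho z.
  by move=> zp; rewrite /rho deviate_neq //; apply: contraTneq zp => ->; rewrite prio_irr.
have later z : ~~ prio z p -> z != p -> g.+1 < depart z.
  case: z => h [[|[|]] jlt] //; rewrite /prio /depart /= xpair_eqE -val_eqE /=; lia.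
have [x p1 xle] := deviation_exit_le E_outer sigma_profile true p; rewrite -/rho in p1.
have p0 : enters rho p 0 (depart p) by rewrite enters0.
have e0 : onth (rho p) 0 = Some (Some (false, true) : edge N) by rewrite rE.
have xE : x = g.+2.
  have := enters_transit p1 p0 e0; move: xle; rewrite /load_ahead lT /= (uses1 sigma_profile) u0
    /depart /=; lia.
rewrite {}xE in p1 xle.
(* Agreement is needed one stage beyond [depart p], more than [agree_before] gives: in both profiles
   p stays on her first edge until g.+2, and later generations do not depart earlier. *)
have late (tau : profile N 2) : is_profile tau -> (forall y, enters tau p 1 y -> g.+2 <= y) ->
    not_overtaken (fun z => prio z p) g.+2 tau.
  move=> ptau lp q k u z j v qp zp ku uT; case: j => [|j] jv je.
    have [e ze] := lt_onth (walk_nonempty (braess_source_dest _) (ptau z)).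
    rewrite ze in je; have k0 := source_edge_first ptau source_out (esym je) (walk_tail (ptau z)
      ze).
    rewrite k0 enters0 in ku; rewrite enters0 in jv; rewrite (eqP ku) (eqP jv).
    by move: qp zp; rewrite /prio /depart; lia.
  have [y z1 yv] := enters_prefix jv (isT : 0 < j.+1).
  have [zE|zp'] := eqVneq z p; first by rewrite zE in z1; have := lp y z1; lia.
  by have := later z zp zp'; have := enters_depart jv; lia.
have agr z k y : prio z p -> y <= g.+2 -> enters sigma z k y <-> enters rho z k y.
  move=> zp yg; apply: (agree _ (late sigma _ _) (late rho _ _) same) => //.
  - move=> q z' qp z'p; have [->//|z'p'] := eqVneq z' p; apply: prio_trans qp _.
    by have := prio_total z'p'; rewrite (negPf z'p).
  - move=> y' p1'; case uF : (uses sigma p false).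
      have := outer_exit_ge E_outer sigma_profile uF p1'; rewrite /load_ahead lF /depart /=; lia.
    have uT : uses sigma p true by rewrite (uses1 sigma_profile) uF.
    have := outer_exit_ge E_outer sigma_profile uT p1'; rewrite /load_ahead lT /depart /=; lia.
  - by move=> y' /(enters_uniq p1) ->.
have e1 : onth (rho p) 1 = Some (Some (true, true) : edge N) by rewrite rE.
have [y p2 yle] : exists2 y, enters rho p 2 y & y <= g.+3 + 1.
  apply: (queue_release p1 e1) => //; first by rewrite /= addn0.
  move=> L uL sL; apply: (@exits_per_stage _ _ sigma (Some (true, true) : edge N) g.+3 L uL).
  move=> [z j] /sL[[v jv prec] je out]; rewrite -[(z, j).1]/z -[(z, j).2]/j in jv prec je out *.
  rewrite e1 in je.
  have zp : prio z p.
    apply/negPn/negP => zp; have [zE|zp'] := eqVneq z p.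
      rewrite zE rE in je; rewrite zE in jv prec.
      case: j je jv prec {out} => [|[|[|j]]] //= _ jv; rewrite (enters_uniq jv p1).
      by rewrite precedes_irr.
    have := later z zp zp'; have := enters_depart jv; move: prec.
    by rewrite /precedes (negPf zp) (negPf zp'); lia.
  have vg : v <= g.+2 by move: prec; rewrite /precedes; lia.
  have jv' : enters sigma z j v by apply/agr.
  have je' : onth (sigma z) j = Some (Some (true, true)) by rewrite (same z zp).
  have zg : z.1 < g.
    (* The mate has two players ahead of her on the edge to a and cannot be at b by stage g.+2. *)
    rewrite ltnNge; apply/negP => gz; have zE : z = (g, ord0).
      case: z zp gz {jv prec je out jv' je'} => h [[|[|]] jlt] //; rewrite /prio /= => hg gh.
        by congr (_, _); [lia | apply: val_inj].
      by lia.
    rewrite zE in jv' je'; move: u0 je' jv'; rewrite /uses.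
    case: j {je jv prec out} => [|j] /eqP e0'; first by rewrite e0'.
    move=> _ jv'; have [w w1 wv] := enters_prefix jv' (isT : 0 < j.+1).
    have := outer_exit_ge E_outer sigma_profile (introT eqP e0') w1.
    by rewrite /load_ahead lF /depart /=; lia.
  have [w zend wle] := latency_le (sigma_profile z) (in_time z zg).
  have jE : size (sigma z) = j.+1.
    move: je'; case: (braess_routes (sigma_profile z)) => [->|->|[-> _]].
    - by case: j {je jv prec out jv'} => [|[|[|j]]].
    - by case: j {je jv prec out jv'} => [|[|[|j]]].
    - by case: j {je jv prec out jv'} => [|[|[|[|j]]]].
  rewrite jE in zend; split=> //; suff <- : w = g.+3 by [].
  have wg3 : w <= g.+3 by apply: leq_trans wle _; rewrite -[g.+3]addn3 leq_add2r.
  have : g.+2 < w; last by lia.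
  rewrite ltnNge; apply/negP => wg; move/negP: out; apply; apply/left_by.
  by exists w => //; apply/(agr z j.+1 w zp wg).
rewrite (@latency_finish R _ _ rho p y); last by rewrite rE.
by rewrite lee_fin ler_nat /depart /=; lia.
Qed.

(** The invariant is a total load of at most 2. If both first edges have someone to release, two
    players arrive and two leave; the load can grow only if the two waiting players and both new
    ones share one edge. The second player then has three players ahead of her, which each of her
    three routes excludes. *)
Lemma zigzag_upper p : (latency R sigma p <= 3%:R%:E)%E.
Proof.
suff [] : (forall q, q.1 < p.1.+1 -> (latency R sigma q <= 3%:R%:E)%E) /\
    load sigma false p.1.+1 + load sigma true p.1.+1 <= 2 by move=> h _; exact: h.
move: p.1.+1 => g; elim: g => [|g [IH loads]]; first by split.
have first_le : (latency R sigma (g, ord0) <= 3%:R%:E)%E.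
  apply: (@nash (g, ord0) false); apply: (le_trans (deviation_top _ E_outer sigma_profile _)).
  by rewrite lee_fin ler_nat /load_ahead /=; lia.
have second_le : (latency R sigma (g, ord_max) <= 3%:R%:E)%E.
  have [few|many] := leqP (load_ahead sigma false (g, ord_max)) 2.
    apply: (@nash (g, ord_max) false); apply: (le_trans (deviation_top _ E_outer sigma_profile
      _)).
    by rewrite lee_fin ler_nat.
  apply: (@nash (g, ord_max) true); move: many; rewrite /load_ahead /= => many.
  by apply: crowded_deviation => //; move: many; case: (uses _ _ _) => /=; lia.
split.
  move=> q; rewrite ltnS leq_eqVlt => /orP[/eqP qg|]; last exact: IH.
  by case: (second_case q); rewrite qg => ->.
have nF := load_next E_outer sigma_profile false g;
  have nT := load_next E_outer sigma_profile true g.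
rewrite !(uses1 sigma_profile) in nT.
have [//|many] := leqP (load sigma false g.+1 + load sigma true g.+1) 2; exfalso.
case u2 : (uses sigma (g, ord_max) false); last first.
  have aT : load_ahead sigma true (g, ord_max) = 3.
    by rewrite /load_ahead /= (uses1 sigma_profile); move: nF nT; rewrite u2 /=;
      case: (uses _ _ _) => /=; lia.
  have rE : sigma (g, ord_max) = outer true.
    move: u2; rewrite /uses.
    by case: (braess_routes (sigma_profile (g, ord_max))) => [->|->|[->]].
  by have := outer_latency E_outer sigma_profile rE second_le; rewrite aT.
have aF : load_ahead sigma false (g, ord_max) = 3 /\ load_ahead sigma true (g, ord_max) = 0.
  by rewrite /load_ahead /= (uses1 sigma_profile); move: nF nT; rewrite u2 /=;
    case: (uses _ _ _) => /=; lia.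
have [rE|rE|[rE _]] := braess_routes (sigma_profile (g, ord_max)); last 1 first.
(* By the edge to a she reaches b no earlier than 3 stages after departure, by the direct edge after
   1. This is where an equilibrium has to be uniformly fastest and not merely Nash. *)
- move: sigma_UFR; rewrite inE => -[_ fastest].
  apply: (fastest (g, ord_max) (false, true) _); first by rewrite rE.
  exists (outer true); split; first exact: outer_is_route.
  have [x p1 xl] := deviation_exit_le E_outer sigma_profile true (g, ord_max).
  apply: (@le_lt_trans _ _ (depart (g, ord_max : 'I_2)).+1%:R%:E).
    apply: (@le_trans _ _ x%:R%:E); last by rewrite lee_fin ler_nat; move: xl; rewrite aF.2 /=;
      lia.
    have e0 : onth (deviate sigma (g, ord_max) (outer true) (g, ord_max)) 0 = Some (Some (false,
      true) : edge N).
      by rewrite deviate_eq.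
    by have := arrival_le R e0 p1.
  apply: (@lt_le_trans _ _ (depart (g, ord_max : 'I_2) + 3)%:R%:E).
    by rewrite lte_fin ltr_nat; lia.
  apply: arrival_ge => // k y e ke he ky.
  have k0 : 0 < k by case: k ke ky => //; rewrite rE /= => -[eE]; rewrite -eE in he.
  have [z z1 zy] := enters_prefix ky (ltnW k0 : 1 <= k.+1).
  by have := outer_exit_ge E_outer sigma_profile u2 z1; rewrite aF.1; lia.
- by have := outer_latency E_outer sigma_profile rE second_le; rewrite aF.1.
- by move: u2; rewrite /uses rE.
Qed.

End BraessUpper.

Section BraessEfficiency.
Variable R : realType.

Lemma split_UFR (E : {set option (bool * bool)}) : (forall x, Some x \in E) ->
  None \notin E -> exists sigma, sigma \in @UFR R (braess_on E) 2.
Proof.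
move=> E_outer nE; exists (fun p => outer (second p)).
(* The distance is 0 at the source and at a, 1 at b and at the destination; the edge from a to b
   would shorten it. *)
apply: (@free_flow_UFR R (braess_on E) 2 _ (fun v => v.2)) => //.
- by move=> p; apply: outer_is_route.
- by move=> [[[|] [|]]|] //=; rewrite (negPf nE).
- by move=> q [|[|[|k]]] e //= [<-] /=; case: (second q).
move=> g e L uL sL; apply: (@leq_trans 1) => //.
case: e sL => [[x v]|] sL; last first.
  case: L uL sL => // [[q [|[|[|j]]]] L] _ /(_ _ (mem_head _ _))[_] //=.
apply: (@uniq_leq_size _ L [:: ((g, if v then ord_max else ord0), x : nat)] uL) => -[q j] /sL[/=
  qg je].
rewrite inE; apply/eqP; congr (_, _); last by case: j je => [|[|[|j]]] //= [<- _].
have vE : second q = v by case: j je => [|[|[|j]]] //= [_ ->].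
by rewrite -vE -qg; case: q {vE qg je} => h [[|[|]] ilt] //; congr (_, _); apply: val_inj.
Qed.

Lemma braess_efficiency :
  [/\ PoA R braess 2 = 3%:R%:E, BR R braess 2 = 3%:R%:E & PoS R braess 2 = 1%E].
Proof.
have TE x : Some x \in [set: option (bool * bool)] by rewrite finset.inE.
pose F : {set edge braess} := finset.set1 None.
have FE x : Some x \in finset.setD [set: option (bool * bool)] F by rewrite !finset.inE.
have nF : None \notin finset.setD [set: option (bool * bool)] F by rewrite !finset.inE.
have [fast_eq fast_le] := fast_equilibrium R; have [slow_eq slow_late] := slow_equilibrium R.
apply: (@efficiency R braess 2 2 3 F fast slow).
- exact: isT.
- exact: ord0.
- by move=> sigma ps; have := braess_lower R ps.
- exact: fast_eq.
- exact: (avg_esup_le fast_le).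
- by move=> sigma su; apply: (@avg_esup_le R braess 2 sigma 3) => p; exact: zigzag_upper.
- exact: slow_eq.
- by apply: (@avg_einf_ge_latency R braess 2 slow 3 4) => p p4; rewrite slow_late.
- exact: finset.subsetT.
- by apply/eqP => /setP/(_ None); rewrite !finset.inE.
- exact: split_UFR.
- move=> sigma su; apply: (@avg_esup_le R _ 2 sigma 1) => p.
  exact: (outer_upper FE su p nF).
Qed.

End BraessEfficiency.

Local Open Scope ring_scope.

Theorem proposition5p5 (R : realType) (n : nat)
    (n_gt0 : (0 < n)%N) (n_even : ~~ odd n) :
  exists N : prenetwork,
    [/\ is_network N,
        #|vertex N| = n,
        PoA R N (net_capacity N) = (n%:R - 1)%:E,
        BR R N (net_capacity N) = (n%:R - 1)%:E
      & PoS R N (net_capacity N) = 1%E].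
Proof.
have [K nK] : exists K, n = K.+1 by exists n.-1; rewrite prednK.
rewrite nK -addn1 natrD addrK; case: (ltnP 5 n) => [n5|n5].
  pose J := (K - 2)%N; have KJ : K = J.+2 by rewrite /J; lia.
  have J2 : (1 < J)%N by rewrite /J; lia.
  have TE i : (i <= J.+1)%N -> link J i \in [set: 'I_(J.*2.+3)] by rewrite finset.inE.
  have [poa br pos] := chain_efficiency R J2; exists (chain J).
  rewrite (subchain_capacity J2 TE) KJ; split=> //; first exact: subchain_network.
  by rewrite card_ord addn1.
have : K = 1%N \/ K = 3%N by move: n_even; rewrite nK /= negbK; move: n5; rewrite nK;
  case: K {nK} => [|[|[|[|[|]]]]] //; [left|right].
case=> ->.
  have [poa br pos] := two_edges_efficiency R; exists two_edges.
  rewrite two_edges_capacity; split=> //; [exact: two_edges_network|exact: card_bool].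
have [poa br pos] := braess_efficiency R; exists braess.
have TE x : Some x \in [set: option (bool * bool)] by rewrite finset.inE.
rewrite (braess_capacity TE); split=> //; first exact: braess_network.
by rewrite card_prod card_bool.
Qed.
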